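(* Let $f:(0,\infty)\to\mathbb{R}$ be a locally integrable function whose Laplace transform $F(z)=\int_0^\infty e^{-zx}f(x)\,dx$ exists (is finite) for all $z>0$, let $f_n$ ($n\ge 1$) be the Gaver-Stehfest approximations of $f$, and let $x>0$. Then: (i) The convergence of $f_n(x)$ depends only on the values of $f$ in a neighborhood of $x$. That is, if $h:(0,\infty)\to\mathbb{R}$ is another locally integrable function whose Laplace transform exists for all $z>0$, with Gaver-Stehfest approximations $h_n$, and if $h=f$ on some neighborhood of $x$, then for every $c\in\mathbb{R}$ we have $f_n(x)\to c$ as $n\to+\infty$ if and only if $h_n(x)\to c$ as $n\to+\infty$. (ii) If for some $c\in\mathbb{R}$ and some $\epsilon\in(0,1/4)$ $$\int_0^{\epsilon}\left|f\left(-x\log_2\left(\tfrac12+v\right)\right)+f\left(-x\log_2\left(\tfrac12-v\right)\right)-2c\right|v^{-1}\,dv<\infty,$$ then $f_n(x)\to c$ as $n\to+\infty$. (iii) If $f$ has bounded variation in a neighborhood of $x$, then $f_n(x)\to \big(f(x+0)+f(x-0)\big)/2$ as $n\to+\infty$, where $f(x+0)$ and $f(x-0)$ are the right and left limits of $f$ at $x$.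
   Context: Integrals are Lebesgue integrals. For a function $f$ with Laplace transform $F$, the Gaver-Stehfest approximations are $$f_n(x):=\frac{\ln 2}{x}\sum_{k=1}^{2n}a_k(n)\,F\left(\frac{k\ln 2}{x}\right),\qquad n\ge 1,\ x>0,$$ where $$a_k(n):=\frac{(-1)^{n+k}}{n!}\sum_{j=[(k+1)/2]}^{\min(k,n)}j^{n+1}\binom{n}{j}\binom{2j}{j}\binom{j}{k-j},\qquad n\ge 1,\ 1\le k\le 2n,$$ and $[\cdot]$ denotes the integer part. The approximations $h_n$ of another function $h$ are defined in the same way from the Laplace transform of $h$. *)

(* Defs.v *)
From HB Require Import structures.
From mathcomp Require Import all_boot all_order all_algebra.
From mathcomp Require Import all_classical all_reals all_analysis.

Set Implicit Arguments.
Unset Strict Implicit.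
Unset Printing Implicit Defensive.
Import Order.TTheory GRing.Theory Num.Theory.
Import numFieldNormedType.Exports.

Local Open Scope classical_set_scope.
Local Open Scope ring_scope.

(* R with the sigma-algebra of Lebesgue (not only Borel) measurable sets, on
   which completed_lebesgue_measure is defined. *)
Notation lebesgueTypeR R := (caratheodory_type ((@wlength R idfun)^*)%mu).

Section gaver_stehfest.
Context {R : realType}.
Implicit Types (f : R -> R) (D : set R).

Local Notation lmeasure := (@completed_lebesgue_measure R).

(* A function on (0, +oo) is encoded by a total f : R -> R, whose values
   outside (0, +oo) are irrelevant. *)
Definition posR : set R := [set t | 0 < t].

(* Same as locally_integrable, for Lebesgue measurable functions instead of
   Borel measurable ones. *)
Definition llocally_integrable D f :=
  [/\ measurable_fun (D : set (lebesgueTypeR R)) (f : lebesgueTypeR R -> R),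
      open D
    & forall K : set R, K `<=` D -> compact K ->
        (\int[lmeasure]_(t in (K : set (lebesgueTypeR R))) `|f t|%:E < +oo)%E].

Definition laplace_exists f := forall z : R, 0 < z ->
  lmeasure.-integrable (posR : set (lebesgueTypeR R))
    (fun t => (expR (- (z * t)) * f t)%:E).

Definition laplace f (z : R) : R :=
  \int[lmeasure]_(t in (posR : set (lebesgueTypeR R))) (expR (- (z * t)) * f t).

Definition gs_coef (n k : nat) : R :=
  (-1) ^+ (n + k) / n`!%:R *
  \sum_(k.+1./2 <= j < (minn k n).+1)
    (j ^ n.+1 * 'C(n, j) * 'C(2 * j, j) * 'C(j, k - j))%:R.

Definition gaver_stehfest f (n : nat) (x : R) : R :=
  ln 2 / x *
  \sum_(1 <= k < (2 * n).+1) gs_coef n k * laplace f (k%:R * ln 2 / x).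

Definition log2 (y : R) : R := ln y / ln 2.

End gaver_stehfest.

(* Main.v *)
Require Import Defs.
From mathcomp Require Import all_boot all_order all_algebra.
From mathcomp Require Import all_classical all_reals all_analysis.
From mathcomp Require Import measurable_realfun.
From mathcomp Require Import ring lra.

Set Implicit Arguments.
Unset Strict Implicit.
Unset Printing Implicit Defensive.
Import Order.TTheory GRing.Theory Num.Theory.
Import numFieldNormedType.Exports.

Local Open Scope classical_set_scope.
Local Open Scope ring_scope.

(* Substituting [1/2 + v = 2^(- t / x)] in the Laplace integrals gives
   [f_n(x) = \int_(-1/2)^(1/2) u(v) (1/2 - v) K_n(v) dv], where
   [u(v) = f(- x log2(1/2 + v))] and [K_n(v) = 4 S_n(1 - 4 v^2)] for a polynomial
   [S_n]. Folding at [v = 0] and using [\int_0^(1/2) K_n = 1],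
     [f_n(x) - c = \int_0^(1/2) K_n(v) [(u(v) + u(-v) - 2 c) / 2 - v (u(v) - u(-v))] dv].
   Everything follows from three facts: [K_n -> 0] pointwise on [(0, 1/2]],
   [|K_n(v)| <= C / v], and the primitives of [K_n] are bounded. The first two give
   (ii) by dominated convergence, and (i) is (ii) for [f - h]; with the third one, the
   second mean value theorem gives (iii).

   The coefficients of [S_n] are those of [G_n(y) = [z^n] 1 / (1 - y z e^(1 - z)) / y]
   times [e^(-j) b_j j^(j+1) / j!] with [b_j = 'C(2 j, j) / 4^j]. The values [y G_n(y)]
   are those at integers of the solution of the delay equation
   [w'(t) = (1 - tau) w(t) - w(t - 1)], [tau = - ln y], which is bounded by a quadratic
   Lyapunov function, and the extra factors act boundedly on polynomials for the sup
   norms on all intervals [[0, Y]], being built from the multipliers [1 / (2 i + k)] by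
   sums, products and limits. *)

(** The delicate point is [y = 1], that is [v = 0]. Since [z e^(1 - z)] is stationary at [z = 1],
    the function [1 / (1 - y z e^(1 - z))] has a double pole there when [y = 1], and its
    coefficients grow linearly in [n]. For [y < 1] the pole splits into two at a distance of order
    [sqrt (1 - y)], which suggests a bound of order [1 / sqrt (1 - y)] uniform in [n]; with
    [1 - y = 4 v^2] this is [C / v]. For the delay equation [y -> 1] means [tau -> 0], so the
    constants are tracked in [tau], and [tau >= 1 - y] converts them back. At the other end the
    equation only controls [y G_n(y)], so for [y <= e^(-5)] the coefficients are estimated directly.
    The bounded primitives rest on a further property: the increments [S_(n+1) - S_n] stay bounded
    up to [y = 1], and [(n + 1) S_(n+1)] is the derivative of [y (S_(n+1) - S_n)]. *)

Section calculus.
Context {R : realType}.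
Implicit Types f g : R -> R.

Lemma is_derive1_ge0_le f df (a b : R) : a <= b ->
  (forall x, a <= x <= b -> is_derive x (1 : R) f (df x)) ->
  (forall x, a <= x <= b -> 0 <= df x) -> f a <= f b.
Proof.
move=> ab fd df0.
have cf : {within `[a, b], continuous f}.
  apply: derivable_within_continuous => x; rewrite in_itv/= => xab.
  by case: (fd x xab).
have [|c cab e] := @MVT_segment R f df a b ab _ cf.
  by move=> x; rewrite in_itv/= => /andP[ax xb]; apply: fd; rewrite !ltW.
rewrite -subr_ge0 e mulr_ge0 ?subr_ge0// df0 //.
Qed.

(** Plays the part of monotonicity of the integral: integral estimates for the delay equation are
    made by exhibiting primitives and comparing derivatives, which spares integrability
    conditions. *)
Lemma is_derive1_le f df g dg (a b : R) : a <= b ->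
  (forall x, a <= x <= b -> is_derive x (1 : R) f (df x)) ->
  (forall x, a <= x <= b -> is_derive x (1 : R) g (dg x)) ->
  (forall x, a <= x <= b -> df x <= dg x) -> f b - f a <= g b - g a.
Proof.
move=> ab fd gd dfg.
have : g a - f a <= g b - f b.
  apply: (@is_derive1_ge0_le (fun x => g x - f x) (fun x => dg x - df x)) => //.
    by move=> x xab; have := fd _ xab; have := gd _ xab => *; apply: is_deriveB.
  by move=> x xab; rewrite subr_ge0 dfg.
lra.
Qed.

Lemma is_derive1_eq f df g (a b : R) : a <= b ->
  (forall x, a <= x <= b -> is_derive x (1 : R) f (df x)) ->
  (forall x, a <= x <= b -> is_derive x (1 : R) g (df x)) ->
  f b - f a = g b - g a.
Proof.
by move=> ab fd gd; apply/eqP; rewrite eq_le; apply/andP; split;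
  apply: (is_derive1_le ab fd gd) || apply: (is_derive1_le ab gd fd).
Qed.

Lemma is_derive1_norm_le f df (M a b : R) : a <= b ->
  (forall x, a <= x <= b -> is_derive x (1 : R) f (df x)) ->
  (forall x, a <= x <= b -> `|df x| <= M) -> `|f b - f a| <= M * (b - a).
Proof.
move=> ab fd dfM.
have gd (c : R) x : is_derive x (1 : R) (fun x => c * x) c.
  by apply: is_derive_eq; rewrite /GRing.scale/= mulr1.
have h1 : f b - f a <= M * b - M * a.
  apply: (@is_derive1_le f df (fun x => M * x) (fun=> M)) => // x /dfM.
  by move/ler_normlP => [].
have h2 : (- M) * b - (- M) * a <= f b - f a.
  apply: (@is_derive1_le (fun x => - M * x) (fun=> - M) f df) => // x /dfM.
  by move/ler_normlP => []; rewrite lerNl.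
by rewrite ler_norml; apply/andP; split; lra.
Qed.

Lemma continuous_primitive f : continuous f ->
  exists F : R -> R, forall x : R, -1 < x -> is_derive x (1 : R) F (f x).
Proof.
move=> cf.
(* The base point [-1] keeps [0] in the interior, so that the derivative at [0] is two-sided. *)
exists (fun x => \int[lebesgue_measure]_(t in `[-1, x]) f t)%R => x x0.
have xx1 : x < x + 1 by rewrite ltrDl.
have fi : lebesgue_measure.-integrable `[-1, (x + 1)] (EFin \o f).
  apply: continuous_compact_integrable; first exact: segment_compact.
  by apply: continuous_subspaceT => ?; exact: cf.
have [Fd FE] := @continuous_FTC1_closed _ f (-1) x (x + 1) xx1 fi x0 (cf x).
by rewrite -FE derive1E; exact/derivableP.
Qed.

Lemma continuous_primitive01 f :
  (forall x : R, 0 <= x <= 1 -> {for x, continuous f}) ->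
  exists F : R -> R, forall x : R, 0 <= x <= 1 -> is_derive x (1 : R) F (f x).
Proof.
(* [f \o clamp] is continuous on the whole line and agrees with [f] on [[0, 1]]. *)
move=> cf; pose clamp (x : R) := Num.max 0 (Num.min x 1).
have clamp01 x : 0 <= clamp x <= 1.
  by rewrite /clamp le_max lexx/= ge_max ler01/= ge_min lexx orbT.
have clampid x : 0 <= x <= 1 -> clamp x = x.
  by move=> /andP[x0 x1]; rewrite /clamp (min_idPl x1) (max_idPr x0).
have cc : continuous clamp.
  move=> x; have c01 c : {for x, continuous (fun=> c : R^o)} by exact: cvg_cst.
  have cid : {for x, continuous (id : R -> R^o)} by exact: cvg_id.
  exact: (continuous_max (c01 0) (continuous_min cid (c01 1))).
have [|F Fd] := @continuous_primitive (f \o clamp).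
  by move=> x; apply: continuous_comp; [exact: cc|exact: cf].
exists F => x x01; rewrite -[in f x](clampid _ x01); apply: Fd.
by case/andP: x01 => x0 _; rewrite (lt_le_trans _ x0)// oppr_lt0.
Qed.

Lemma is_derive_monomial (a x : R) m :
  is_derive x (1 : R) (fun t => a * t ^+ m) (a * m%:R * x ^+ m.-1).
Proof.
have -> : (fun t : R => a * t ^+ m) = fun t => a * (id ^+ m) t.
  by apply/funext => s; rewrite exprfctE.
by apply: is_derive_eq; rewrite /GRing.scale/= mulr1 mulrA.
Qed.

End calculus.

(** * A Lyapunov function for a linear delay equation *)

Section delay.
Context {R : realType}.
(* Read as one function of [t = n + s], [w] solves [w' t = (1 - tau) * w t - w (t - 1)]. *)
Variables (tau : R) (w : nat -> R -> R).
Hypothesis tau_gt0 : 0 < tau.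
Hypothesis w0 : forall s, w 0 s = 0.
Hypothesis w10 : w 1 0 = 1.
Hypothesis w_glue : forall n, w n.+2 0 = w n.+1 1.
Hypothesis w_der : forall n (s : R),
  is_derive s (1 : R) (w n.+1) ((1 - tau) * w n.+1 s - w n s).

Variables W A B : nat -> R -> R.
Hypothesis W_der : forall n (s : R), 0 <= s <= 1 ->
  is_derive s (1 : R) (W n) (w n s).
Hypothesis A_der : forall n (s : R), 0 <= s <= 1 ->
  is_derive s (1 : R) (A n) (w n s ^+ 2).
Hypothesis B_der : forall n (s : R), 0 <= s <= 1 ->
  is_derive s (1 : R) (B n) (s * w n s ^+ 2).

(** With [t = n + 1 + s], [m] and [I] are the integrals of [w] and [w^2] over [[t - 1, t]], split at
    the integer [n + 1], and [X] is the integral of [(r - t + 1) w(r)^2] over the same interval.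
    Passing to [D = w - m] removes the delay: [D' = - tau w]. The weight in [X] is [0] at
    [r = t - 1] and [1] at [r = t], hence [X' = w^2 - I]. *)
Let m n s := (W n.+1 s - W n.+1 0) + (W n 1 - W n s).
Let D n s := w n.+1 s - m n s.
Let I n s := (A n.+1 s - A n.+1 0) + (A n 1 - A n s).
Let X n s := (1 - s) * (A n.+1 s - A n.+1 0) + (B n.+1 s - B n.+1 0)
  + (B n 1 - B n s) - s * (A n 1 - A n s).
Let V n s := D n s ^+ 2 + tau * X n s.

Let D_der n (s : R) : 0 <= s <= 1 ->
  is_derive s (1 : R) (D n) (- tau * w n.+1 s).
Proof.
move=> s01; have := w_der n s; have := W_der n s01; have := W_der n.+1 s01.
move=> *; rewrite /D /m; apply: is_derive_eq; rewrite /GRing.scale/=; ring.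
Qed.

Let X_der n (s : R) : 0 <= s <= 1 ->
  is_derive s (1 : R) (X n) (w n.+1 s ^+ 2 - I n s).
Proof.
move=> s01; have := A_der n s01; have := A_der n.+1 s01.
have := B_der n s01; have := B_der n.+1 s01.
move=> *; rewrite /X /I; apply: is_derive_eq; rewrite /GRing.scale/=; ring.
Qed.

Let V_der n (s : R) : 0 <= s <= 1 -> is_derive s (1 : R) (V n)
  (- tau * (w n.+1 s ^+ 2 - 2 * w n.+1 s * m n s + I n s)).
Proof.
move=> s01; have := D_der n s01; have := X_der n s01.
move=> *; rewrite /V; apply: is_derive_eq; rewrite /GRing.scale/= /D; ring.
Qed.

(** The right side is the integral of [(c - w)^2] over the last unit interval, taken on its two
    pieces. The choice [c = m n s] gives [m_sqr]. *)
Let cauchy_schwarz n s c : 0 <= s <= 1 -> 0 <= c ^+ 2 - 2 * c * m n s + I n s.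
Proof.
move=> /andP[s0 s1].
have key k (a b : R) : 0 <= a -> a <= b -> b <= 1 ->
    0 <= c ^+ 2 * (b - a) - 2 * c * (W k b - W k a) + (A k b - A k a).
  move=> a0 ab b1.
  pose F (x : R) := c ^+ 2 * x - 2 * c * W k x + A k x.
  have := @is_derive1_ge0_le R F (fun x => (c - w k x) ^+ 2) a b ab _ _.
  rewrite -subr_ge0 => /(_ _ _)/wrap[].
  - move=> x /andP[ax xb]; have x01 : 0 <= x <= 1 by apply/andP; split; lra.
    have := A_der k x01; have := W_der k x01 => *.
    rewrite /F; apply: is_derive_eq; rewrite /GRing.scale/=; ring.
  - by move=> x _; rewrite sqr_ge0.
  - by rewrite /F => h; lra.
have := key n.+1 0 s (lexx 0) s0 s1.
have := key n s 1 s0 s1 (lexx 1).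
by rewrite /m /I; lra.
Qed.

Let m_sqr n s : 0 <= s <= 1 -> m n s ^+ 2 <= I n s.
Proof. by move=> s01; have := cauchy_schwarz n (m n s) s01; lra. Qed.

Let D_glue n : D n.+1 0 = D n 1.
Proof. by rewrite /D /m w_glue; ring. Qed.

Let V_glue n : V n.+1 0 = V n 1.
Proof. by rewrite /V D_glue /X; ring. Qed.

(* [V] is nonincreasing, since [V' = - tau * \int (w t - w (t - s))^2 ds]. *)
Let V_noninc n (a b : R) : 0 <= a -> a <= b -> b <= 1 -> V n b <= V n a.
Proof.
move=> a0 ab b1.
rewrite -lerN2.
apply: (@is_derive1_ge0_le R (fun s => - V n s)
  (fun s => tau * (w n.+1 s ^+ 2 - 2 * w n.+1 s * m n s + I n s))) => //.
  move=> x /andP[ax xb]; have x01 : 0 <= x <= 1 by apply/andP; split; lra.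
  by have := V_der n x01 => *; apply: is_derive_eq; ring.
move=> x /andP[ax xb]; have x01 : 0 <= x <= 1 by apply/andP; split; lra.
by apply: mulr_ge0; [exact: ltW|exact: cauchy_schwarz].
Qed.

(** At [t = 1] the solution has just jumped from [0] to [1], so there [D = 1], [X = 0] and
    [V = 1]. *)
Let V_le1 n s : 0 <= s <= 1 -> V n s <= 1.
Proof.
move=> /andP[s0 s1]; apply: (@le_trans _ _ (V n 0)); first exact: V_noninc.
elim: n => [|n IH]; last by rewrite V_glue (le_trans _ IH)// V_noninc.
have W0 : W 0 1 = W 0 0.
  apply/eqP; rewrite -subr_eq0 -normr_le0.
  have := @is_derive1_norm_le R (W 0) (w 0) 0 0 1 ler01 (@W_der 0).
  by rewrite mul0r; apply => x x01; rewrite w0 normr0.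
have B0 : B 0 1 = B 0 0.
  apply/eqP; rewrite -subr_eq0 -normr_le0.
  have := @is_derive1_norm_le R (B 0) _ 0 0 1 ler01 (@B_der 0).
  rewrite mul0r; apply => x x01.
  by rewrite w0 expr0n mulr0 normr0.
rewrite /V /D /X /m w10 W0 B0; lra.
Qed.

(** The weight in [B] is at least [c] on [[a, b]]. This and its upper counterpart [BA'] turn the
    weighted integral [X] into estimates by [A]. *)
Let BA k c (a b : R) : 0 <= a -> a <= b -> b <= 1 -> c <= a ->
  c * (A k b - A k a) <= B k b - B k a.
Proof.
move=> a0 ab b1 ca.
have x01 x : a <= x <= b -> 0 <= x <= 1 by move=> /andP[ax xb]; apply/andP; split; lra.
rewrite -subr_ge0.
have := @is_derive1_ge0_le R (fun x => B k x - c * A k x)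
  (fun x => (x - c) * w k x ^+ 2) a b ab _ _.
rewrite -subr_ge0 => /(_ _ _)/wrap[].
- move=> x /x01 h; have := A_der k h; have := B_der k h => *.
  by apply: is_derive_eq; rewrite /GRing.scale/=; ring.
- by move=> x /andP[ax _]; rewrite mulr_ge0 ?sqr_ge0// subr_ge0 (le_trans ca).
- by move=> h; lra.
Qed.

Let BA' k c (a b : R) : 0 <= a -> a <= b -> b <= 1 -> b <= c ->
  B k b - B k a <= c * (A k b - A k a).
Proof.
move=> a0 ab b1 bc.
have x01 x : a <= x <= b -> 0 <= x <= 1 by move=> /andP[ax xb]; apply/andP; split; lra.
rewrite -subr_ge0.
have := @is_derive1_ge0_le R (fun x => c * A k x - B k x)
  (fun x => (c - x) * w k x ^+ 2) a b ab _ _.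
rewrite -subr_ge0 => /(_ _ _)/wrap[].
- move=> x /x01 h; have := A_der k h; have := B_der k h => *.
  by apply: is_derive_eq; rewrite /GRing.scale/=; ring.
- by move=> x /andP[_ xb]; rewrite mulr_ge0 ?sqr_ge0// subr_ge0 (le_trans xb).
- by move=> h; lra.
Qed.

Let A_inc k (a b : R) : 0 <= a -> a <= b -> b <= 1 -> 0 <= A k b - A k a.
Proof.
move=> a0 ab b1; rewrite subr_ge0.
apply: (@is_derive1_ge0_le R _ (fun x => w k x ^+ 2)) => // x /andP[ax xb].
  by apply: A_der; apply/andP; split; lra.
by rewrite sqr_ge0.
Qed.

Let X_ge0 n s : 0 <= s <= 1 -> 0 <= X n s.
Proof.
move=> /andP[s0 s1].
have := BA n s0 s1 (lexx 1) (lexx s).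
have := BA n.+1 (lexx 0) s0 s1 (lexx 0).
have := mulr_ge0 (_ : 0 <= 1 - s) (A_inc n.+1 (lexx 0) s0 s1).
rewrite subr_ge0 => /(_ s1); rewrite /X; lra.
Qed.

Let D_le1 n s : 0 <= s <= 1 -> D n s ^+ 2 <= 1.
Proof.
move=> s01; have := V_le1 n s01; have := X_ge0 n s01; rewrite /V => X0.
have := mulr_ge0 (ltW tau_gt0) X0; lra.
Qed.

Let X_le1 n s : 0 <= s <= 1 -> tau * X n s <= 1.
Proof. by move=> s01; have := V_le1 n s01; have := sqr_ge0 (D n s); rewrite /V; lra. Qed.

Let A_le n : tau * (A n 1 - A n 0) <= 4.
Proof.
case: n => [|n].
  have := @is_derive1_norm_le R (A 0) _ 0 0 1 ler01 (@A_der 0).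
  rewrite mul0r => /(_ _)/wrap[x _|]; first by rewrite w0 expr0n normr0.
  by rewrite normr_le0 => /eqP ->; rewrite mulr0.
have h0 : 0 <= 2^-1 :> R by rewrite invr_ge0.
have h1 : 2^-1 <= 1 :> R by rewrite invf_le1// ler1n.
have Xh : 2^-1 * (A n.+1 2^-1 - A n.+1 0) <= X n 2^-1.
  have := BA n h0 h1 (lexx 1) (lexx 2^-1).
  have := BA n.+1 (lexx 0) h0 h1 (lexx 0).
  by rewrite /X; lra.
have X1 : 2^-1 * (A n.+1 1 - A n.+1 2^-1) <= X n 1.
  have := BA n.+1 h0 h1 (lexx 1) (lexx 2^-1).
  have := BA n.+1 (lexx 0) h0 h1 (lexx 0).
  by rewrite /X; lra.
have := X_le1 n (_ : 0 <= 2^-1 <= 1); rewrite h0 h1 => /(_ isT) XH.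
have := X_le1 n (_ : 0 <= 1 <= 1); rewrite ler01 lexx => /(_ isT) XI.
have : tau * (2^-1 * (A n.+1 2^-1 - A n.+1 0) + 2^-1 * (A n.+1 1 - A n.+1 2^-1)) <= 2.
  rewrite mulrDr; apply: (@le_trans _ _ (tau * X n 2^-1 + tau * X n 1)).
    by rewrite lerD// ler_pM2l.
  by lra.
by lra.
Qed.

Let I_le n s : 0 <= s <= 1 ->
  I n s <= (A n.+1 1 - A n.+1 0) + (A n 1 - A n 0).
Proof.
move=> /andP[s0 s1]; have := A_inc n.+1 s0 s1 (lexx 1).
by have := A_inc n (lexx 0) s0 s1; rewrite /I; lra.
Qed.

Let X_le_I n s : 0 <= s <= 1 -> X n s <= I n s.
Proof.
move=> /andP[s0 s1].
have := BA' n s0 s1 (lexx 1) (lexx 1).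
have := BA' n.+1 (lexx 0) s0 s1 (lexx s).
have := mulr_ge0 s0 (A_inc n s0 s1 (lexx 1)).
by rewrite /X /I; lra.
Qed.

(** From [w = D + m]: [tau D^2 <= tau], and [tau m^2 <= tau I <= 8] because [I] is covered by two
    unit intervals, each of mass at most [4 / tau]. *)
Lemma delay_bounded n s : 0 <= s <= 1 -> tau * w n s ^+ 2 <= 2 * tau + 16.
Proof.
move=> s01; case: n => [|n]; first by rewrite w0 expr0n mulr0 addr_ge0// mulr_ge0// ltW.
have hI : tau * m n s ^+ 2 <= 8.
  apply: (@le_trans _ _ (tau * ((A n.+1 1 - A n.+1 0) + (A n 1 - A n 0)))).
    by rewrite ler_pM2l// (le_trans (m_sqr n s01))// I_le.
  by have := A_le n; have := A_le n.+1; lra.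
have : tau * D n s ^+ 2 <= tau by rewrite -[leRHS]mulr1 ler_pM2l// D_le1.
have := mulr_ge0 (ltW tau_gt0) (sqr_ge0 (D n s - m n s)).
rewrite (_ : w n.+1 s = D n s + m n s); last by rewrite /D subrK.
by move: (D n s) (m n s) hI => d k; lra.
Qed.

(** * Bounded increments of the solution *)

Section increment.
Hypothesis tau_le5 : tau <= 5.
Hypothesis w1_le : forall s, 0 <= s <= 1 -> `|w 1 s| <= 4.

Let p n s := (1 - tau) * w n.+1 s - w n s.

Let tauw_le n s : 0 <= s <= 1 -> tau * `|w n s| <= 12.
Proof.
move=> s01; have tau_ge0 := ltW tau_gt0.
rewrite -(@ler_pXn2r _ 2)// ?nnegrE ?mulr_ge0//.
rewrite exprMn real_normK ?num_real// expr2 -mulrA.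
(* [tau^2 w^2 <= tau (2 tau + 16) <= 5 * 26 = 130], below [12^2]. *)
apply: (@le_trans _ _ (5 * 26 : R)); last by rewrite -natrM -natrX ler_nat.
apply: ler_pM => //; first by rewrite mulr_ge0// sqr_ge0.
by have := delay_bounded n s01; have := tau_le5; lra.
Qed.

(** [p n] is the derivative of [w n.+1], and [w'(t) = (m - w(t - 1)) + (D - tau w(t))]. The second
    bracket is at most [1 + 12]. The first is the mean of [w(r) - w(t - 1)] over [[t - 1, t]], so a
    Lipschitz constant [P] bounds it by the integral of [P u] over [[0, 1]], which is [P / 2]. *)
Let p_le_half n (P s : R) : 0 <= s <= 1 ->
  (forall r, 0 <= r <= 1 -> `|p n r| <= P) ->
  (forall r, 0 <= r <= 1 -> `|p n.+1 r| <= P) ->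
  `|p n.+1 s| <= P / 2 + 13.
Proof.
move=> s01 pn pn1; case/andP: (s01) => s0 s1.
have P0 : 0 <= P by apply: le_trans (normr_ge0 _) (pn 0 _); rewrite lexx ler01.
have lip k (r r' : R) : (forall x, 0 <= x <= 1 -> `|p k x| <= P) ->
    0 <= r -> r <= r' -> r' <= 1 -> `|w k.+1 r' - w k.+1 r| <= P * (r' - r).
  move=> pk r0 rr' r1; apply: (@is_derive1_norm_le R _ (p k)) => // x /andP[rx xr].
  by apply: pk; apply/andP; split; lra.
pose c := w n.+1 s.
have sq (d x : R) : is_derive x (1 : R) (fun x => P / 2 * ((x + d) * (x + d))) (P * (x + d)).
  by apply: is_derive_eq; rewrite /GRing.scale/=; lra.
have lin (k : nat) (x : R) : 0 <= x <= 1 ->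
    is_derive x (1 : R) (fun x => W k x - c * x) (w k x - c).
  move=> x01; have := W_der k x01 => *.
  by apply: is_derive_eq; rewrite /GRing.scale/=; ring.
have linN (k : nat) (x : R) : 0 <= x <= 1 ->
    is_derive x (1 : R) (fun x => c * x - W k x) (c - w k x).
  move=> x01; have := W_der k x01 => *.
  by apply: is_derive_eq; rewrite /GRing.scale/=; ring.
have dist1 x : s <= x <= 1 -> `|w n.+1 x - c| <= P * (x + - s).
  by move=> /andP[sx x1]; exact: lip.
have dist2 x : 0 <= x <= s -> `|w n.+2 x - c| <= P * (x + (1 - s)).
  move=> /andP[x0 xs]; rewrite (_ : _ - _ = (w n.+2 x - w n.+2 0) + (w n.+1 1 - c)).
    rewrite (le_trans (ler_normD _ _))//.
    have := lip _ 0 x pn1 (lexx 0) x0 (le_trans xs s1).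
    have := lip _ s 1 pn s0 s1 (lexx 1).
    by rewrite /c; lra.
  by rewrite w_glue; ring.
have dist1' x : s <= x <= 1 -> `|c - w n.+1 x| <= P * (x + - s).
  by rewrite distrC; exact: dist1.
have dist2' x : 0 <= x <= s -> `|c - w n.+2 x| <= P * (x + (1 - s)).
  by rewrite distrC; exact: dist2.
have in1 x : s <= x <= 1 -> 0 <= x <= 1 by move=> /andP[? ?]; apply/andP; split; lra.
have in2 x : 0 <= x <= s -> 0 <= x <= 1 by move=> /andP[? ?]; apply/andP; split; lra.
have u1 := @is_derive1_le R _ _ _ _ s 1 s1 (fun x h => lin n.+1 x (in1 x h))
   (fun x _ => sq (- s) x).
have u2 := @is_derive1_le R _ _ _ _ 0 s s0 (fun x h => lin n.+2 x (in2 x h))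
   (fun x _ => sq (1 - s) x).
have l1 := @is_derive1_le R _ _ _ _ s 1 s1 (fun x h => linN n.+1 x (in1 x h))
   (fun x _ => sq (- s) x).
have l2 := @is_derive1_le R _ _ _ _ 0 s s0 (fun x h => linN n.+2 x (in2 x h))
   (fun x _ => sq (1 - s) x).
have {}u1 := u1 (fun x h => le_trans (ler_norm _) (dist1 x h)).
have {}u2 := u2 (fun x h => le_trans (ler_norm _) (dist2 x h)).
have {}l1 := l1 (fun x h => le_trans (ler_norm _) (dist1' x h)).
have {}l2 := l2 (fun x h => le_trans (ler_norm _) (dist2' x h)).
have mc : `|m n.+1 s - c| <= P / 2.
  rewrite ler_norml; apply/andP; split; last by rewrite /m; lra.
  by rewrite /m; lra.
have -> : p n.+1 s = (m n.+1 s - c) + (D n.+1 s - tau * w n.+2 s).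
  by rewrite /p /D /c; ring.
rewrite (le_trans (ler_normD _ _))// lerD//.
rewrite (le_trans (ler_normB _ _))// (_ : 13 = 1 + 12) ?lerD//.
- rewrite -(@ler_pXn2r _ 2)// ?nnegrE// real_normK ?num_real// expr1n.
  exact: D_le1.
- by rewrite normrM (ger0_norm (ltW tau_gt0)); exact: tauw_le.
Qed.

(** [26] solves [P = P / 2 + 13]. If the maximum [P] of [|p n.+1|] exceeded [26], it would also
    dominate [p n] by induction, and [p_le_half] would give [P <= P / 2 + 13]. *)
Let p_le26 n s : 0 <= s <= 1 -> `|p n s| <= 26.
Proof.
elim: n s => [s s01|n IH].
  rewrite /p w0 subr0 normrM (@le_trans _ _ (4 * 4))//; last by rewrite -natrM ler_nat.
  apply: ler_pM => //; last exact: w1_le.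
  by rewrite ler_norml; have := tau_gt0; have := tau_le5; move=> *; apply/andP; split; lra.
have cp : {within `[0, 1], continuous (fun s => `|p n.+1 s|)}.
  apply: continuous_subspaceT => x; apply: continuous_comp; last exact: norm_continuous.
  have wc k : {for x, continuous (w k.+1)}.
    have := w_der k x => -[dw _].
    by apply: differentiable_continuous; apply/derivable1_diffP.
  by apply: cvgB; [apply: cvgM; [exact: cvg_cst|exact: wc]|exact: wc].
have [c] := EVT_max ler01 cp; rewrite in_itv/= => c01 cmax s s01.
have {}cmax r : 0 <= r <= 1 -> `|p n.+1 r| <= `|p n.+1 c|.
  by move=> r01; apply: cmax; rewrite in_itv.
rewrite (le_trans (cmax _ s01))// leNgt; apply/negP => c26.
have := @p_le_half n `|p n.+1 c| c c01 _ cmax.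
move=> /(_ _)/wrap[r r01|]; first by rewrite (le_trans (IH _ r01))// ltW.
by move: c26; move: (`|p n.+1 c|) => z; lra.
Qed.

Lemma delay_increment_bounded n : `|w n.+2 0 - w n.+1 0| <= 26.
Proof.
rewrite w_glue.
have := @is_derive1_norm_le R (w n.+1) (p n) 26 0 1 ler01 (fun x _ => w_der n x).
by rewrite subr0 mulr1; apply => x; exact: p_le26.
Qed.

End increment.

(** * Exponential decay of the solution *)

Section decay.
Hypothesis tau_le5 : tau <= 5.
Variable C : nat -> R -> R.
Hypothesis C_der : forall n (s : R), 0 <= s <= 1 ->
  is_derive s (1 : R) (C n)
    ((w n.+1 s - ((W n.+1 s - W n.+1 0) + (W n 1 - W n s))) ^+ 2).

(** The integral of [D n ^ 2] over a unit interval, as [C n] is a primitive of [D n ^ 2]. *)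
Let d n := C n 1 - C n 0.

(** By [m_sqr], [- V' = tau (w^2 - 2 w m + I)] is at least [tau (w - m)^2 = tau D^2]: the loss of
    [V] controls [D]. *)
Let d_le n : tau * d n <= V n 0 - V n.+1 0.
Proof.
rewrite V_glue.
have := @is_derive1_le R (fun s => tau * C n s) (fun s => tau * D n s ^+ 2)
  (fun s => - V n s) (fun s => tau * (w n.+1 s ^+ 2 - 2 * w n.+1 s * m n s + I n s))
  0 1 ler01 _ _ _.
move=> /(_ _ _ _)/wrap[].
- move=> x x01; have := C_der n x01 => *.
  by apply: is_derive_eq; rewrite /GRing.scale/= /D /m; ring.
- move=> x x01; have := V_der n x01 => *.
  by apply: is_derive_eq; rewrite /GRing.scale/=; ring.
- move=> x x01; rewrite ler_pM2l//.
  by have := m_sqr n x01; rewrite /D; lra.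
by rewrite /d; lra.
Qed.

(** Integration of [D' = - tau w] over [[t - 1, t]]. In this way [D] alone controls [m], and then
    [w]. *)
Let D_step n s : 0 <= s <= 1 -> D n.+1 s - D n s = - tau * m n.+1 s.
Proof.
move=> /andP[s0 s1].
have x01 x : 0 <= x <= s -> 0 <= x <= 1 by move=> /andP[ax xb]; apply/andP; split; lra.
have := @is_derive1_eq R (fun s => D n.+1 s - D n s)
  (fun s => - tau * (w n.+2 s - w n.+1 s)) (fun s => - tau * m n.+1 s) 0 s s0 _ _.
move=> /(_ _ _)/wrap[].
- move=> x /x01 h; have := D_der n h; have := D_der n.+1 h => *.
  by apply: is_derive_eq; rewrite /GRing.scale/=; ring.
- move=> x /x01 h; have := W_der n.+1 h; have := W_der n.+2 h => *.
  by rewrite /m; apply: is_derive_eq; rewrite /GRing.scale/=; ring.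
have D1 : D n 1 - D n 0 = - tau * W n.+1 1 - (- tau * W n.+1 0).
  apply: (@is_derive1_eq R _ _ (fun s => - tau * W n.+1 s) 0 1 ler01 (@D_der n)).
  move=> x h; have := W_der n.+1 h => *.
  by apply: is_derive_eq; rewrite /GRing.scale/=; ring.
rewrite D_glue D1 /m; lra.
Qed.

(** By [D_step], [tau w(t) = tau (D + m) = (tau - 1) D(t) + D(t - 1)]. Its square is at most
    [2 (tau - 1)^2 D(t)^2 + 2 D(t - 1)^2], and [(tau - 1)^2 <= 16]. *)
Let w_sqr n s : 0 <= s <= 1 ->
  (tau * w n.+2 s) ^+ 2 <= 34 * (D n.+1 s ^+ 2 + D n s ^+ 2).
Proof.
move=> s01.
have -> : tau * w n.+2 s = (tau - 1) * D n.+1 s + D n s.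
  have -> : w n.+2 s = D n.+1 s + m n.+1 s by rewrite /D subrK.
  by have := D_step n s01; move: (D n.+1 s) (D n s) (m n.+1 s) => a b c; lra.
move: (D n.+1 s) (D n s) => a b.
have : (tau - 1) ^+ 2 * a ^+ 2 <= 16 * a ^+ 2.
  rewrite ler_wpM2r ?sqr_ge0//.
  by have := tau_gt0; have := tau_le5 => *; nra.
have := sqr_ge0 ((tau - 1) * a - b); have := sqr_ge0 a; have := sqr_ge0 b.
by lra.
Qed.

Let A_le_d n : tau ^+ 2 * (A n.+2 1 - A n.+2 0) <= 34 * (d n.+1 + d n).
Proof.
have := @is_derive1_le R (fun s => tau ^+ 2 * A n.+2 s) (fun s => (tau * w n.+2 s) ^+ 2)
  (fun s => 34 * (C n.+1 s + C n s)) (fun s => 34 * (D n.+1 s ^+ 2 + D n s ^+ 2))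
  0 1 ler01 _ _ _.
move=> /(_ _ _ _)/wrap[].
- move=> x x01; have := A_der n.+2 x01 => *.
  by apply: is_derive_eq; rewrite /GRing.scale/=; ring.
- move=> x x01; have := C_der n x01; have := C_der n.+1 x01 => *.
  by apply: is_derive_eq; rewrite /GRing.scale/= /D /m; ring.
- by move=> x; exact: w_sqr.
by rewrite /d; lra.
Qed.

Let V_le_d n : tau * V n.+3 0 <= tau * d n.+2 + 34 * (d n.+2 + 2 * d n.+1 + d n).
Proof.
set J := (A n.+3 1 - A n.+3 0) + (A n.+2 1 - A n.+2 0).
(* As [V] is nonincreasing, its value at the end of a unit interval is below its mean over that
   interval; the mean of [D^2] is [d n.+2], and [X <= I <= J]. *)
have step s : 0 <= s <= 1 -> V n.+3 0 <= D n.+2 s ^+ 2 + tau * J.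
  move=> s01; rewrite V_glue; case/andP: (s01) => s0 s1.
  rewrite (le_trans (V_noninc n.+2 s0 s1 (lexx 1)))// lerD2l ler_pM2l//.
  by rewrite (le_trans (X_le_I _ s01))// I_le.
have : V n.+3 0 <= d n.+2 + tau * J.
  have := @is_derive1_le R (fun s => V n.+3 0 * s) (fun=> V n.+3 0)
    (fun s => C n.+2 s + tau * J * s) (fun s => D n.+2 s ^+ 2 + tau * J)
    0 1 ler01 _ _ _.
  move=> /(_ _ _ _)/wrap[].
  - by move=> x x01; apply: is_derive_eq; rewrite /GRing.scale/= mulr1.
  - move=> x x01; have := C_der n.+2 x01 => *.
    by apply: is_derive_eq; rewrite /GRing.scale/= /D /m; ring.
  - by move=> x; exact: step.
  by rewrite /d; lra.
rewrite -(ler_pM2l tau_gt0); have := A_le_d n; have := A_le_d n.+1.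
rewrite /J; lra.
Qed.

Let d_ge0 n : 0 <= d n.
Proof.
rewrite subr_ge0; apply: (is_derive1_ge0_le ler01 (@C_der n)) => x _.
exact: sqr_ge0.
Qed.

(** Over three unit intervals [V] loses at least [tau (d n + d n.+1 + d n.+2)], while
    [tau * V n.+3 0] is at most [tau + 68] times the same sum. Hence
    [V n.+3 0 <= K (V n 0 - V n.+3 0)]. *)
Let V_decay (K : R) n : (tau + 68) <= K * tau ^+ 2 -> 0 <= K ->
  V n.+3 0 <= K / (1 + K) * V n 0.
Proof.
move=> hK K0.
have d0 := d_ge0 n; have d1 := d_ge0 n.+1; have d2 := d_ge0 n.+2.
have h1 := d_le n; have h2 := d_le n.+1; have h3 := d_le n.+2.
have h4 : tau * V n.+3 0 <= (tau + 68) * (d n + d n.+1 + d n.+2).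
  have := V_le_d n.
  have := mulr_ge0 (ltW tau_gt0) d0; have := mulr_ge0 (ltW tau_gt0) d1.
  by lra.
have h5 : tau ^+ 2 * V n.+3 0 <= tau ^+ 2 * (K * (V n 0 - V n.+3 0)).
  have -> : tau ^+ 2 * V n.+3 0 = tau * (tau * V n.+3 0) by ring.
  apply: (@le_trans _ _ (tau * ((tau + 68) * (d n + d n.+1 + d n.+2)))).
    by rewrite ler_pM2l.
  have -> : tau * ((tau + 68) * (d n + d n.+1 + d n.+2)) =
    (tau + 68) * (tau * (d n + d n.+1 + d n.+2)) by ring.
  have -> : tau ^+ 2 * (K * (V n 0 - V n.+3 0)) =
    (K * tau ^+ 2) * (V n 0 - V n.+3 0) by ring.
  apply: ler_pM => //.
  - by have := tau_gt0; lra.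
  - by apply: mulr_ge0; [exact: ltW|lra].
  - by lra.
have t2 : 0 < tau ^+ 2 by rewrite exprn_gt0.
have {}h5 : V n.+3 0 <= K * (V n 0 - V n.+3 0) by rewrite -(ler_pM2l t2).
have K1 : 0 < 1 + K by lra.
by rewrite mulrAC ler_pdivlMr//; lra.
Qed.

Lemma delay_decay (K : R) n : (tau + 68) <= K * tau ^+ 2 -> 0 <= K ->
  (tau * w n.+2 0) ^+ 2 <= 68 * (K / (1 + K)) ^+ (n %/ 3).
Proof.
move=> hK K0; set q := K / (1 + K).
have q0 : 0 <= q by rewrite divr_ge0// addr_ge0.
have s0 : 0 <= (0 : R) <= (1 : R) by rewrite lexx ler01.
have Vq k i : V (3 * k + i) 0 <= q ^+ k.
  elim: k => [|k IH]; first by rewrite muln0 expr0 V_le1.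
  rewrite exprS (_ : 3 * k.+1 + i = (3 * k + i).+3)%N; last by rewrite mulnS.
  by rewrite (le_trans (V_decay _ hK K0))// ler_wpM2l.
have Dq k : (n <= k)%N -> D k 0 ^+ 2 <= q ^+ (n %/ 3).
  move=> nk; apply: le_trans (Vq (n %/ 3)%N (k - 3 * (n %/ 3))%N).
  rewrite subnKC; last by rewrite (leq_trans _ nk)// mulnC leq_trunc_div.
  by rewrite /V lerDl mulr_ge0 ?X_ge0// ltW.
rewrite (le_trans (w_sqr n s0))//.
have := Dq n (leqnn n); have := Dq n.+1 (leqnSn n); lra.
Qed.

End decay.

End delay.

(** Supplies, by continuity, the primitives that the section takes as variables; [C] comes last
    because its integrand contains [W]. *)
Lemma delay_solution_bounds {R : realType} (tau : R) (w : nat -> R -> R) :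
  0 < tau -> (forall s, w 0 s = 0) -> w 1 0 = 1 ->
  (forall n, w n.+2 0 = w n.+1 1) ->
  (forall n (s : R),
    is_derive s (1 : R) (w n.+1) ((1 - tau) * w n.+1 s - w n s)) ->
  [/\ forall n s, 0 <= s <= 1 -> tau * w n s ^+ 2 <= 2 * tau + 16,
      tau <= 5 -> (forall s, 0 <= s <= 1 -> `|w 1 s| <= 4) ->
        forall n, `|w n.+2 0 - w n.+1 0| <= 26 &
      tau <= 5 -> forall K n, tau + 68 <= K * tau ^+ 2 -> 0 <= K ->
        (tau * w n.+2 0) ^+ 2 <= 68 * (K / (1 + K)) ^+ (n %/ 3)].
Proof.
move=> tau0 w0 w10 wg wd.
have cw n (x : R) : {for x, continuous (w n)}.
  case: n => [|n]; first by rewrite (_ : w 0 = fun=> 0); [exact: cvg_cst|exact/funext].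
  have [dw _] := wd n x.
  by apply: differentiable_continuous; apply/derivable1_diffP.
have prim (f : nat -> R -> R) : (forall n (x : R), 0 <= x <= 1 -> {for x, continuous (f n)}) ->
    exists F : nat -> R -> R, forall n (x : R), 0 <= x <= 1 -> is_derive x (1 : R) (F n) (f n x).
  move=> cf; have := fun n => continuous_primitive01 (@cf n).
  by move=> /choice[F HF]; exists F.
have [W Wd] := prim w (fun n x _ => cw n x).
have [A Ad] : exists A : nat -> R -> R, forall n (x : R), 0 <= x <= 1 ->
    is_derive x (1 : R) (A n) (w n x ^+ 2).
  by apply: (prim (fun n x => w n x ^+ 2)) => n x _; apply: cvgM; exact: cw.
have [B Bd] : exists B : nat -> R -> R, forall n (x : R), 0 <= x <= 1 ->
    is_derive x (1 : R) (B n) (x * w n x ^+ 2).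
  apply: (prim (fun n x => x * w n x ^+ 2)) => n x _.
  by apply: cvgM; [exact: cvg_id|apply: cvgM; exact: cw].
have cW n (x : R) : 0 <= x <= 1 -> {for x, continuous (W n)}.
  move=> /(Wd n x)[dW _].
  by apply: differentiable_continuous; apply/derivable1_diffP.
have [C Cd] : exists C : nat -> R -> R, forall n (x : R), 0 <= x <= 1 ->
    is_derive x (1 : R) (C n)
      ((w n.+1 x - ((W n.+1 x - W n.+1 0) + (W n 1 - W n x))) ^+ 2).
  apply: (prim (fun n x => (w n.+1 x - ((W n.+1 x - W n.+1 0) + (W n 1 - W n x))) ^+ 2)).
  move=> n x x01.
  have c : {for x, continuous (fun x => w n.+1 x - ((W n.+1 x - W n.+1 0) + (W n 1 - W n x)))}.
    apply: cvgB; first exact: cw.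
    by apply: cvgD; (apply: cvgB; [|exact: cvg_cst]; exact: cW) ||
      (apply: cvgB; [exact: cvg_cst|exact: cW]).
  by apply: cvgM; exact: c.
split.
- by move=> n s s01; apply: (delay_bounded tau0 w0 w10 wg wd Wd Ad Bd).
- by move=> t5 w1 n; apply: (delay_increment_bounded tau0 w0 w10 wg wd Wd Ad Bd).
- by move=> t5 K n; apply: (delay_decay tau0 w0 w10 wg wd Wd Ad Bd t5 Cd).
Qed.

(** * The delay equation behind the generating function *)

Section gaver_kernel.
Context {R : realType}.

(* [y * gk n y] is the coefficient of [z ^+ n] in [1 / (1 - y z e^(1 - z))]. *)
Definition gk_coef n i : R :=
  expR 1 ^+ i.+1 * (- i.+1%:R) ^+ (n - i.+1) / (n - i.+1)`!%:R.

Definition gk n (y : R) := \sum_(i < n) gk_coef n i * y ^+ i.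

Definition delay_term (a : R) n j s :=
  a ^+ j / (n - j)`!%:R * (- (j%:R + s)) ^+ (n - j).

(** [delay_w y n.+1 s] is the coefficient of [z^n] in [e^(s (1 + ln y - z)) / (1 - y z e^(1 - z))].
    Differentiation in [s] multiplies by [1 + ln y - z], which is the delay equation; at [s = 1] the
    exponential is [y e^(1 - z)], which glues to the next coefficient at [s = 0]. *)
Definition delay_w (y : R) n s := if n is n'.+1 then
  expR (s * (1 + ln y)) * \sum_(j < n) delay_term (expR 1 * y) n' j s else 0.

Lemma is_derive_delay_term (a : R) n j (s : R) : (j <= n)%N ->
  is_derive s (1 : R) (delay_term a n.+1 j) (- delay_term a n j s).
Proof.
move=> jn; have -> : delay_term a n.+1 j = fun s =>
    a ^+ j / (n.+1 - j)`!%:R * ((fun s => - (j%:R + s)) ^+ (n.+1 - j)) s.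
  by apply/funext => t; rewrite /delay_term exprfctE.
apply: is_derive_eq; rewrite /GRing.scale/= /delay_term subSn//= factS natrM.
have f0 : (n - j)`!%:R != 0 :> R by rewrite pnatr_eq0 -lt0n fact_gt0.
by field; rewrite f0 nat1r pnatr_eq0.
Qed.

Lemma is_derive_delay_w (y : R) n (s : R) : 0 < y ->
  is_derive s (1 : R) (delay_w y n.+1)
    ((1 + ln y) * delay_w y n.+1 s - delay_w y n s).
Proof.
move=> y0; set b := 1 + ln y; set a := expR 1 * y.
have dE : is_derive s (1 : R) (fun s => expR (s * b)) (b * expR (s * b)).
  by apply: is_derive_eq; rewrite /GRing.scale/=; ring.
have dS : is_derive s (1 : R) (fun s => \sum_(j < n.+1) delay_term a n j s)
    (if n is n'.+1 then - \sum_(j < n) delay_term a n' j s else 0).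
  case: n => [|n].
    have -> : (fun s => \sum_(j < 1) delay_term a 0 j s) = fun=> 1.
      apply/funext => t; rewrite big_ord1 /delay_term subnn !expr0 fact0.
      by rewrite divr1 mulr1.
    exact: is_derive_cst.
  rewrite -fct_sumE big_ord_recr/= -sumrN.
  have -> : delay_term a n.+1 n.+1 = fun=> a ^+ n.+1.
    by apply/funext => t; rewrite /delay_term subnn expr0 fact0 divr1 mulr1.
  have h : is_derive s (1 : R) (\sum_(i < n.+1) delay_term a n.+1 i)
      (\sum_(i < n.+1) - delay_term a n i s).
    apply: is_derive_sum => i; apply: is_derive_delay_term.
    by rewrite -ltnS ltn_ord.
  by apply: is_derive_eq; rewrite addr0.
rewrite /delay_w -/b -/a.
apply: is_derive_eq; rewrite /GRing.scale/=.
case: n dS => [|n] dS; ring.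
Qed.

Lemma delay_w_glue (y : R) n : 0 < y -> delay_w y n.+2 0 = delay_w y n.+1 1.
Proof.
move=> y0; rewrite /delay_w mul0r expR0 !mul1r expRD lnK ?posrE//.
rewrite big_ord_recl/= {1}/delay_term subn0 addr0 oppr0 exprS mul0r mulr0 add0r.
rewrite mulr_sumr; apply: eq_bigr => i _; rewrite /delay_term/= /bump/= add1n subSS.
rewrite addr0 natr1 exprS; ring.
Qed.

Lemma gk_delay (y : R) n : delay_w y n.+2 0 = y * gk n.+1 y.
Proof.
rewrite /delay_w mul0r expR0 mul1r.
rewrite big_ord_recl/= {1}/delay_term subn0 addr0 oppr0 exprS mul0r mulr0 add0r.
rewrite mulr_sumr; apply: eq_bigr => i _; rewrite /delay_term/= /gk_coef /bump/= add1n.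
rewrite addr0 exprMn [y ^+ i.+1]exprS; ring.
Qed.

Lemma expR1_ge2 : 2 <= expR 1 :> R.
Proof. by rewrite (le_trans _ (expR_ge1Dx _)). Qed.

Lemma expR1_le4 : expR 1 <= 4 :> R.
Proof.
have : 2^-1 <= expR (- 2^-1) :> R.
  by rewrite (le_trans _ (expR_ge1Dx _))//; lra.
rewrite expRN lef_pV2 ?posrE ?expR_gt0// => h.
have -> : expR 1 = expR 2^-1 * expR 2^-1 :> R.
  by rewrite -expRD; congr expR; lra.
rewrite (_ : 4 = 2 * 2 :> R); last by rewrite -natrM.
by apply: ler_pM => //; exact: expR_ge0.
Qed.

Lemma delay_w_bounds (y : R) : 0 < y -> y < 1 -> let tau := - ln y in
  [/\ forall n, tau * delay_w y n 0 ^+ 2 <= 2 * tau + 16,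
      tau <= 5 -> forall n, `|delay_w y n.+2 0 - delay_w y n.+1 0| <= 26 &
      tau <= 5 -> forall K n, tau + 68 <= K * tau ^+ 2 -> 0 <= K ->
        (tau * delay_w y n.+2 0) ^+ 2 <= 68 * (K / (1 + K)) ^+ (n %/ 3)].
Proof.
move=> y0 y1 tau.
have tau0 : 0 < tau by rewrite oppr_gt0 ln_lt0// y0.
have [||||h1 h2 h3] := @delay_solution_bounds R tau (delay_w y) tau0.
- by [].
- by rewrite /delay_w /= mul0r expR0 mul1r big_ord1 /delay_term subnn !expr0 divr1 mulr1.
- by move=> n; exact: delay_w_glue.
- by move=> n s; rewrite /tau opprK; exact: is_derive_delay_w.
split => // [n|t5 n]; first by apply: h1; rewrite lexx ler01.
apply: h2 => // s /andP[s0 s1].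
(* Here [w 1 s = e^(s (1 - tau))] is at most [e <= 4]. *)
rewrite /delay_w /= big_ord1 /delay_term subnn !expr0 divr1 !mulr1 ger0_norm ?expR_ge0//.
rewrite (le_trans _ expR1_le4)// ler_expR.
have : s * (1 - tau) <= s * 1 by rewrite ler_wpM2l//; lra.
by rewrite /tau opprK; lra.
Qed.

Lemma exp_fact_le (x : R) k : 0 <= x -> x ^+ k / k`!%:R <= expR x.
Proof.
move=> x0; case: k => [|k].
  by rewrite expr0 divr1 (le_trans _ (expR_ge1Dx _))// lerDl.
by rewrite (le_trans _ (expR_ge1Dxn k x0))// lerDr.
Qed.

(** With [k = n - i - 1], [(i + 1)^k / k! = 2^(-k) (2 (i + 1))^k / k! <= 2^(-k) e^(2 (i + 1))].
    Apart from [2^(-k)] the terms grow at most like [e^(3 i) y^i], and [y <= e^(-5)] leaves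
    [e^(-2 i) <= 4^(-i)], which outweighs the [2^i] inside [2^(-k)]. *)
Lemma gk_small n (y : R) : 0 <= y <= expR (- 5) ->
  `|gk n y| <= 4 * expR 1 ^+ 3 * 2^-1 ^+ n.
Proof.
move=> /andP[y0 y5]; pose e := expR 1 : R.
have e0 : 0 < e by exact: expR_gt0.
have key i : (i < n)%N ->
    `|gk_coef n i * y ^+ i| <= 2 * e ^+ 3 * 2^-1 ^+ n * 2^-1 ^+ i.
  move=> lin; set k := (n - i.+1)%N.
  rewrite /gk_coef !normrM normfV !normrX normrN (ger0_norm (expR_ge0 _)).
  rewrite !normr_nat (ger0_norm y0) -/k -/e.
  have h : i.+1%:R ^+ k / k`!%:R <= 2^-1 ^+ k * (e ^+ 2) ^+ i.+1.
    rewrite -(@ler_pM2l _ (2 ^+ k)) ?exprn_gt0// [leRHS]mulrA -exprMn mulfV//.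
    rewrite expr1n mul1r mulrA -exprMn -exprM -expRM_natl.
    rewrite (le_trans (exp_fact_le _ _))// ?mulr_ge0// ler_expR.
    by rewrite mulr1 natrM.
  have yi : y ^+ i <= (e ^- 5) ^+ i.
    apply: lerXn2r; rewrite ?nnegrE ?invr_ge0 ?exprn_ge0 ?expR_ge0//.
    by move: y5; rewrite expRN -[X in expR X]mulr1 expRM_natl.
  apply: (@le_trans _ _ (e ^+ i.+1 * (2^-1 ^+ k * (e ^+ 2) ^+ i.+1) * (e ^- 5) ^+ i)).
    apply: ler_pM => //; first by rewrite !mulr_ge0 ?exprn_ge0 ?invr_ge0// ltW.
      by rewrite exprn_ge0.
    by rewrite -mulrA ler_pM2l ?exprn_gt0.
  have -> : e ^+ i.+1 * (2^-1 ^+ k * (e ^+ 2) ^+ i.+1) * (e ^- 5) ^+ i =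
      2^-1 ^+ k * e ^+ 3 * (e * e ^+ 2 * e ^- 5) ^+ i.
    by rewrite !exprS !exprMn; ring.
  have -> : e * e ^+ 2 * e ^- 5 = e ^- 2 by field; rewrite gt_eqF.
  have -> : 2 * e ^+ 3 * 2^-1 ^+ n * 2^-1 ^+ i = 2^-1 ^+ k * e ^+ 3 * (2^-1 * 2^-1) ^+ i.
    have -> : n = (k + i.+1)%N by rewrite subnK.
    by rewrite exprMn exprD [_ ^+ i.+1]exprS; field.
  rewrite ler_pM2l; last by rewrite mulr_gt0 ?exprn_gt0// invr_gt0.
  apply: lerXn2r; rewrite ?nnegrE ?invr_ge0 ?exprn_ge0 ?mulr_ge0 ?invr_ge0 ?expR_ge0//.
  by rewrite -invfM lef_pV2 ?posrE ?exprn_gt0// expr2 ler_pM// expR1_ge2.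
rewrite (le_trans (ler_norm_sum _ _ _))//.
apply: (@le_trans _ _ (\sum_(i < n) 2 * e ^+ 3 * 2^-1 ^+ n * 2^-1 ^+ i)).
  by apply: ler_sum => i _; exact: key.
rewrite -mulr_sumr.
have -> : 4 * e ^+ 3 * 2^-1 ^+ n = 2 * e ^+ 3 * 2^-1 ^+ n * 2.
  by rewrite (_ : 4 = 2 * 2) -?natrM//; ring.
rewrite ler_wpM2l ?mulr_ge0 ?exprn_ge0 ?invr_ge0 ?(ltW e0)//.
suff -> : \sum_(i < n) 2^-1 ^+ i = 2 - 2 * 2^-1 ^+ n :> R.
  by rewrite gerBl mulr_ge0// exprn_ge0// invr_ge0.
elim: n {key} => [|k IH]; first by rewrite big_ord0 expr0 mulr1 subrr.
by rewrite big_ord_recr/= IH exprS; field.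
Qed.

Lemma ln_bounds (y : R) : expR (- 5) <= y -> y < 1 -> 1 - y <= - ln y <= 5.
Proof.
move=> y5 y1; have y0 : 0 < y by rewrite (lt_le_trans _ y5)// expR_gt0.
have := expR_ge1Dx (ln y); rewrite lnK ?posrE// => h.
have h5 : - 5 <= ln y by rewrite -ler_expR lnK ?posrE.
by apply/andP; split; lra.
Qed.

Lemma gk_small_le n (y : R) : 0 <= y <= expR (- 5) -> `|gk n y| <= 256.
Proof.
move=> y5; rewrite (le_trans (gk_small n y5))//.
rewrite -[leRHS]mulr1 ler_pM ?mulr_ge0 ?exprn_ge0 ?expR_ge0 ?invr_ge0//.
  rewrite (_ : 256 = 4 * 4 ^+ 3 :> R); last by rewrite -natrX -natrM.
  by rewrite ler_pM2l// lerXn2r ?nnegrE ?expR_ge0// expR1_le4.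
by rewrite exprn_ile1// invf_le1// ler1n.
Qed.

(** Away from [0] this is the bound on [tau w^2] with [w = y * gk n y], where [1 - y <= tau <= 5]
    and [26 = 2 * 5 + 16]. *)
Lemma gk_sqr_le : exists2 C : R, 0 <= C & forall n (y : R), (0 < n)%N ->
  0 <= y < 1 -> gk n y ^+ 2 * (1 - y) <= C.
Proof.
pose b : R := expR (- 5); have b0 : 0 < b by exact: expR_gt0.
exists (26 / b ^+ 2 + 256 ^+ 2).
  by rewrite addr_ge0 ?divr_ge0 ?exprn_ge0// ltW.
case=> // n y _ /andP[y0 y1]; have [yb|by_] := leP y b.
  rewrite (@le_trans _ _ (256 ^+ 2))//; last by rewrite lerDr divr_ge0// exprn_ge0// ltW.
  rewrite -[leRHS]mulr1 ler_pM ?sqr_ge0 ?subr_ge0 ?(ltW y1)//; last by lra.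
  rewrite -real_normK ?num_real// lerXn2r ?nnegrE//.
  by apply: gk_small_le; rewrite y0.
have yp : 0 < y by rewrite (lt_trans b0).
have /andP[t1 t5] := ln_bounds (ltW by_) y1.
have [/(_ n.+2) h _ _] := delay_w_bounds yp y1.
rewrite (@le_trans _ _ (26 / b ^+ 2))//; last by rewrite lerDl exprn_ge0.
rewrite ler_pdivlMr ?exprn_gt0//.
rewrite gk_delay in h.
apply: (@le_trans _ _ (- ln y * (y * gk n.+1 y) ^+ 2)); last by rewrite (le_trans h)//; lra.
rewrite exprMn [leRHS]mulrA [leRHS]mulrC -mulrA ler_wpM2l ?sqr_ge0//.
apply: ler_pM; rewrite ?subr_ge0 ?sqr_ge0// ?(ltW y1)//.
by apply: lerXn2r; rewrite ?nnegrE ?(ltW by_) ?(ltW yp) ?(ltW b0).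
Qed.

Lemma gk_increment_le : exists2 C : R, 0 <= C & forall n (y : R), (0 < n)%N ->
  0 <= y < 1 -> `|gk n.+1 y - gk n y| <= C.
Proof.
pose b : R := expR (- 5); have b0 : 0 < b by exact: expR_gt0.
exists (26 / b + (256 + 256)).
  by rewrite addr_ge0// divr_ge0// ltW.
case=> // n y _ /andP[y0 y1]; have [yb|by_] := leP y b.
  rewrite (@le_trans _ _ (256 + 256))//; last by rewrite lerDr divr_ge0// ltW.
  by rewrite (le_trans (ler_normB _ _))// lerD// gk_small_le// y0.
have yp : 0 < y by rewrite (lt_trans b0).
have /andP[t1 t5] := ln_bounds (ltW by_) y1.
have [_ /(_ t5 n.+1) h _] := delay_w_bounds yp y1.
rewrite (@le_trans _ _ (26 / b))//; last by rewrite lerDl.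
rewrite ler_pdivlMr//.
rewrite !gk_delay -mulrBr normrM (ger0_norm (ltW yp)) in h.
by rewrite mulrC (le_trans _ h)// ler_wpM2r// ltW.
Qed.

(** The convergence is made uniform on [[0, Y]] because multipliers act on sup norms over such
    intervals. *)
Lemma gk_cvg0 (Y e : R) : Y < 1 -> 0 < e -> exists N : nat,
  forall n (y : R), (N <= n)%N -> 0 <= y <= Y -> `|gk n y| <= e.
Proof.
move=> Y1 e0; pose b : R := expR (- 5); have b0 : 0 < b by exact: expR_gt0.
have d0 : 0 < 1 - Y by rewrite subr_gt0.
(* [tau + 68 <= 73] and [tau >= 1 - Y], so that [tau + 68 <= K tau^2]. *)
pose K := 73 / (1 - Y) ^+ 2.
have K0 : 0 <= K by rewrite divr_ge0// sqr_ge0.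
pose q := K / (1 + K).
have q0 : 0 <= q by rewrite divr_ge0// addr_ge0.
have q1 : `|q| < 1.
  by rewrite ger0_norm// ltr_pdivrMr ?ltr_wpDr// mul1r ltrDr.
have [N1 HN1] : exists N1 : nat, forall n, (N1 <= n)%N -> 4 * expR 1 ^+ 3 * 2^-1 ^+ n <= e.
  have : (fun n => 4 * expR 1 ^+ 3 * 2^-1 ^+ n) @ \oo --> (0 : R).
    rewrite -[X in _ --> X](mulr0 (4 * expR 1 ^+ 3)); apply: cvgMr.
    by apply: cvg_expr; rewrite ger0_norm ?invr_ge0// invf_lt1// ltr1n.
  move=> /cvgrPdist_le/(_ _ e0)[N1 _ HN]; exists N1 => n /HN/=.
  by rewrite sub0r normrN; apply: le_trans; exact: ler_norm.
(* [(1 - Y) b] is a lower bound of [tau y], the factor between [gk] and the decaying quantity. *)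
pose c := ((1 - Y) * b * e) ^+ 2.
have c0 : 0 < c by rewrite exprn_gt0// !mulr_gt0.
have [N2 HN2] : exists N2 : nat, forall n, (N2 <= n)%N -> 68 * q ^+ n <= c.
  have : (fun n => 68 * q ^+ n) @ \oo --> (0 : R).
    rewrite -[X in _ --> X](mulr0 68); apply: cvgMr.
    exact: cvg_expr.
  move=> /cvgrPdist_le/(_ _ c0)[N1' _ HN]; exists N1' => n /HN/=.
  by rewrite sub0r normrN; apply: le_trans; exact: ler_norm.
exists (N1 + 3 * N2).+1 => -[//|n] y Nn /andP[y0 yY].
have y1 : y < 1 by exact: le_lt_trans Y1.
have [yb|by_] := leP y b.
  rewrite (le_trans (gk_small _ _)) ?y0//; apply: HN1.
  by apply: leq_trans Nn; rewrite leqW// leq_addr.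
have yp : 0 < y by rewrite (lt_trans b0).
have /andP[t1 t5] := ln_bounds (ltW by_) y1.
have [_ _ /(_ t5 K n)] := delay_w_bounds yp y1.
have t2 : 1 - Y <= - ln y by rewrite (le_trans _ t1)// lerB.
move=> /(_ _ K0)/wrap[|h].
  rewrite /K mulrAC ler_pdivlMr ?exprn_gt0//.
  apply: ler_pM; rewrite ?sqr_ge0//; [by lra|by lra|].
  by apply: lerXn2r; rewrite ?nnegrE ?(ltW d0) ?(ltW (lt_le_trans d0 t2)).
have {}h := le_trans h (HN2 (n %/ 3)%N _).
have {}h : (- ln y * delay_w y n.+2 0) ^+ 2 <= c.
  apply: h; rewrite leq_divRL// mulnC (leq_trans _ (_ : N1 + 3 * N2 <= n)%N)//.
  by rewrite leq_addl.
have : (1 - Y) * b * `|gk n.+1 y| <= (1 - Y) * b * e.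
  rewrite -(@ler_pXn2r _ 2)// ?nnegrE ?mulr_ge0 ?(ltW d0) ?(ltW b0) ?(ltW e0)//.
  apply: le_trans h; rewrite gk_delay -[leRHS]real_normK ?num_real// !normrM.
  apply: lerXn2r; rewrite ?nnegrE ?mulr_ge0 ?(ltW d0) ?(ltW b0)//.
  rewrite mulrA ler_wpM2r// ler_pM ?(ltW d0) ?(ltW b0)//.
    by rewrite (le_trans t2)// ler_norm.
  by rewrite (le_trans (ltW by_))// ler_norm.
by rewrite ler_pM2l// mulr_gt0.
Qed.

End gaver_kernel.

(** * Multipliers on the coefficients of a polynomial *)

Section multiplier.
Context {R : realType}.
Implicit Types (a t : nat -> R) (M : R).

Definition pev a n (y : R) := \sum_(i < n) a i * y ^+ i.

(** The intervals start at [0] because [multiplier_inv] integrates from [0]. A single constant for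
    all lengths [n] and all [Y] makes the class stable under products, sums and pointwise limits. *)
Definition multiplier M t := forall n a (Y B : R),
  (forall y, 0 <= y <= Y -> `|pev a n y| <= B) ->
  forall y, 0 <= y <= Y -> `|pev (fun i => t i * a i) n y| <= M * B.

Lemma cvgn_le (u : nat -> R) (l B : R) :
  u @ \oo --> l -> (forall k, u k <= B) -> l <= B.
Proof.
move=> ul uB; rewrite -(cvg_lim _ ul)//; apply: limr_le; first exact: cvgP ul.
exact: nearW.
Qed.

Lemma eq_multiplier M t t' : t =1 t' -> multiplier M t -> multiplier M t'.
Proof. by move=> /funext ->. Qed.

Lemma le_multiplier M M' t : M <= M' -> multiplier M t -> multiplier M' t.
Proof.
move=> MM tM n a Y B aB y yY; rewrite (le_trans (tM _ _ _ _ aB _ yY))//.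
by rewrite ler_wpM2r// (le_trans _ (aB _ yY)).
Qed.

Lemma multiplier_cst (c : R) : multiplier `|c| (fun=> c).
Proof.
move=> n a Y B aB y yY; rewrite (_ : pev _ n y = c * pev a n y).
  by rewrite normrM ler_wpM2l// aB.
by rewrite /pev mulr_sumr; apply: eq_bigr => i _; rewrite mulrA.
Qed.

Lemma multiplierM M M' t t' : multiplier M t -> multiplier M' t' ->
  multiplier (M * M') (fun i => t i * t' i).
Proof.
move=> tM tM' n a Y B aB y yY; rewrite -mulrA.
have -> : pev (fun i => t i * t' i * a i) n y = pev (fun i => t i * (t' i * a i)) n y.
  by apply: eq_bigr => i _; rewrite -[t i * _ * _]mulrA.
exact: tM (tM' _ _ _ _ aB) _ yY.
Qed.

Lemma multiplierD M M' t t' : multiplier M t -> multiplier M' t' ->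
  multiplier (M + M') (fun i => t i + t' i).
Proof.
move=> tM tM' n a Y B aB y yY; rewrite mulrDl.
have -> : pev (fun i => (t i + t' i) * a i) n y =
    pev (fun i => t i * a i) n y + pev (fun i => t' i * a i) n y.
  by rewrite /pev -big_split; apply: eq_bigr => i _; rewrite !mulrDl.
by rewrite (le_trans (ler_normD _ _))// lerD//; [apply: tM aB _ yY|apply: tM' aB _ yY].
Qed.

Lemma multiplier_sum (M : nat -> R) (t : nat -> nat -> R) K :
  (forall k, multiplier (M k) (t k)) ->
  multiplier (\sum_(k < K) M k) (fun i => \sum_(k < K) t k i).
Proof.
move=> tM; elim: K => [|K IH].
  apply: (eq_multiplier (t := fun=> 0)); first by move=> i; rewrite big_ord0.
  by rewrite big_ord0; have := multiplier_cst 0; rewrite normr0.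
apply: (eq_multiplier (t := fun i => \sum_(k < K) t k i + t K i)).
  by move=> i; rewrite big_ord_recr.
by rewrite big_ord_recr; exact: multiplierD.
Qed.

Lemma multiplier_prod (M : nat -> R) (t : nat -> nat -> R) K :
  (forall k, multiplier (M k) (t k)) ->
  multiplier (\prod_(k < K) M k) (fun i => \prod_(k < K) t k i).
Proof.
move=> tM; elim: K => [|K IH].
  apply: (eq_multiplier (t := fun=> 1)); first by move=> i; rewrite big_ord0.
  by rewrite big_ord0; have := multiplier_cst 1; rewrite normr1.
apply: (eq_multiplier (t := fun i => (\prod_(k < K) t k i) * t K i)).
  by move=> i; rewrite big_ord_recr.
by rewrite big_ord_recr; exact: multiplierM.
Qed.

Lemma multiplierX M t k : multiplier M t -> multiplier (M ^+ k) (fun i => t i ^+ k).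
Proof.
move=> tM; have := multiplier_prod (M := fun=> M) (t := fun=> t) k (fun=> tM).
rewrite prodr_const card_ord; apply: eq_multiplier => i.
by rewrite prodr_const card_ord.
Qed.

(** For fixed [n] and [y] the value is a finite combination of the factors, so it converges as soon
    as each factor does. *)
Lemma multiplier_cvg M (t_ : nat -> nat -> R) t : (forall k, multiplier M (t_ k)) ->
  (forall i, t_ k i @[k --> \oo] --> t i) -> multiplier M t.
Proof.
move=> tM tt n a Y B aB y yY.
have c : pev (fun i => t_ k i * a i) n y @[k --> \oo] --> pev (fun i => t i * a i) n y.
  rewrite /pev; elim: n {aB} => [|n IH].
    rewrite big_ord0; under eq_fun do rewrite big_ord0; exact: cvg_cst.
  rewrite big_ord_recr; under eq_fun do rewrite big_ord_recr.
  apply: cvgD; first exact: IH.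
  by apply: cvgMl; apply: cvgMl; exact: tt.
by apply: cvgn_le (cvg_norm c) _ => k; apply: tM aB _ yY.
Qed.

(** The partial sums of the exponential series are multipliers, with the partial sums at [M] as
    constants. *)
Lemma multiplier_exp M t : multiplier M t ->
  multiplier (expR M) (fun i => expR (- t i)).
Proof.
move=> tM.
(* Testing on the constant polynomial [1] gives [M >= 0], so that the partial sums at [M] increase
   to [expR M]. *)
have M0 : 0 <= M.
  have h n y : pev (fun i => if i == 0 then 1 else 0) n.+1 y = 1 :> R.
    rewrite /pev big_ord_recl/= expr0 mulr1 big1 ?addr0// => i _.
    by rewrite /= mul0r.
  have := tM 1 (fun i => if i == 0 then 1 else 0) 0 1.
  move=> /(_ _ 0)/wrap[y _|]; first by rewrite h normr1.
  by rewrite lexx mulr1 => /(_ isT); apply: le_trans.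
apply: (@multiplier_cvg _ (fun K i => \sum_(k < K) (k`!%:R)^-1 * ((-1) ^+ k * t i ^+ k))).
  move=> K; apply: (@le_multiplier (\sum_(k < K) (k`!%:R)^-1 * (1 * M ^+ k))).
    rewrite [leRHS]/expR.
    apply: le_trans (nondecreasing_cvgn_le _ (is_cvg_series_exp_coeff M) K).
      rewrite seriesEord/=; apply: ler_sum => k _.
      by rewrite /exp_coeff/= mul1r mulrC.
    apply/nondecreasing_seqP => k; rewrite /series/= big_nat_recr//= lerDl.
    by rewrite divr_ge0// exprn_ge0.
  apply: (@multiplier_sum (fun k => (k`!%:R)^-1 * (1 * M ^+ k))
    (fun k i => (k`!%:R)^-1 * ((-1) ^+ k * t i ^+ k))) => k.
  apply: multiplierM; first by have := multiplier_cst (k`!%:R^-1); rewrite ger0_norm// invr_ge0.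
  apply: multiplierM; last exact: multiplierX.
  by have := multiplier_cst ((-1) ^+ k); rewrite normrX normrN1 expr1n.
move=> i; rewrite /expR; have := is_cvg_series_exp_coeff (- t i).
suff -> : series (exp_coeff (- t i)) =
   (fun K => \sum_(k < K) (k`!%:R)^-1 * ((-1) ^+ k * t i ^+ k)) by [].
apply/funext => K; rewrite seriesEord/=; apply: eq_bigr => k _.
by rewrite /exp_coeff/= mulrC [in LHS]exprNn.
Qed.

(* If [Q = 2 y P' + k P], then [(r ^ k P(r^2))' = r ^ (k - 1) Q(r^2)]. *)
Lemma multiplier_inv k : (0 < k)%N ->
  multiplier k%:R^-1 (fun i => (2 * i + k)%:R^-1).
Proof.
case: k => // k _ n a Y B aB y /andP[y0 yY].
pose P := pev (fun i => (2 * i + k.+1)%:R^-1 * a i) n.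
pose F (r : R) := \sum_(i < n) (2 * i + k.+1)%:R^-1 * a i * r ^+ (2 * i + k.+1).
have Fd (r : R) : is_derive r (1 : R) F (r ^+ k * pev a n (r ^+ 2)).
  have -> : F = \sum_(i < n) (fun r => (2 * i + k.+1)%:R^-1 * a i * r ^+ (2 * i + k.+1)).
    by rewrite fct_sumE.
  rewrite /pev mulr_sumr; apply: is_derive_sum => i.
  have -> : (fun r : R => (2 * i + k.+1)%:R^-1 * a i * r ^+ (2 * i + k.+1)) =
      fun r => (2 * i + k.+1)%:R^-1 * a i * (id ^+ (2 * i + k.+1)) r.
    by apply/funext => s; rewrite exprfctE.
  apply: is_derive_eq; rewrite /GRing.scale/= addnS/= exprD -exprM mulr1.
  have n0 : (2 * i + k).+1%:R != 0 :> R by rewrite pnatr_eq0.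
  by move: ((2 * i + k).+1%:R : R) n0 => N n0; field.
have PE (r : R) : F r = r ^+ k.+1 * P (r ^+ 2).
  rewrite /F /P /pev mulr_sumr; apply: eq_bigr => i _.
  by rewrite exprD -exprM; ring.
have Gd (r : R) : is_derive r (1 : R) (fun r => k.+1%:R^-1 * B * (id ^+ k.+1) r) (r ^+ k * B).
  apply: is_derive_eq; rewrite /GRing.scale/= mulr1.
  have n0 : k.+1%:R != 0 :> R by rewrite pnatr_eq0.
  by move: (k.+1%:R : R) n0 => N n0; field.
rewrite -/(P y).
(* At [y = 0] a power of [sqrt y] cannot be divided out; only the constant coefficient contributes
   there. *)
have [->|yn0] := eqVneq y 0.
  have P0 (b : nat -> R) : pev b n 0 = if n is 0 then 0 else b 0.
    rewrite /pev; case: n {aB P F Fd PE} => [|m]; first by rewrite big_ord0.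
    by rewrite big_ord_recl expr0 mulr1 big1 ?addr0// => i _; rewrite exprS mul0r mulr0.
  have := aB 0; rewrite lexx (le_trans y0 yY) => /(_ isT).
  rewrite /P !P0; case: n {aB P F Fd PE P0} => [|m].
    by rewrite normr0 => B0; rewrite mulr_ge0 ?invr_ge0.
  by move=> aB; rewrite muln0 add0n normrM ger0_norm ?invr_ge0// ler_wpM2l ?invr_ge0.
have yp : 0 < y by rewrite lt_neqAle eq_sym yn0.
pose s := Num.sqrt y.
have s0 : 0 < s by rewrite sqrtr_gt0.
have ss : s ^+ 2 = y by rewrite sqr_sqrtr.
have bnd x : 0 <= x <= s -> `|x ^+ k * pev a n (x ^+ 2)| <= x ^+ k * B.
  move=> /andP[x0 xs]; rewrite normrM ger0_norm ?exprn_ge0// ler_wpM2l ?exprn_ge0//.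
  apply: aB; rewrite sqr_ge0/= (le_trans _ yY)// -ss.
  by apply: lerXn2r; rewrite ?nnegrE// ltW.
have h1 := @is_derive1_le R F _ _ _ 0 s (ltW s0) (fun x _ => Fd x) (fun x _ => Gd x)
  (fun x h => le_trans (ler_norm _) (bnd x h)).
have Nd (x : R) : is_derive x (1 : R) (fun x => - F x) (- (x ^+ k * pev a n (x ^+ 2))).
  by have := Fd x => ?; apply: is_deriveN.
have h2 := @is_derive1_le R _ _ _ _ 0 s (ltW s0) (fun x _ => Nd x) (fun x _ => Gd x).
have lerNnorm_ (z : R) : - z <= `|z| by rewrite -normrN ler_norm.
have {}h2 := h2 (fun x h => le_trans (lerNnorm_ _) (bnd x h)).
rewrite !PE !exprfctE/= expr0n/= mul0r mulr0 !subr0 ss in h1 h2.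
rewrite oppr0 subr0 in h2.
rewrite -(@ler_pM2l _ (s ^+ k.+1)) ?exprn_gt0//.
have sk : 0 <= s ^+ k.+1 by rewrite exprn_ge0// ltW.
rewrite (_ : _ * `|P y| = `|s ^+ k.+1 * P y|); last by rewrite normrM ger0_norm.
rewrite ler_norml.
by rewrite [s ^+ k.+1 * (_ * _)]mulrC lerNl h1 h2.
Qed.

End multiplier.

(** * The coefficient ratio as a multiplier *)

Section salzer_multiplier.
Context {R : realType}.

(* The ratio of the coefficients of [sk] and [gk], see [sk_coefE]. *)
Definition sm_coef (i : nat) : R := expR (- i.+1%:R) *
  ('C(2 * i.+1, i.+1)%:R / 4 ^+ i.+1) * (i.+1%:R ^+ i.+2 / (i.+1)`!%:R).

(** The logarithm of [sm_coef j / sm_coef (j - 1)], see [sm_coefS]. With [x = 1 / (2 j + 1)], the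
    quotients [2 (j + 1) / (2 j + 1)] and [2 j / (2 j + 1)] are [1 + x] and [1 - x], and the powers
    of this [x] are within reach of [multiplier_inv]. *)
Definition sm_log (j : nat) : R := let x := (2 * j).+1%:R^-1 in
  j%:R * ln (1 + x) - j.+1%:R * ln (1 - x) - 1.

Lemma sm_coef_gt0 i : 0 < sm_coef i.
Proof.
have b0 : (0 < 'C(2 * i.+1, i.+1))%N.
  by rewrite bin_gt0 mul2n -addnn leq_addr.
rewrite /sm_coef mulr_gt0// ?mulr_gt0 ?expR_gt0 ?invr_gt0 ?exprn_gt0 ?ltr0n//.
Qed.

Lemma central_binS j :
  (j.+1 * 'C(2 * j.+1, j.+1) = 2 * (2 * j).+1 * 'C(2 * j, j))%N.
Proof.
have h1 := mul_bin_diag (2 * j).+2 j; have h2 := mul_bin_down (2 * j).+1 j.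
rewrite mulnS -h1/= (_ : (2 * j).+2 = 2 * j.+1)%N; last by rewrite mulnS.
rewrite -!mulnA h2 (_ : (2 * j).+1 - j = j.+1)%N//.
by rewrite mul2n -addnn -addnS addKn.
Qed.

Lemma sm_coefS i : sm_coef i.+1 = sm_coef i * expR (sm_log i.+1).
Proof.
set j := i.+1.
have j0 : (0 : R) < j%:R by rewrite ltr0n.
have x1 : (2 * j).+1%:R = 2 * j%:R + 1 :> R by rewrite -natr1 natrM.
have d0 : 0 < 2 * j%:R + 1 :> R by rewrite ltr_wpDl// mulr_ge0// ltW.
have E : expR (sm_log j) =
    (1 + (2 * j).+1%:R^-1) ^+ j / (1 - (2 * j).+1%:R^-1) ^+ j.+1 * expR (- 1).
  rewrite /sm_log !expRD expRN !expRM_natl !lnK// posrE x1.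
    by rewrite subr_gt0 invf_lt1// ltrDr mulr_gt0.
  by rewrite ltr_wpDr// invr_ge0 ltW.
rewrite E /sm_coef -/j x1.
have -> : 1 + (2 * j%:R + 1)^-1 = (2 * j.+1%:R) / (2 * j%:R + 1) :> R.
  by rewrite -natr1; field; rewrite gt_eqF.
have -> : 1 - (2 * j%:R + 1)^-1 = (2 * j%:R) / (2 * j%:R + 1) :> R.
  by field; rewrite gt_eqF.
have -> : expR (- j.+1%:R) = expR (- j%:R) * expR (- 1) :> R.
  by rewrite -expRD -natr1 opprD.
have -> : 'C(2 * j.+1, j.+1)%:R = 2 * (2 * j%:R + 1) * 'C(2 * j, j)%:R / j.+1%:R :> R.
  rewrite -x1 -!natrM -central_binS natrM mulrC mulKf// pnatr_eq0//.
rewrite factS natrM !exprMn !exprVn.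
have f0 : j`!%:R != 0 :> R by rewrite pnatr_eq0 -lt0n fact_gt0.
have n0 : j.+1%:R != 0 :> R by rewrite pnatr_eq0.
have j1 : j%:R != 0 :> R by rewrite gt_eqF.
have d1 : 2 * j%:R + 1 != 0 :> R by rewrite gt_eqF.
have p1 : (2 * j%:R + 1) ^+ i != 0 :> R by rewrite expf_neq0.
have p2 : j%:R ^+ i != 0 :> R by rewrite expf_neq0.
have p3 : 2 ^+ i != 0 :> R by rewrite expf_neq0.
have p4 : 4 ^+ i != 0 :> R by rewrite expf_neq0.
rewrite !exprS.
by field; rewrite p1 d1 p2 j1 p3 f0 p4 n0.
Qed.

(** Partial sums of the Taylor series of [sm_log] in [x = 1 / (2 j + 1)]. The coefficients are
    positive, so multiplier constants can be read off from the value at the largest [x]. *)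
Definition sm_series K (x : R) : R :=
  \sum_(k < K) ((2 * k).+2%:R^-1 + (2 * k).+3%:R^-1) * (x ^+ 2) ^+ k.+1.

(** A Taylor remainder: [E t] is [2 t] times the difference, as a function of [t], with
    [E 0 = E' 0 = 0]. Two derivatives eliminate the logarithms, and [E''] is the tail of the sum
    computed in [geom]. *)
Lemma sm_series_log K (j : nat) : (0 < j)%N ->
  `|sm_log j - sm_series K (2 * j).+1%:R^-1| <= 5 * K.+1%:R * 9^-1 ^+ K.
Proof.
move=> j0; set D := 5 * _ * _; set x := (2 * j).+1%:R^-1.
have D0 : 0 <= D by rewrite !mulr_ge0 ?exprn_ge0 ?invr_ge0.
have x0 : 0 < x by rewrite invr_gt0.
have x3 : x <= 3^-1.
  by rewrite lef_pV2 ?posrE// ler_nat; case: (j) j0 => // k _; rewrite mulnS.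
pose c k : R := (2 * k).+2%:R^-1 + (2 * k).+3%:R^-1.
pose E (t : R) := (1 - t) * ln (1 + t) - (1 + t) * ln (1 - t) - 2 * t
  - 2 * t * sm_series K t.
pose E' (t : R) := - ln (1 + t) + (1 - t) / (1 + t) - ln (1 - t) + (1 + t) / (1 - t) - 2
  - \sum_(k < K) 2 * c k * (2 * k).+3%:R * t ^+ (2 * k).+2.
pose E'' (t : R) := t * (t ^+ 2) ^+ K *
  (2 / (1 - t ^+ 2) + 8 * (K.+1%:R - K%:R * t ^+ 2) / (1 - t ^+ 2) ^+ 2).
have in01 t : 0 <= t <= x -> [/\ 0 <= t, t <= 3^-1 & t < 1].
  by move=> /andP[? ?]; split; lra.
have lnp t : 0 <= t <= x -> is_derive t (1 : R) (fun t => ln (1 + t)) (1 + t)^-1.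
  move=> /in01[t0 _ _]; have h : 0 < 1 + t by lra.
  have dln := is_derive1_ln h.
  have dg : is_derive t (1 : R) (fun t => 1 + t) 1 by apply: is_derive_eq; ring.
  exact: is_derive_eq (is_derive1_comp dln dg) (mulr1 _).
have lnm t : 0 <= t <= x -> is_derive t (1 : R) (fun t => ln (1 - t)) (- (1 - t)^-1).
  move=> /in01[_ _ t1]; have h : 0 < 1 - t by lra.
  have dln := is_derive1_ln h.
  have dg : is_derive t (1 : R) (fun t => 1 - t) (- 1) by apply: is_derive_eq; ring.
  by apply: (is_derive_eq (is_derive1_comp (g := fun t => 1 - t) dln dg)); ring.
have powd m (a t : R) : is_derive t (1 : R) (fun t => a * t ^+ m.+1) (a * m.+1%:R * t ^+ m).
  exact: is_derive_monomial.
have dE t : 0 <= t <= x -> is_derive t (1 : R) E (E' t).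
  move=> tx; have [t0 t3 t1] := in01 _ tx.
  have := lnp _ tx; have := lnm _ tx => d1 d2.
  have ds : is_derive t (1 : R) (fun t => \sum_(k < K) 2 * c k * t ^+ (2 * k).+3)
      (\sum_(k < K) 2 * c k * (2 * k).+3%:R * t ^+ (2 * k).+2).
    by rewrite -fct_sumE; apply: is_derive_sum => k; exact: powd.
  have -> : E = fun t => (1 - t) * ln (1 + t) - (1 + t) * ln (1 - t) - 2 * t
      - \sum_(k < K) 2 * c k * t ^+ (2 * k).+3.
    apply/funext => s; rewrite /E /sm_series; congr (_ - _).
    rewrite mulr_sumr; apply: eq_bigr => k _.
    by rewrite -/(c k) -exprM mulnS !exprS; ring.
  by apply: is_derive_eq; rewrite /GRing.scale/= /E'; ring.
have geom t : 0 <= t <= x -> \sum_(k < K) (8 * k + 10)%:R * (t ^+ 2) ^+ k =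
    2 / (1 - t ^+ 2) + 8 / (1 - t ^+ 2) ^+ 2 - (t ^+ 2) ^+ K *
    (2 / (1 - t ^+ 2) + 8 * (K.+1%:R - K%:R * t ^+ 2) / (1 - t ^+ 2) ^+ 2).
  move=> /in01[t0 t3 t1].
  have h : 1 - t ^+ 2 != 0 by rewrite gt_eqF//; nra.
  move: (t ^+ 2) h => X h.
  elim: (K) => [|k IH]; first by rewrite big_ord0 expr0; field.
  rewrite big_ord_recr/= {}IH [X ^+ k.+1]exprS natrD natrM -(natr1 k.+1) -(natr1 k).
  by move: (X ^+ k) (k%:R : R) => Y a; field.
have dE' t : 0 <= t <= x -> is_derive t (1 : R) E' (E'' t).
  move=> tx; have [t0 t3 t1] := in01 _ tx.
  have := lnp _ tx; have := lnm _ tx => d1 d2.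
  have ds : is_derive t (1 : R)
      (fun t => \sum_(k < K) 2 * c k * (2 * k).+3%:R * t ^+ (2 * k).+2)
      (t * \sum_(k < K) (8 * k + 10)%:R * (t ^+ 2) ^+ k).
    have -> : t * (\sum_(k < K) (8 * k + 10)%:R * (t ^+ 2) ^+ k) =
        \sum_(k < K) 2 * c k * (2 * k).+3%:R * (2 * k).+2%:R * t ^+ (2 * k).+1.
      rewrite mulr_sumr; apply: eq_bigr => k _; rewrite /c -exprM [t ^+ (2 * k).+1]exprS.
      have n1 : (2 * k).+2%:R != 0 :> R by rewrite pnatr_eq0.
      have n2 : (2 * k).+3%:R != 0 :> R by rewrite pnatr_eq0.
      rewrite -!natr1 in n1 n2 *.
      rewrite natrD !natrM in n1 n2 *.
      by move: (t ^+ (2 * k)) (k%:R : R) n1 n2 => Y a n1 n2; field; rewrite n1 n2.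
    by rewrite -fct_sumE; apply: is_derive_sum => k; exact: powd.
  have h1 : 1 + t != 0 by rewrite gt_eqF//; lra.
  have h2 : 1 - t != 0 by rewrite gt_eqF//; lra.
  have h3 : 1 - t ^+ 2 != 0 by rewrite gt_eqF//; nra.
  rewrite /E'; apply: is_derive_eq; rewrite /GRing.scale/= (geom _ tx) /E''.
  by field; rewrite h1 h2 h3.
have E00 : E 0 = 0 by rewrite /E addr0 subr0 ln1; ring.
have E'00 : E' 0 = 0.
  rewrite /E' addr0 subr0 ln1 big1; first by field.
  by move=> k _; rewrite exprS mul0r mulr0.
have E''le t : 0 <= t <= x -> `|E'' t| <= D.
  move=> /in01[t0 t3 t1]; have X0 := sqr_ge0 t.
  have X9 : t ^+ 2 <= 9^-1 by nra.
  have K0 : (0 : R) <= K%:R by [].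
  rewrite /E''; move: (t ^+ 2) X0 X9 => X X0 X9.
  have Y0 : 0 < 1 - X by lra.
  have Z1 : (1 - X)^-1 <= 9 / 8.
    by rewrite -[leRHS]invf_div lef_pV2 ?posrE ?divr_gt0//; lra.
  have Zp : 0 < (1 - X)^-1 by rewrite invr_gt0.
  rewrite -exprVn; move: ((1 - X)^-1) Z1 Zp => Z Z1 Zp.
  rewrite -[K.+1%:R]natr1 /D -[K.+1%:R]natr1 -mulrA mulrCA normrM.
  rewrite (ger0_norm (exprn_ge0 _ X0)) [leRHS]mulrC.
  apply: ler_pM => //; first by rewrite exprn_ge0.
    by apply: lerXn2r; rewrite ?nnegrE ?invr_ge0.
  move: (K%:R : R) K0 => k k0.
  have Z2 : Z ^+ 2 <= (9 / 8) ^+ 2.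
    by apply: lerXn2r; rewrite ?nnegrE ?divr_ge0// ltW.
  have h0 : 0 <= k + 1 - k * X by nra.
  have h1 : k + 1 - k * X <= k + 1 by nra.
  have h2 : 0 <= (k + 1 - k * X) * Z ^+ 2 by rewrite mulr_ge0// sqr_ge0.
  have h3 : (k + 1 - k * X) * Z ^+ 2 <= (k + 1) * (9 / 8) ^+ 2.
    by apply: ler_pM => //; exact: sqr_ge0.
  have W0 : 0 <= 2 * Z + 8 * (k + 1 - k * X) * Z ^+ 2 by lra.
  (* As [Z <= 9 / 8], the left side is at most [9 / 4 + (81 / 8) (k + 1)]; the factor [t <= 1 / 3]
     then turns [15] into the [5] of [D]. *)
  have W1 : 2 * Z + 8 * (k + 1 - k * X) * Z ^+ 2 <= 15 * (k + 1) by lra.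
  rewrite ger0_norm ?mulr_ge0//.
  rewrite (@le_trans _ _ (3^-1 * (15 * (k + 1))))//; last by lra.
  exact: ler_pM.
have E'le t : 0 <= t <= x -> `|E' t| <= D.
  move=> tx; have /andP[t0 t1] := tx.
  have := @is_derive1_norm_le R E' E'' D 0 t t0 _ _.
  rewrite E'00 !subr0 => /(_ _ _)/wrap[s /andP[s0 st]|s /andP[s0 st]|h].
  - by apply: dE'; rewrite s0 (le_trans st).
  - by apply: E''le; rewrite s0 (le_trans st).
  by rewrite (le_trans h)// ler_piMr//; have [] := in01 _ tx; lra.
have Ele : `|E x| <= D * x.
  have := @is_derive1_norm_le R E E' D 0 x (ltW x0) dE E'le.
  by rewrite E00 !subr0.
have d1 : 2 * j%:R + 1 != 0 :> R by rewrite -natrM natr1 pnatr_eq0.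
have -> : sm_log j - sm_series K x = E x / (2 * x).
  rewrite /E /sm_log -/x.
  have -> : j%:R = (1 - x) / (2 * x) :> R.
    by rewrite /x -natr1 natrM; field; rewrite d1.
  have -> : j.+1%:R = (1 + x) / (2 * x) :> R.
    by rewrite /x -!natr1 natrM; field; rewrite d1.
  by field; rewrite gt_eqF.
have x20 : 0 < 2 * x by rewrite mulr_gt0.
rewrite normrM normfV (gtr0_norm x20) ler_pdivrMr// (le_trans Ele)//.
by rewrite mulrCA ler_peMl ?ler1n// mulr_ge0// ltW.
Qed.

Lemma sm_series_cvg (j : nat) : (0 < j)%N ->
  sm_series K (2 * j).+1%:R^-1 @[K --> \oo] --> sm_log j.
Proof.
move=> j0; apply/cvgrPdist_le => e e0.
(* [K + 1 <= 2 * 2^K] absorbs the linear factor of the remainder. *)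
have c : 10 * (2 / 9) ^+ K @[K --> \oo] --> (0 : R).
  rewrite -[X in _ --> X](mulr0 10); apply: cvgMr; apply: cvg_expr.
  by rewrite ger0_norm ?divr_ge0// ltr_pdivrMr// mul1r ltr_nat.
move/cvgrPdist_le : c => /(_ e e0); apply: filterS => K.
rewrite sub0r normrN => h; rewrite (le_trans (sm_series_log K j0))// (le_trans _ h)//.
rewrite (le_trans _ (ler_norm _))// exprMn mulrA.
rewrite ler_wpM2r ?exprn_ge0 ?invr_ge0// (_ : 10 = 5 * 2); last by rewrite -natrM.
rewrite -mulrA ler_wpM2l// -exprS -natrX ler_nat.
by rewrite ltnW// ltn_expl.
Qed.

Lemma sm_series_le K (x : R) : 0 <= x -> x <= 3^-1 -> 0 <= sm_series K x <= x ^+ 2.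
Proof.
move=> x0 x3; have X0 := sqr_ge0 x.
have X9 : x ^+ 2 <= 9^-1 by nra.
rewrite /sm_series; move: (x ^+ 2) X0 X9 => X X0 X9.
rewrite sumr_ge0/=; last by move=> k _; rewrite mulr_ge0 ?exprn_ge0// addr_ge0// invr_ge0.
(* Each coefficient is at most [1/2 + 1/3 <= 8/9 <= 1 - X], so the sum is dominated by the
   telescoping sum of [(1 - X) X^(k + 1)]. *)
apply: (@le_trans _ _ (X * (1 - X ^+ K))); last first.
  by rewrite -[leRHS]mulr1 ler_wpM2l// gerBl exprn_ge0.
elim: K => [|k IH]; first by rewrite big_ord0 expr0 subrr mulr0.
rewrite big_ord_recr/= (le_trans (lerD IH (lexx _)))//.
have h : (2 * k).+2%:R^-1 + (2 * k).+3%:R^-1 <= 1 - X.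
  have : (2 * k).+2%:R^-1 <= 2^-1 :> R by rewrite lef_pV2 ?posrE// ler_nat.
  have : (2 * k).+3%:R^-1 <= 3^-1 :> R by rewrite lef_pV2 ?posrE// ler_nat.
  by move: ((2 * k).+2%:R^-1 : R) ((2 * k).+3%:R^-1 : R) => u v; lra.
have := ler_wpM2r (exprn_ge0 k.+1 X0) h; rewrite exprS; move: (X ^+ k) => Y.
by move: (_ + _) => a; lra.
Qed.

(** As a function of [i], [1 / (2 (i + N + 1) + 1)] is the multiplier [1 / (2 i + k)] with
    [k = 2 N + 3], of constant [1 / k]. A sum of its powers with positive coefficients has the same
    sum at [1 / k] as a constant. *)
Lemma multiplier_sm_series K N :
  multiplier ((2 * N).+3%:R^-1 ^+ 2)
    (fun i => sm_series K (2 * (i + N).+1).+1%:R^-1 : R).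
Proof.
have r0 : 0 <= (2 * N).+3%:R^-1 :> R by rewrite invr_ge0.
have r3 : (2 * N).+3%:R^-1 <= 3^-1 :> R by rewrite lef_pV2 ?posrE// ler_nat.
have /andP[_ h] := sm_series_le K r0 r3.
apply: le_multiplier h _.
apply: (@multiplier_sum _
  (fun k => ((2 * k).+2%:R^-1 + (2 * k).+3%:R^-1) * ((2 * N).+3%:R^-1 ^+ 2) ^+ k.+1)
  (fun k i => ((2 * k).+2%:R^-1 + (2 * k).+3%:R^-1) * ((2 * (i + N).+1).+1%:R^-1 ^+ 2) ^+ k.+1)) => k.
apply: multiplierM.
  by have := multiplier_cst ((2 * k).+2%:R^-1 + (2 * k).+3%:R^-1 : R);
    rewrite ger0_norm// addr_ge0// invr_ge0.
apply: (multiplierX (t := fun i => (2 * (i + N).+1).+1%:R^-1 ^+ 2)).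
apply: (multiplierX (t := fun i => (2 * (i + N).+1).+1%:R^-1)).
apply: eq_multiplier (multiplier_inv (k := (2 * N).+3) isT) => i.
by rewrite mulnS mulnDr !addnS add2n.
Qed.

Lemma sm_log_bounds N : 0 <= sm_log N.+1 <= (2 * N).+3%:R^-1 ^+ 2.
Proof.
have r0 : 0 <= (2 * N).+3%:R^-1 :> R by rewrite invr_ge0.
have r3 : (2 * N).+3%:R^-1 <= 3^-1 :> R by rewrite lef_pV2 ?posrE// ler_nat.
have c := sm_series_cvg (ltn0Sn N); rewrite mulnS in c.
apply/andP; split.
  by rewrite -oppr_le0; apply: cvgn_le (cvgN c) _ => K; rewrite oppr_le0;
    have /andP[] := sm_series_le K r0 r3.
by apply: cvgn_le c _ => K; have /andP[] := sm_series_le K r0 r3.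
Qed.

(** Telescoping, from [(M + 1) (M + 2) <= (2 M + 3)^2]. *)
Lemma sum_inv_sqr_le1 M : \sum_(N < M) (2 * N).+3%:R^-1 ^+ 2 <= 1 :> R.
Proof.
suff h : \sum_(N < M) (2 * N).+3%:R^-1 ^+ 2 <= 1 - M.+1%:R^-1 :> R.
  by rewrite (le_trans h)// gerBl invr_ge0.
elim: M => [|M IH]; first by rewrite big_ord0 invr1 subrr.
rewrite big_ord_recr/= (le_trans (lerD IH (lexx _)))//.
have -> : 1 - M.+2%:R^-1 = 1 - M.+1%:R^-1 + (M.+1%:R * M.+2%:R)^-1 :> R.
  by rewrite -!natr1; field; rewrite -?natrD ?natr1 ?pnatr_eq0.
rewrite lerD2l exprVn lef_pV2 ?posrE ?mulr_gt0 ?exprn_gt0//.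
rewrite -natrM -natrX ler_nat expnS expn1.
have h : (M <= 2 * M)%N by rewrite leq_pmull.
by apply: leq_mul; rewrite !ltnS ?leqW.
Qed.

(** The factors increase to a limit [L > 0], and [sm_coef i] is [L] times the infinite product over
    [N] of [expR (- sm_log (i + N).+1)]. A product up to [i] would have a varying number of factors;
    coming down from infinity, the factor number [N] has one form for all [i] and is a multiplier of
    constant [expR (1 / (2 N + 3)^2)], and these constants multiply to at most [expR 1]. *)
Lemma multiplier_sm_coef : exists M, multiplier M sm_coef.
Proof.
have coefE i M : sm_coef (i + M) = sm_coef i * \prod_(N < M) expR (sm_log (i + N).+1).
  elim: M => [|M IH]; first by rewrite big_ord0 addn0 mulr1.
  by rewrite addnS sm_coefS IH big_ord_recr/= mulrA.
have ndT : nondecreasing_seq sm_coef.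
  apply/nondecreasing_seqP => i; rewrite sm_coefS ler_peMr ?(ltW (sm_coef_gt0 i))//.
  by rewrite (le_trans _ (expR_ge1Dx _))// lerDl; have /andP[] := sm_log_bounds i.
have bT i : sm_coef i <= sm_coef 0 * expR 1.
  rewrite -[i]add0n coefE ler_pM2l ?sm_coef_gt0// -expR_sum ler_expR.
  apply: le_trans (sum_inv_sqr_le1 i); apply: ler_sum => N _.
  by rewrite add0n; have /andP[] := sm_log_bounds N.
have cT : cvgn sm_coef.
  apply: nondecreasing_is_cvgn => //; exists (sm_coef 0 * expR 1).
  by move=> _ [i _ <-].
pose L : R := limn sm_coef.
have L0 : 0 < L by rewrite (lt_le_trans (sm_coef_gt0 0))// nondecreasing_cvgn_le.
exists (L * expR 1).
apply: (@multiplier_cvg _ _ (fun M i => L * \prod_(N < M) expR (- sm_log (i + N).+1))).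
  move=> M; apply: multiplierM; first by have := multiplier_cst L; rewrite gtr0_norm.
  apply: (@le_multiplier _ (\prod_(N < M) expR ((2 * N).+3%:R^-1 ^+ 2))).
    by rewrite -expR_sum ler_expR sum_inv_sqr_le1.
  apply: (@multiplier_prod _ (fun N => expR ((2 * N).+3%:R^-1 ^+ 2))
    (fun N i => expR (- sm_log (i + N).+1))) => N.
  apply: multiplier_exp; apply: (multiplier_cvg (fun K => multiplier_sm_series K N)) => i.
  exact: sm_series_cvg.
move=> i.
have -> : (fun M => L * \prod_(N < M) expR (- sm_log (i + N).+1)) =
    (fun M => L * (sm_coef i / sm_coef (i + M))).
  apply/funext => M; congr (_ * _).
  rewrite coefE invfM mulrA mulfV ?gt_eqF ?sm_coef_gt0// mul1r.
  by rewrite -prodfV; apply: eq_bigr => N _; rewrite expRN.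
have cL : sm_coef (i + M) @[M --> \oo] --> L.
  have c : sm_coef @ \oo --> L := cT.
  by under eq_fun do rewrite addnC; move: c; rewrite -(cvg_shiftn i).
rewrite -[X in _ --> X](mulfK (lt0r_neq0 L0)) [sm_coef i * L]mulrC -mulrA.
apply: cvgMr; apply: cvgMr; apply: cvgV => //.
by rewrite lt0r_neq0.
Qed.

End salzer_multiplier.

(** * The kernel of the Gaver-Stehfest sums *)

Section stehfest_kernel.
Context {R : realType}.

(** Chosen so that the sum of [gs_coef n k * w^k] over [k] is [y * sk n y] at [y = 4 w (1 - w)], see
    [sum_gs_coef]. *)
Definition sk_coef n i : R := (-1) ^+ (n - i.+1) *
  ('C(n, i.+1) * i.+1 ^ n.+1 * 'C(2 * i.+1, i.+1))%:R / (n`!%:R * 4 ^+ i.+1).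

Definition sk n (y : R) := \sum_(i < n) sk_coef n i * y ^+ i.

Lemma sk_coefE n i : (i < n)%N -> sk_coef n i = sm_coef i * gk_coef n i.
Proof.
move=> lin; rewrite /sk_coef /sm_coef /gk_coef 2!natrM.
have f1 : n`!%:R != 0 :> R by rewrite pnatr_eq0 -lt0n fact_gt0.
have f2 : i.+1`!%:R != 0 :> R by rewrite pnatr_eq0 -lt0n fact_gt0.
have f3 : (n - i.+1)`!%:R != 0 :> R by rewrite pnatr_eq0 -lt0n fact_gt0.
have -> : 'C(n, i.+1)%:R = n`!%:R / (i.+1`!%:R * (n - i.+1)`!%:R) :> R.
  by rewrite -[in RHS](bin_fact lin) natrM (natrM _ (i.+1)`!) mulfK// mulf_neq0.
have e1 : expR (- i.+1%:R) * expR 1 ^+ i.+1 = 1 :> R.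
  by rewrite expRN -[X in expR X]mulr1 expRM_natl mulVf// expf_neq0// gt_eqF// expR_gt0.
have -> : (- i.+1%:R) ^+ (n - i.+1) = (-1) ^+ (n - i.+1) * i.+1%:R ^+ (n - i.+1) :> R.
  by rewrite exprNn.
have -> : (i.+1 ^ n.+1)%:R = i.+1%:R ^+ i.+2 * i.+1%:R ^+ (n - i.+1) :> R.
  by rewrite natrX -exprD addSn subnKC.
have f4 : 4 ^+ i.+1 != 0 :> R by rewrite expf_neq0.
transitivity ((expR (- i.+1%:R) * expR 1 ^+ i.+1) * ((-1) ^+ (n - i.+1) *
  (n`!%:R / (i.+1`!%:R * (n - i.+1)`!%:R) * (i.+1%:R ^+ i.+2 * i.+1%:R ^+ (n - i.+1)) *
  'C(2 * i.+1, i.+1)%:R) / (n`!%:R * 4 ^+ i.+1)) : R).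
  by rewrite e1 mul1r.
move: (4 ^+ i.+1 : R) f4 (n`!%:R : R) f1 (i.+1`!%:R : R) f2 ((n - i.+1)`!%:R : R) f3.
move=> a a0 b b0 c c0 d d0.
move: (expR 1 ^+ i.+1 : R) (expR (- i.+1%:R) : R) (i.+1%:R ^+ i.+2 : R).
move: ((-1) ^+ (n - i.+1) : R) (i.+1%:R ^+ (n - i.+1) : R) ('C(2 * i.+1, i.+1)%:R : R).
by move=> *; field; rewrite a0 b0 c0 d0.
Qed.

Lemma skE n y : sk n y = pev (fun i => sm_coef i * gk_coef n i) n y.
Proof. by apply: eq_bigr => i _; rewrite sk_coefE. Qed.

Lemma sk_sqr_le : exists2 C : R, 0 <= C & forall n (y : R), (0 < n)%N ->
  0 <= y < 1 -> sk n y ^+ 2 * (1 - y) <= C.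
Proof.
have [M HM] := @multiplier_sm_coef R; have [C C0 HC] := @gk_sqr_le R.
exists (M ^+ 2 * C) => [|n y n0 /andP[y0 y1]]; first by rewrite mulr_ge0// sqr_ge0.
have d0 : 0 < 1 - y by rewrite subr_gt0.
(* Since [1 - z >= 1 - y], one bound holds on all of [[0, y]], as a multiplier demands. *)
have B z : 0 <= z <= y -> `|pev (gk_coef n) n z| <= Num.sqrt (C / (1 - y)).
  move=> /andP[z0 zy]; rewrite -sqrtr_sqr ler_wsqrtr// ler_pdivlMr//.
  have := HC n z n0; rewrite z0 (le_lt_trans zy)// => /(_ isT); apply: le_trans.
  by rewrite ler_wpM2l ?sqr_ge0// lerB.
have := HM _ _ _ _ B y; rewrite y0 lexx -skE => /(_ isT) h.
have s2 : Num.sqrt (C / (1 - y)) ^+ 2 * (1 - y) = C.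
  by rewrite sqr_sqrtr ?divr_ge0 ?(ltW d0)// divfK ?gt_eqF.
rewrite -[in leRHS]s2 mulrA -exprMn ler_pM2r// -real_normK ?num_real//.
by apply: lerXn2r => //; rewrite nnegrE//; apply: le_trans h.
Qed.

Lemma sk_increment_le : exists2 C : R, 0 <= C & forall n (y : R), (0 < n)%N ->
  0 <= y < 1 -> `|sk n.+1 y - sk n y| <= C.
Proof.
have [M HM] := @multiplier_sm_coef R; have [C C0 HC] := @gk_increment_le R.
exists (`|M * C|) => // n y n0 /andP[y0 y1].
(* Padding [gk n] with a zero coefficient makes the increment one polynomial of length [n.+1], to
   which the multiplier applies. *)
pose a i := gk_coef n.+1 i - (if (i < n)%N then gk_coef n i else 0) : R.
have aE (t : nat -> R) z : pev (fun i => t i * a i) n.+1 z =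
    pev (fun i => t i * gk_coef n.+1 i) n.+1 z - pev (fun i => t i * gk_coef n i) n z.
  rewrite /pev !big_ord_recr/= /a ltnn subr0 addrAC -sumrB; congr (_ + _).
  by apply: eq_bigr => i _; rewrite ltn_ord; ring.
have := HM n.+1 a y C _ y; rewrite aE -!skE y0 lexx => /(_ _ isT) h.
rewrite (le_trans (h _))// ?ler_norm// => z /andP[z0 zy].
have -> : pev a n.+1 z = gk n.+1 z - gk n z.
  transitivity (pev (fun i => 1 * a i) n.+1 z); first by apply: eq_bigr => i _; rewrite mul1r.
  by rewrite (aE (fun=> 1)); congr (_ - _); apply: eq_bigr => i _; rewrite mul1r.
by apply: HC => //; rewrite z0 (le_lt_trans zy).
Qed.

Lemma sk_le_linear : exists2 C : R, 0 <= C & forall n (y : R), (0 < n)%N ->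
  0 <= y < 1 -> `|sk n y| <= C * n%:R.
Proof.
have [C C0 HC] := sk_increment_le.
exists (C + `|sk_coef 1 0|) => [|n y n0 y01]; first by rewrite addr_ge0.
elim: n n0 => // -[_ _|n IH _].
  by rewrite mulr1 /sk big_ord1 expr0 mulr1 lerDr.
rewrite -[sk _ _](subrK (sk n.+1 y)) (le_trans (ler_normD _ _))//.
rewrite -[n.+2%:R]natr1 mulrDr mulr1 addrC lerD ?IH//.
by rewrite (le_trans (HC _ _ _ _))// lerDl.
Qed.

Lemma sk_cvg0 (y : R) : 0 <= y < 1 -> sk n y @[n --> \oo] --> 0.
Proof.
move=> /andP[y0 y1]; have [M HM] := @multiplier_sm_coef R.
apply/cvgrPdist_le => e e0.
have d0 : 0 < e / (`|M| + 1) by rewrite divr_gt0// ltr_wpDl.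
have [N HN] := gk_cvg0 y1 d0.
exists N => // n /= Nn; rewrite sub0r normrN skE.
have := HM n (gk_coef n) y _ (fun z => HN n z Nn) y; rewrite y0 lexx => /(_ isT) h.
rewrite (le_trans h)// mulrA ler_pdivrMr ?ltr_wpDl// mulrC ler_pM2l//.
by rewrite (le_trans (ler_norm _))// lerDl.
Qed.

(** With [j = i + 1], [sk_coef n i] is [- (n + 1 - j) / j] times [sk_coef n.+1 i], and
    [1 + (n + 1 - j) / j = (n + 1) / j]. The denominator is the one that differentiating [y^j]
    cancels in [is_derive_sk]. *)
Lemma sk_coef_increment n i : (i < n)%N ->
  sk_coef n.+1 i - sk_coef n i = n.+1%:R / i.+1%:R * sk_coef n.+1 i.
Proof.
move=> lin; rewrite /sk_coef subSS -[(n - i)%N](subnSK lin) exprS factS.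
rewrite [(i.+1 ^ n.+2)%N]expnS !(natrM _ (_ * _)) !(natrM _ 'C(_, i.+1)).
rewrite (natrM _ n.+1) (natrM _ i.+1).
have e : n.+1%:R * 'C(n, i.+1)%:R = (n.+1%:R - i.+1%:R) * 'C(n.+1, i.+1)%:R :> R.
  have := congr1 (fun k => k%:R : R) (mul_bin_down n.+1 i.+1).
  by rewrite /= !natrM natrB// ltnS ltnW.
have f0 : n`!%:R != 0 :> R by rewrite pnatr_eq0 -lt0n fact_gt0.
have q0 : 4 ^+ i.+1 != 0 :> R by rewrite expf_neq0.
have n0 : n.+1%:R != 0 :> R by rewrite pnatr_eq0.
have i0 : i.+1%:R != 0 :> R by rewrite pnatr_eq0.
have {e} -> : 'C(n, i.+1)%:R = (n.+1%:R - i.+1%:R) * 'C(n.+1, i.+1)%:R / n.+1%:R :> R.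
  by rewrite -e mulrC mulKf.
move: (4 ^+ i.+1 : R) q0 (n`!%:R : R) f0 (n.+1%:R : R) n0 (i.+1%:R : R) i0.
move: ((-1) ^+ (n - i.+1) : R) ((i.+1 ^ n.+1)%:R : R) ('C(2 * i.+1, i.+1)%:R : R).
move=> s P B q q0 f f0 a a0 b b0; field.
by rewrite q0 f0 a0 b0.
Qed.

Lemma is_derive_sk n (y : R) : (0 < n)%N ->
  is_derive y (1 : R) (fun y => y * (sk n.+1 y - sk n y)) (n.+1%:R * sk n.+1 y).
Proof.
move=> n0.
have -> : (fun y => y * (sk n.+1 y - sk n y)) =
    fun y => \sum_(i < n.+1) (n.+1%:R / i.+1%:R * sk_coef n.+1 i) * y ^+ i.+1.
  apply/funext => z; rewrite /sk !big_ord_recr/= addrAC -sumrB mulrDr mulr_sumr; congr (_ + _).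
    by apply: eq_bigr => i _; rewrite exprS -mulrBl sk_coef_increment//; ring.
  by rewrite divff ?pnatr_eq0// mul1r exprS mulrCA.
rewrite -fct_sumE /sk mulr_sumr; apply: is_derive_sum => i.
apply: is_derive_eq (is_derive_monomial _ _ _) _.
by rewrite /=; field; rewrite nat1r pnatr_eq0.
Qed.

(** A range of [j] that does not depend on [k] allows the two sums to be exchanged; the added terms
    with [2 j < k] vanish because [k - j > j]. *)
Lemma gs_coefE n k : (0 < k)%N -> gs_coef n k = \sum_(i < n) (-1) ^+ (n + k) / n`!%:R *
  (if (i.+1 <= k)%N then
     (i.+1 ^ n.+1 * 'C(n, i.+1) * 'C(2 * i.+1, i.+1) * 'C(i.+1, k - i.+1))%:R else 0) :> R.
Proof.
move=> k0; rewrite /gs_coef -mulr_sumr; congr (_ * _).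
rewrite (big_nat_widenl _ 0)// (big_nat_widen _ _ n.+1); last by rewrite ltnS geq_minr.
have h : (k.+1./2 <= 0)%N = false by case: (k) k0.
rewrite big_mkord big_mkcond big_ord_recl h/= add0r.
apply: eq_bigr => i _; rewrite /bump/= add1n ltnS leq_min.
rewrite (ltn_ord i) andbT; case: (leqP i.+1 k) => ik; last by rewrite andbF.
rewrite andbT; case: leqP => // ki.
rewrite (@bin_small i.+1 (k - i.+1)) ?muln0//.
by move: ki; rewrite geq_uphalf_double doubleS ltnS ltn_subRL addnn; apply: leq_trans.
Qed.

(** For fixed [j], the sum over [k = j + l] of [(-1)^l 'C(j, l) w^k] is [(w (1 - w))^j] by the
    binomial theorem. *)
Lemma sum_gs_coef n (w : R) :
  \sum_(1 <= k < (2 * n).+1) gs_coef n k * w ^+ k =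
  4 * (w * (1 - w)) * sk n (4 * (w * (1 - w))).
Proof.
transitivity (\sum_(1 <= k < (2 * n).+1) \sum_(i < n) (-1) ^+ (n + k) / n`!%:R *
  (if (i.+1 <= k)%N then
     (i.+1 ^ n.+1 * 'C(n, i.+1) * 'C(2 * i.+1, i.+1) * 'C(i.+1, k - i.+1))%:R else 0) * w ^+ k).
  by apply: eq_big_nat => k /andP[k0 _]; rewrite gs_coefE// mulr_suml.
rewrite exchange_big/= /sk mulr_sumr; apply: eq_bigr => i _.
have lin : (i < n)%N by [].
set j := i.+1; pose c : R := (j ^ n.+1 * 'C(n, j) * 'C(2 * j, j))%:R.
transitivity (\sum_(j <= k < (2 * n).+1) (-1) ^+ (n + k) / n`!%:R * c *
   'C(j, k - j)%:R * w ^+ k).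
  rewrite [RHS](big_nat_widenl _ 1)// [RHS]big_mkcond/=; apply: eq_bigr => k _.
  by case: ifP => _; rewrite ?mulr0 ?mul0r// natrM !mulrA.
rewrite -{1}[j]add0n big_addn.
have jn : (j.+1 <= (2 * n).+1 - j)%N.
  by rewrite ltn_subRL ltnS addnn -mul2n leq_mul2l.
rewrite (big_cat_nat (leq0n j.+1) jn)//= [X in _ + X]big_nat_cond [X in _ + X]big1 ?addr0; last first.
  move=> l /andP[/andP[jl _] _]; rewrite addnK bin_small//.
  by rewrite mulr0 mul0r.
rewrite big_mkord.
transitivity ((-1) ^+ (n - j) / n`!%:R * c * (w * (1 - w)) ^+ j); last first.
  have -> : c = ('C(n, j) * j ^ n.+1 * 'C(2 * j, j))%:R.
    by rewrite /c [('C(n, j) * _)%N]mulnC.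
  rewrite mulrCA -exprS /sk_coef -/j [(4 * _) ^+ j]exprMn invfM.
  have q0 : 4 ^+ j != 0 :> R by rewrite expf_neq0.
  by field; rewrite q0 pnatr_eq0 -lt0n fact_gt0.
rewrite exprMn exprBn !mulr_sumr; apply: eq_bigr => l _.
rewrite addnK expr1n mulr1 -mulr_natr [w ^+ (l + j)]exprD.
have -> : (-1) ^+ (n + (l + j)) = (-1) ^+ (n - j) * (-1) ^+ l :> R.
  rewrite -exprD -signr_odd -[RHS]signr_odd; congr (_ ^+ _).
  by rewrite !oddD oddB// -addbA [odd l (+) _]addbC.
by ring.
Qed.

(** The [n]-th finite difference of a power. The shift [x] serves the induction, in which
    [j 'C(n + 1, j) = (n + 1) 'C(n, j - 1)] moves [j] by one. *)
Lemma sum_bin_expn n (k : nat) (x : R) : (k <= n)%N ->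
  \sum_(j < n.+1) (-1) ^+ (n - j) * 'C(n, j)%:R * (j%:R + x) ^+ k =
  if k == n then n`!%:R else 0.
Proof.
elim: n k x => [|n IH] k x.
  by rewrite leqn0 => /eqP ->; rewrite big_ord1 !expr0 !mulr1.
elim: k => [_|k IHk kn].
  rewrite /= -[RHS](expr0n R n.+1) -[X in _ = X ^+ _](addNr (1 : R)) exprDn.
  by apply: eq_bigr => j _; rewrite expr0 expr1n !mulr1 mulr_natr.
transitivity (x * (\sum_(j < n.+2) (-1) ^+ (n.+1 - j) * 'C(n.+1, j)%:R * (j%:R + x) ^+ k) +
    n.+1%:R * (\sum_(j < n.+1) (-1) ^+ (n - j) * 'C(n, j)%:R * (j%:R + (x + 1)) ^+ k)).
  transitivity (x * (\sum_(j < n.+2) (-1) ^+ (n.+1 - j) * 'C(n.+1, j)%:R * (j%:R + x) ^+ k) +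
    \sum_(j < n.+2) (-1) ^+ (n.+1 - j) * 'C(n.+1, j)%:R * (j%:R * (j%:R + x) ^+ k)).
    by rewrite mulr_sumr -big_split/=; apply: eq_bigr => j _; rewrite [_ ^+ k.+1]exprS; ring.
  congr (_ + _); rewrite big_ord_recl/= mul0r mulr0 add0r mulr_sumr.
  apply: eq_bigr => i _; rewrite /bump/= add1n subSS -natr1.
  have e : i.+1%:R * 'C(n.+1, i.+1)%:R = n.+1%:R * 'C(n, i)%:R :> R.
    by rewrite -!natrM -mul_bin_diag.
  have -> : i%:R + (x + 1) = i%:R + 1 + x by ring.
  rewrite natr1; transitivity ((-1) ^+ (n - i) * (i.+1%:R * 'C(n.+1, i.+1)%:R) *
    (i.+1%:R + x) ^+ k); first by ring.
  by rewrite e; ring.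
rewrite IHk ?(ltnW kn)// IH// eqn_leq [(n.+1 <= k)%N]leqNgt kn andbF mulr0 add0r.
by rewrite eqSS; case: eqP => _; rewrite ?mulr0// -natrM factS.
Qed.

(* A primitive of [(1 - 4 v^2)^i], from
   [(v (1 - 4 v^2)^i.+1)' = (2 i + 3) (1 - 4 v^2)^i.+1 - 2 (i + 1) (1 - 4 v^2)^i]. *)
Fixpoint beta_prim i (v : R) : R := if i is i'.+1 then
    (v * (1 - 4 * v ^+ 2) ^+ i + (2 * i)%:R * beta_prim i' v) / (2 * i).+1%:R
  else v.

Lemma is_derive_beta_prim i (v : R) :
  is_derive v (1 : R) (beta_prim i) ((1 - 4 * v ^+ 2) ^+ i).
Proof.
elim: i => [|i IH]; first by rewrite expr0; exact: is_derive_id.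
have dy : is_derive v (1 : R) (fun v => 1 - 4 * v ^+ 2) (- (8 * v)).
  have := is_derive_monomial 4 v 2 => d.
  by apply: is_derive_eq; rewrite /=; ring.
have dp : is_derive v (1 : R) (fun v => (1 - 4 * v ^+ 2) ^+ i.+1)
   (i.+1%:R * (1 - 4 * v ^+ 2) ^+ i * - (8 * v)).
  have -> : (fun v : R => (1 - 4 * v ^+ 2) ^+ i.+1) = (fun v : R => 1 - 4 * v ^+ 2) ^+ i.+1.
    by apply/funext => z; rewrite exprfctE.
  by apply: is_derive_eq.
have -> : beta_prim i.+1 = fun v => (v * (1 - 4 * v ^+ 2) ^+ i.+1 +
  (2 * i.+1)%:R * beta_prim i v) / (2 * i.+1).+1%:R by [].
apply: is_derive_eq; rewrite /GRing.scale/= [(1 - 4 * v ^+ 2) ^+ i.+1]exprS.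
rewrite -[(2 * i.+1).+1%:R]natr1 (natrM _ 2 i.+1) -[i.+1%:R]natr1.
have i0 : 2 * (i%:R + 1) + 1 != 0 :> R by rewrite natr1 -natrM natr1 pnatr_eq0.
by field.
Qed.

Definition sk_prim n (v : R) := \sum_(i < n) 4 * sk_coef n i * beta_prim i v.

Lemma is_derive_sk_prim n (v : R) :
  is_derive v (1 : R) (sk_prim n) (4 * sk n (1 - 4 * v ^+ 2)).
Proof.
rewrite /sk mulr_sumr (_ : sk_prim n = \sum_(i < n) (fun v => 4 * sk_coef n i * beta_prim i v)).
  apply: is_derive_sum => i; have := is_derive_beta_prim i v => ?.
  by apply: is_derive_eq; rewrite /GRing.scale/= mulrA.
by rewrite fct_sumE.
Qed.

Lemma sk_prim0 n : sk_prim n 0 = 0.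
Proof.
have b0 i : beta_prim i 0 = 0 by elim: i => //= i ->; rewrite mul0r mulr0 addr0 mul0r.
by rewrite /sk_prim big1// => i _; rewrite b0 mulr0.
Qed.

(** A Wallis integral: the central binomial in [sk_coef] cancels the one in the integral of
    [(1 - 4 v^2)^i] over [[0, 1/2]]. *)
Lemma beta_prim_half i :
  4 * ('C(2 * i.+1, i.+1)%:R / 4 ^+ i.+1) * beta_prim i 2^-1 = i.+1%:R^-1 :> R.
Proof.
elim: i => [|i IH].
  by rewrite muln1 bin1 expr1 /=; field.
have y0 : 1 - 4 * 2^-1 ^+ 2 = 0 :> R by field.
rewrite /= y0 [0 ^+ i.+1]exprS mul0r mulr0 add0r.
have -> : 'C(2 * i.+2, i.+2)%:R = 2 * (2 * i.+1).+1%:R * 'C(2 * i.+1, i.+1)%:R / i.+2%:R :> R.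
  by rewrite -!natrM -central_binS natrM mulrC mulKf// pnatr_eq0.
have -> : beta_prim i 2^-1 = i.+1%:R^-1 / (4 * ('C(2 * i.+1, i.+1)%:R / 4 ^+ i.+1)) :> R.
  rewrite -IH mulrC mulKf// !mulf_neq0// ?invr_neq0 ?expf_neq0// pnatr_eq0 -lt0n bin_gt0.
  by rewrite leq_pmull.
have n1 : 'C(2 * i.+1, i.+1)%:R != 0 :> R by rewrite pnatr_eq0 -lt0n bin_gt0 leq_pmull.
have n2 : (2 * i.+1).+1%:R != 0 :> R by rewrite pnatr_eq0.
have n3 : i.+1%:R != 0 :> R by rewrite pnatr_eq0.
have n4 : i.+2%:R != 0 :> R by rewrite pnatr_eq0.
have n5 : 4 ^+ i.+1 != 0 :> R by rewrite expf_neq0.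
rewrite [4 ^+ i.+2]exprS natrM.
move: ('C(2 * i.+1, i.+1)%:R : R) ((2 * i.+1).+1%:R : R) (i.+1%:R : R) (i.+2%:R : R) (4 ^+ i.+1 : R)
    n1 n2 n3 n4 n5.
by move=> a b c d e *; field; apply/and5P.
Qed.

(** By [beta_prim_half] this is the sum of [(-1)^(n - j) 'C(n, j) j^n / n!], an [n]-th difference of
    [j^n]; the term [j = 0] that [sk_prim] lacks is zero as [n > 0]. *)
Lemma sk_prim_half n : (0 < n)%N -> sk_prim n 2^-1 = 1.
Proof.
move=> n0.
have f0 : n`!%:R != 0 :> R by rewrite pnatr_eq0 -lt0n fact_gt0.
have := sum_bin_expn 0 (leqnn n); rewrite eqxx big_ord_recl addr0 expr0n.
rewrite -[n == 0%N]negbK -lt0n n0 mulr0 add0r => h.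
rewrite -[RHS](mulfV f0) -[X in X / _]h mulr_suml; apply: eq_bigr => i _.
rewrite /= addr0 /sk_coef !natrM.
transitivity ((-1) ^+ (n - i.+1) * 'C(n, i.+1)%:R * (i.+1 ^ n.+1)%:R / n`!%:R *
  (4 * ('C(2 * i.+1, i.+1)%:R / 4 ^+ i.+1) * beta_prim i 2^-1)).
  by rewrite invfM; ring.
rewrite beta_prim_half natrX exprS; field.
by rewrite f0 nat1r pnatr_eq0.
Qed.

Lemma y_bounds (v : R) : 0 < v -> v <= 2^-1 -> 0 <= 1 - 4 * v ^+ 2 < 1.
Proof. by move=> v0 v1; apply/andP; split; nra. Qed.

Lemma sk_le_inv : exists2 C : R, 0 <= C & forall n (v : R), (0 < n)%N ->
  0 < v -> v <= 2^-1 -> `|4 * sk n (1 - 4 * v ^+ 2)| <= C / v.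
Proof.
have [C C0 HC] := sk_sqr_le.
(* As [1 - y = 4 v^2], [(4 sk v)^2 = 4 sk^2 (1 - y) <= 4 C]. *)
exists (Num.sqrt (4 * C)) => [|n v n0 v0 v1]; first exact: sqrtr_ge0.
have := HC n _ n0 (y_bounds v0 v1).
have -> : `|4 * sk n (1 - 4 * v ^+ 2)| <= Num.sqrt (4 * C) / v =
    (Num.sqrt ((4 * sk n (1 - 4 * v ^+ 2) * v) ^+ 2) <= Num.sqrt (4 * C)).
  by rewrite ler_pdivlMr// sqrtr_sqr [in RHS]normrM (gtr0_norm v0).
move=> h.
by rewrite ler_wsqrtr//; move: (sk _ _) h => s; lra.
Qed.

Lemma sk_halfcvg0 (v : R) : 0 < v -> v <= 2^-1 ->
  4 * sk n (1 - 4 * v ^+ 2) @[n --> \oo] --> 0.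
Proof.
move=> v0 v1; rewrite -[X in _ --> X](mulr0 4); apply: cvgMr.
exact: sk_cvg0 (y_bounds v0 v1).
Qed.

Lemma continuous_sk n : continuous (sk n).
Proof.
move=> x; have [d _] : is_derive x (1 : R) (sk n)
    (\sum_(i < n) sk_coef n i * i%:R * x ^+ i.-1).
  have -> : sk n = \sum_(i < n) (fun y => sk_coef n i * y ^+ i) by rewrite fct_sumE.
  by apply: is_derive_sum => i; exact: is_derive_monomial.
by apply: differentiable_continuous; apply/derivable1_diffP.
Qed.

Lemma sk_prim_le_small : exists2 C : R, 0 <= C & forall n (x : R), (0 < n)%N ->
  0 <= x -> x <= 2^-1 -> x <= n%:R^-1 -> `|sk_prim n x| <= C.
Proof.
have [C C0 HC] := sk_le_linear.
exists (4 * C) => [|n x n0 x0 x1 xn]; first by rewrite mulr_ge0.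
have nn : 0 < n%:R :> R by rewrite ltr0n.
(* [sk_le_linear] stops short of [y = 1], which is [v = 0]; continuity adds this point. *)
have sk1 : `|sk n 1| <= C * n%:R.
  have c1 : sk n y @[y --> 1^'-] --> sk n 1.
    apply: cvg_at_left_filter.
    exact: continuous_sk.
  have {}c1 : `|sk n y| @[y --> 1^'-] --> `|sk n 1| by exact: cvg_norm c1.
  rewrite -(cvg_lim _ c1)//; apply: limr_le; first exact: cvgP c1.
  near=> y; apply: HC => //; apply/andP; split; last by near: y; exact: nbhs_left_lt.
  by near: y; apply: nbhs_left_ge.
have key v : 0 <= v <= x -> `|4 * sk n (1 - 4 * v ^+ 2)| <= 4 * (C * n%:R).
  move=> /andP[v0 vx]; rewrite normrM ger0_norm// ler_pM2l//.
  have [->|vn0] := eqVneq v 0; first by rewrite expr0n mulr0 subr0.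
  have vp : 0 < v by rewrite lt_neqAle eq_sym vn0.
  by apply: HC => //; apply: y_bounds => //; exact: le_trans x1.
have := @is_derive1_norm_le R (sk_prim n) _ _ 0 x x0 (fun v _ => is_derive_sk_prim n v) key.
rewrite sk_prim0 !subr0 => h; rewrite (le_trans h)// -mulrA ler_pM2l//.
rewrite -mulrA -[leRHS]mulr1 ler_wpM2l//.
by rewrite -ler_pdivlMl// mulr1.
Unshelve. all: by end_near. Qed.

(* With [r v = y (sk n y - sk n.-1 y) / n] and [y = 1 - 4 v^2], [r' = - 2 v * (4 sk n y)],
   so that [4 sk n y] is [(- r / (2 v))' - r / (2 v^2)], where [r = O(1 / n)]. *)
Lemma sk_prim_le : exists2 C : R, 0 <= C & forall n (x : R), (1 < n)%N ->
  0 <= x -> x <= 2^-1 -> `|sk_prim n x| <= C.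
Proof.
have [C1 C10 H1] := sk_prim_le_small; have [C C0 HC] := sk_increment_le.
exists (C1 + 2 * C) => [|n x n1 x0 x1]; first by rewrite addr_ge0// mulr_ge0.
case: n n1 => // n; rewrite ltnS => n0.
have nn : 0 < n.+1%:R :> R by rewrite ltr0n.
(* Up to [d] the linear bound on the kernel suffices; beyond it, [|r| <= d C] is divided by
   [v >= d]. *)
set d : R := n.+1%:R^-1; have d0 : 0 < d by rewrite invr_gt0.
have d2 : d <= 2^-1 by rewrite lef_pV2 ?posrE// ler_nat ltnS.
have [xd|/ltW dx] := leP x d.
  by rewrite (le_trans (H1 n.+1 x _ _ _ _))// lerDl mulr_ge0.
have H1d := H1 n.+1 d isT (ltW d0) d2 (lexx _).
pose r (v : R) := d * ((1 - 4 * v ^+ 2) * (sk n.+1 (1 - 4 * v ^+ 2) - sk n (1 - 4 * v ^+ 2))).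
have in01 v : d <= v <= x -> 0 < v /\ v <= 2^-1.
  by move=> /andP[dv vx]; split; [exact: lt_le_trans dv|exact: le_trans x1].
have rle v : d <= v <= x -> `|r v| <= d * C.
  move=> /in01[v0 v1]; have /andP[y0 y1] := y_bounds v0 v1.
  rewrite /r normrM gtr0_norm// ler_pM2l// normrM -[C]mul1r ler_pM//.
    by rewrite ger0_norm// ltW.
  by apply: HC => //; rewrite y0.
have rd (v : R) : is_derive v (1 : R) r (- 2 * v * (4 * sk n.+1 (1 - 4 * v ^+ 2))).
  have dy : is_derive v (1 : R) (fun v => 1 - 4 * v ^+ 2) (- (8 * v)).
    have := is_derive_monomial 4 v 2 => ?.
    by apply: is_derive_eq; rewrite /=; ring.
  have ds := is_derive_sk (1 - 4 * v ^+ 2) n0.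
  have dc := is_derive1_comp (g := fun v => 1 - 4 * v ^+ 2) ds dy.
  have -> : r = fun v => d * ((fun y => y * (sk n.+1 y - sk n y)) \o
    (fun v => 1 - 4 * v ^+ 2)) v by [].
  apply: is_derive_eq; rewrite /GRing.scale/= /d.
  by field; rewrite nat1r pnatr_eq0.
(* For [c = d C] the correction [(r + c) / (2 v^2)] is nonnegative, for [c = - d C] it is
   nonpositive. It can thus be dropped from the upper and the lower estimate instead of being
   integrated. *)
have gd (c v : R) : 0 < v -> is_derive v (1 : R) (fun v => - (r v + c) / (2 * v))
    (4 * sk n.+1 (1 - 4 * v ^+ 2) + (r v + c) / (2 * v ^+ 2)).
  move=> v0; have v20 : 2 * v != 0 by rewrite gt_eqF// mulr_gt0.
  have := rd v => ?.
  apply: is_derive_eq; rewrite /GRing.scale/=.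
  by field; rewrite gt_eqF.
have rb c v : `|c| <= d * C -> d <= v <= x -> `|- (r v + c) / (2 * v)| <= C.
  move=> cC dvx; have [v0 _] := in01 _ dvx; have /andP[dv _] := dvx.
  have v20 : 0 < 2 * v by rewrite mulr_gt0.
  rewrite normrM normrN normfV (gtr0_norm v20) ler_pdivrMr// (le_trans (ler_normD _ _))//.
  by have := rle _ dvx; have := ler_wpM2r C0 dv; lra.
have dC0 : 0 <= d * C by rewrite mulr_ge0// ltW.
have dxx : d <= x <= x by rewrite dx lexx.
have ddx : d <= d <= x by rewrite dx lexx.
have up := @is_derive1_le R _ _ _ _ d x dx (fun v _ => is_derive_sk_prim n.+1 v)
  (fun v dvx => gd (d * C) v (proj1 (in01 _ dvx))).
have lo := @is_derive1_le R _ _ _ _ d x dx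
  (fun v dvx => gd (- (d * C)) v (proj1 (in01 _ dvx))) (fun v _ => is_derive_sk_prim n.+1 v).
have {}up : sk_prim n.+1 x - sk_prim n.+1 d <= 2 * C.
  apply: le_trans (up _) _ => [v dvx|].
    have [v0 _] := in01 _ dvx; have := rle _ dvx; rewrite ler_norml => /andP[rl _].
    by rewrite lerDl divr_ge0 ?mulr_ge0 ?sqr_ge0//; lra.
  have := rb (d * C) x _ dxx; have := rb (d * C) d _ ddx; rewrite ger0_norm// !ler_norml.
  by move=> /(_ (lexx _)) /andP[? ?] /(_ (lexx _)) /andP[? ?]; lra.
have {}lo : - (2 * C) <= sk_prim n.+1 x - sk_prim n.+1 d.
  apply: le_trans _ (lo _) => [|v dvx].
    have := rb (- (d * C)) x _ dxx; have := rb (- (d * C)) d _ ddx.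
    rewrite normrN ger0_norm// !ler_norml.
    by move=> /(_ (lexx _)) /andP[? ?] /(_ (lexx _)) /andP[? ?]; lra.
  have [v0 _] := in01 _ dvx; have := rle _ dvx; rewrite ler_norml => /andP[_ rl].
  by rewrite gerDl pmulr_lle0 ?invr_gt0 ?mulr_gt0 ?exprn_gt0// subr_le0.
move: H1d; rewrite !ler_norml => /andP[l1 l2]; apply/andP; split; lra.
Qed.

End stehfest_kernel.

(** * Reduction to integrals on (-1/2, 1/2) *)

Section completed_lebesgue.
Context {R : realType}.
Local Notation mu := (@completed_lebesgue_measure R).
Local Notation lam := (@lebesgue_measure R).
Local Notation bR := (measurableTypeR R).
Local Notation cR := (lebesgueTypeR R).

Lemma measurable_borel_lebesgue (A : set R) :
  measurable (A : set bR) -> measurable (A : set cR).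
Proof. exact: sub_caratheodory. Qed.

Lemma measurable_id_lebesgue : measurable_fun [set: cR] (id : cR -> bR).
Proof. by move=> _ A mA; rewrite setTI preimage_id; exact: measurable_borel_lebesgue. Qed.

Lemma measurable_fun_lebesgue d (T : measurableType d) (D : set R) (h : R -> T) :
  measurable (D : set bR) -> measurable_fun (D : set bR) h ->
  measurable_fun (D : set cR) h.
Proof. by move=> mD mh _ A mA; apply: measurable_borel_lebesgue; exact: mh. Qed.

(** The image of the completed measure under the identity, from Lebesgue to Borel sets, is Lebesgue
    measure. *)
Lemma ge0_integral_completed (D : set R) (h : R -> \bar R) :
  measurable (D : set bR) -> measurable_fun (D : set bR) h ->
  (forall t, D t -> (0 <= h t)%E) ->
  (\int[mu]_(t in (D : set cR)) h t = \int[lam]_(t in D) h t)%E.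
Proof.
move=> mD mh h0.
have := @ge0_integral_pushforward _ _ cR bR R id measurable_id_lebesgue mu D h mD mh.
move=> /(_ _)/wrap[t /set_mem|<-]; first exact: h0.
apply: eq_measure_integral => [|A mA _]; first exact: measurable_id_lebesgue.
by rewrite /= /pushforward preimage_id.
Qed.

Lemma integral_completed (D : set R) (h : R -> \bar R) :
  measurable (D : set bR) -> measurable_fun (D : set bR) h ->
  (\int[mu]_(t in (D : set cR)) h t = \int[lam]_(t in D) h t)%E.
Proof.
move=> mD mh; rewrite integralE [in RHS]integralE; congr (_ - _)%E.
  by apply: ge0_integral_completed => //; exact: measurable_funepos.
by apply: ge0_integral_completed => //; exact: measurable_funeneg.
Qed.

(** Each set [f > q] with [q] rational is Borel up to a null set, and [N] collects these countably
    many null sets. *)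
Lemma measurable_fun_borel (D : set R) (f : R -> R) :
  measurable (D : set bR) -> measurable_fun (D : set cR) (f : cR -> R) ->
  exists N : set R, [/\ measurable (N : set bR), lam N = 0%E &
    measurable_fun (D `\` N : set bR) (f : bR -> R)].
Proof.
move=> mD mf.
(* An enumeration of the rationals, with value [0] at indices that encode none. *)
pose q n : R := ratr (odflt 0 (unpickle n : option rat)).
have mDq n : exists A M : set R, [/\ measurable (A : set bR), measurable (M : set bR),
    lam M = 0%E, A `<=` D `&` f @^-1` `]q n, +oo[%classic &
    D `&` f @^-1` `]q n, +oo[%classic `<=` A `|` M].
  have : measurable (D `&` f @^-1` `]q n, +oo[%classic : set cR).
    by apply: mf => //; exact: measurable_borel_lebesgue.
  have := @completed_caratheodory_measurable R; rewrite g_sigma_completed_algebra_genE => E.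
  move=> mX; have : completed_algebra_gen lam (D `&` f @^-1` `]q n, +oo[%classic).
    by rewrite E.
  move=> [A mA [Z [M [mM M0 ZM]] <-]]; exists A, M; split => //.
  by move=> t [At|/ZM Mt]; [left|right].
have {}mDq n : exists AM : set R * set R, [/\ measurable (AM.1 : set bR), measurable (AM.2 : set bR),
    lam AM.2 = 0%E, AM.1 `<=` D `&` f @^-1` `]q n, +oo[%classic &
    D `&` f @^-1` `]q n, +oo[%classic `<=` AM.1 `|` AM.2].
  by have [A [M h]] := mDq n; exists (A, M).
have /choice[AM HAM] := mDq.
pose N := \bigcup_n (AM n).2.
have mN : measurable (N : set bR).
  by apply: bigcupT_measurable => n; have [] := HAM n.
exists N; split => //.
  apply/negligibleP => //; apply: negligible_bigcup => n.
  by have [_ mM M0 _ _] := HAM n; apply/negligibleP.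
move=> mDN; apply: (measurability _ (RGenOInfty.measurableE R)) => // _ [_ [a ->] <-].
have -> : (D `\` N) `&` f @^-1` `]a, +oo[%classic =
    \bigcup_n (if a <= q n then (AM n).1 `\` N else set0).
  apply/seteqP; split => [t [[Dt Nt]]|t [n _]].
    rewrite /= in_itv/= andbT => /rat_in_itvoo[r]; rewrite in_itv/= => /andP[ar rf].
    exists (pickle r) => //; have qr : q (pickle r) = ratr r by rewrite /q pickleK.
    rewrite qr (ltW ar); split => //.
    have [_ _ _ _ /(_ t)] := HAM (pickle r).
    rewrite qr /= in_itv/= andbT => /(_ (conj Dt rf))[//|Mt].
    by exfalso; apply: Nt; exists (pickle r).
  case: ifP => // aq [At Nt].
  have [_ _ _ /(_ t At)[Dt]] := HAM n.
  rewrite /= !in_itv/= !andbT => qf _.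
  by split => //; exact: le_lt_trans qf.
apply: bigcupT_measurable => n; case: ifP => // _.
by apply: measurableD => //; have [] := HAM n.
Qed.

End completed_lebesgue.

(** * The substitution, as an identity of probability laws *)

Section change_of_variable.
Context {R : realType}.
Local Notation lam := (@lebesgue_measure R).
Variable x : R.
Hypothesis x0 : 0 < x.

Let a := ln 2 / x.
(* The inverse of [t |-> expR (- a * t) - 2^-1]. *)
Definition tmap (v : R) := - x * log2 (2^-1 + v).

Lemma ln2_gt0 : 0 < ln 2 :> R. Proof. by rewrite ln_gt0// ltr1n. Qed.

Let a0 : 0 < a. Proof. by rewrite divr_gt0// ln2_gt0. Qed.

Lemma measurable_tmap : measurable_fun [set: R] tmap.
Proof.
apply: measurable_funM => //; apply: measurable_funM => //.
apply: (measurableT_comp (@measurable_ln R)).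
by apply: measurable_funD.
Qed.

(** The substitution is inverse transform sampling: [tmap] carries the uniform law [U] on
    [[-1/2, 1/2]] to the exponential law [P] of rate [a]. Comparing distribution functions then
    gives the change of variables for every measurable integrand. *)
Let P : probability (measurableTypeR R) R.
Proof. by refine (exponential_prob a : probability _ _); exact: a0. Defined.

Lemma exponential_dominates : P `<< lam.
Proof.
apply/null_content_dominatesP.
move=> A mA A0; rewrite /P /= /exponential_prob.
apply: (null_set_integral (mu := lam)) => //.
by apply/measurable_funTS/measurable_EFinP; exact: measurable_exponential_pdf.
Qed.

(** The Radon-Nikodym derivative of [P] is almost everywhere the exponential density, both having
    the same integral over every measurable set. *)
Lemma ge0_integral_exponential (h : R -> \bar R) : measurable_fun [set: R] h ->
  (forall t, (0 <= h t)%E) ->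
  (\int[P]_t h t = \int[lam]_t (h t * (exponential_pdf a t)%:E))%E.
Proof.
move=> mh h0.
have pdf0 t : 0 <= exponential_pdf a t by apply: exponential_pdf_ge0; exact: ltW.
have mpdf : measurable_fun [set: R] (EFin \o exponential_pdf a).
  by apply/measurable_EFinP; exact: measurable_exponential_pdf.
have dom := exponential_dominates.
rewrite -(Radon_Nikodym_SigmaFinite.change_of_variables dom)//.
have mf : measurable_fun [set: R] (Radon_Nikodym_SigmaFinite.f P lam).
  exact: (measurable_int lam (Radon_Nikodym_SigmaFinite.f_integrable dom)).
apply: ge0_ae_eq_integral => //.
- by apply: emeasurable_funM.
- by apply: emeasurable_funM.
- by move=> t _; rewrite mule_ge0// Radon_Nikodym_SigmaFinite.f_ge0.
- by move=> t _; rewrite mule_ge0// lee_fin.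
apply: ae_eqe_mul2l; apply: integral_ae_eq => //.
  exact: Radon_Nikodym_SigmaFinite.f_integrable.
move=> E _ mE.
by rewrite -Radon_Nikodym_SigmaFinite.f_integral.
Qed.

Let half2 : - 2^-1 < 2^-1 :> R. Proof. by rewrite gtrN// invr_gt0. Qed.

Let U : probability (measurableTypeR R) R := uniform_prob half2.

(** The half-open interval leaves out [-1/2], where [tmap] involves the logarithm of [0]. *)
Let UE (A : set R) : measurable A -> U A = lam (A `&` `]- 2^-1, 2^-1]%classic).
Proof.
move=> mA; rewrite -[A in LHS]setIT -(integral_indic U measurableT mA) /U/=.
rewrite integral_uniform//=; last exact/measurable_EFinP/measurable_indic.
have mi D : measurable_fun D (fun t => (\1_A t)%:E : \bar R).
  by apply/measurable_funTS/measurable_EFinP/measurable_indic.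
have -> : 2^-1 - - 2^-1 = 1 :> R by lra.
by rewrite invr1 mul1e -integral_itv_obnd_cbnd// integral_indic.
Qed.

Lemma tmap_lt (v b : R) : - 2^-1 < v -> (tmap v < b) = (expR (- (a * b)) - 2^-1 < v).
Proof.
move=> v0; have h : 0 < 2^-1 + v by lra.
rewrite ltrBlDl -[X in _ = (_ < X)]lnK ?posrE// ltr_expR -[RHS](ltr_pM2l x0).
have -> : x * - (a * b) = - b * ln 2 by rewrite /a; field; rewrite gt_eqF.
by rewrite /tmap /log2 mulNr ltrNl mulrA ltr_pdivlMr// ln2_gt0.
Qed.

Let exponential_itv (b : R) :
  P `]-oo, b[%classic = (Num.max 0 (1 - expR (- (a * b))))%:E.
Proof.
rewrite /P/= /exponential_prob.
have mpdf D : measurable_fun D (EFin \o exponential_pdf a).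
  by apply/measurable_funTS/measurable_EFinP; exact: measurable_exponential_pdf.
have [b0|b0] := leP b 0.
  rewrite (max_idPl _); last first.
    by rewrite subr_le0 -[leLHS]expR0 ler_expR oppr_ge0 pmulr_rle0.
  rewrite integral0_eq// => t; rewrite /= in_itv/= => tb.
  by rewrite lt0_exponential_pdf// (lt_le_trans tb).
rewrite (max_idPr _); last first.
  by rewrite subr_ge0 expR_le1 oppr_le0 pmulr_rge0// ltW.
rewrite EFinB -mulNr -(exponential_prob_itv0c a b0) /exponential_prob.
rewrite -[RHS]integral_itv_bndo_bndc//.
rewrite [LHS]integral_mkcond [RHS]integral_mkcond.
apply: eq_integral => t _; rewrite !patchE !mem_setE !in_itv/=.
case: (ltP t b) => tb; rewrite ?andbT ?andbF//; case: (leP 0 t) => // t0.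
by rewrite lt0_exponential_pdf.
Qed.

Let uniform_itv (b : R) :
  U (tmap @^-1` `]-oo, b[%classic) = (Num.max 0 (1 - expR (- (a * b))))%:E.
Proof.
have mT : measurable (tmap @^-1` `]-oo, b[%classic).
  by rewrite -[X in measurable X]setTI; exact: measurable_tmap.
rewrite UE//; set c := expR (- (a * b)) - 2^-1.
have cgt : - 2^-1 < c by have := expR_gt0 (- (a * b)); rewrite /c; lra.
have -> : tmap @^-1` `]-oo, b[%classic `&` `]- 2^-1, 2^-1]%classic = `]c, 2^-1]%classic.
  apply/seteqP; split => v /=; rewrite !in_itv/=.
    by move=> [tb /andP[v0 ->]]; rewrite andbT -tmap_lt.
  move=> /andP[cv ->]; have v0 := lt_trans cgt cv.
  by rewrite tmap_lt// v0.
rewrite lebesgue_measure_itv/= lte_fin /c.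
have [h|h] := ltP.
  rewrite (max_idPr _) -?EFinB//; last by lra.
  by congr EFin; lra.
by rewrite (max_idPl _)//; lra.
Qed.

(** The two measures agree on the half-lines []-oo, b[], which are stable under intersection and
    generate the Borel sets. *)
Lemma tmap_pushforward (A : set R) : measurable A ->
  pushforward U tmap A = P A.
Proof.
move=> mA.
have [m1 m1E] : exists m1 : {measure set (measurableTypeR R) -> \bar R},
    forall B, m1 B = pushforward U tmap B.
  unshelve eexists
    (pushforward U (tmap : measurableTypeR R -> measurableTypeR R) : {measure set _ -> \bar R}) => //.
  exact: measurable_tmap.
rewrite -m1E.
have mu_ := @measure_unique _ R (measurableTypeR R) (@RGenInftyO.G R)
  (fun k => `]-oo, k%:R[%classic) _ _ _ _ m1 P _ _ A mA.
apply: mu_ => //.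
- exact: RGenInftyO.measurableE.
- move=> _ _ [b ->] [c ->]; exists (Num.min b c); apply/seteqP; split => t /=.
    by rewrite !in_itv/= lt_min => -[-> ->].
  by rewrite !in_itv/= lt_min => /andP[].
- by move=> k; exists k%:R.
- rewrite -subTset => t _; exists (Num.truncn t).+1 => //=.
  by rewrite in_itv/= truncnS_gt.
- by move=> _ [b ->]; rewrite m1E /pushforward uniform_itv; exact/esym/exponential_itv.
- by move=> k; rewrite m1E /pushforward uniform_itv ltry.
Qed.

Definition vitv : set R := `](- 2^-1), 2^-1[%classic.

Let rho (t : R) := a * expR (- (a * t)).

Lemma ge0_integral_tmap (h : R -> R) : measurable_fun [set: R] h ->
  (forall t, 0 <= h t) ->
  (\int[lam]_(t in posR) (h t * rho t)%:E =
   \int[lam]_(v in vitv) (h (tmap v))%:E)%E.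
Proof.
move=> mh h0.
have mrho : measurable_fun [set: R] rho.
  apply: measurable_funM => //; apply: measurableT_comp => //.
  by apply: measurableT_comp => //; exact: measurable_funM.
have mhE : measurable_fun [set: R] (EFin \o h) by exact/measurable_EFinP.
have mht D : measurable_fun D (EFin \o (h \o tmap)).
  apply/measurable_funTS/measurable_EFinP; apply: measurableT_comp => //.
  exact: measurable_tmap.
transitivity (\int[P]_t (h t)%:E)%E.
  rewrite ge0_integral_exponential//.
  have -> : posR = `]0, +oo[%classic :> set R.
    by apply/seteqP; split => t /=; rewrite in_itv/= andbT.
  rewrite integral_itv_obnd_cbnd; last first.
    by apply/measurable_funTS/measurable_EFinP; exact: measurable_funM.
  rewrite integral_mkcond; apply: eq_integral => t _; rewrite patchE mem_setE in_itv/= andbT.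
  case: (leP 0 t) => t0; first by rewrite exponential_pdfE// EFinM mulNr.
  by rewrite lt0_exponential_pdf// mule0.
have := @ge0_integral_pushforward _ _ (measurableTypeR R) (measurableTypeR R) R
  tmap measurable_tmap U setT (EFin \o h) measurableT mhE.
move=> /(_ _)/wrap[t _|e]; first by rewrite lee_fin.
rewrite preimage_setT in e.
transitivity (\int[U]_t (h (tmap t))%:E)%E.
  rewrite -[RHS]e; apply: eq_measure_integral => [|? A mA _]; first exact: measurable_tmap.
  exact: (esym (tmap_pushforward mA)).
rewrite integral_uniform; [|exact: mht|by move=> t; rewrite lee_fin].
have -> : 2^-1 - - 2^-1 = 1 :> R by lra.
by rewrite invr1 mul1e -integral_itv_obnd_cbnd// -integral_itv_bndo_bndc.
Qed.

Lemma integrable_tmap (h : R -> R) : measurable_fun [set: R] h ->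
  lam.-integrable posR (EFin \o (fun t => h t * rho t)) ->
  lam.-integrable vitv (EFin \o (h \o tmap)).
Proof.
move=> mh /integrableP[_ hi]; apply/integrableP; split.
  apply/measurable_funTS/measurable_EFinP; apply: measurableT_comp => //.
  exact: measurable_tmap.
have mn : measurable_fun [set: R] (fun t => `|h t|) by exact: measurableT_comp.
have := ge0_integral_tmap mn (fun=> normr_ge0 _).
move=> /= <-; apply: le_lt_trans hi; rewrite le_eqVlt; apply/orP; left; apply/eqP.
apply: eq_integral => t _.
by rewrite /= normrM (gtr0_norm (_ : 0 < rho t))// mulr_gt0// expR_gt0.
Qed.

Lemma Rintegral_tmap (h : R -> R) : measurable_fun [set: R] h ->
  lam.-integrable posR (EFin \o (fun t => h t * rho t)) ->
  \int[lam]_(t in posR) (h t * rho t) =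
  \int[lam]_(v in vitv) (h (tmap v)).
Proof.
move=> mh hi; rewrite /Rintegral; congr fine.
rewrite integralE [RHS]integralE; congr (_ - _)%E.
- have mp : measurable_fun [set: R] (fun t => Num.max (h t) 0) by exact: measurable_maxr.
  have p0 t : 0 <= Num.max (h t) 0 by rewrite le_max lexx orbT.
  transitivity (\int[lam]_(t in posR) (Num.max (h t) 0 * rho t)%:E)%E.
    apply: eq_integral => t _; rewrite funeposE -EFin_max/= maxr_pMl ?mul0r//.
    by rewrite ltW// mulr_gt0// expR_gt0.
  rewrite ge0_integral_tmap//.
  by apply: eq_integral => t _; rewrite funeposE -EFin_max.
- have mp : measurable_fun [set: R] (fun t => Num.max (- h t) 0).
    by apply: measurable_maxr => //; exact: measurableT_comp.
  have p0 t : 0 <= Num.max (- h t) 0 by rewrite le_max lexx orbT.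
  transitivity (\int[lam]_(t in posR) (Num.max (- h t) 0 * rho t)%:E)%E.
    apply: eq_integral => t _; rewrite funenegE -EFinN -EFin_max/= maxr_pMl ?mul0r ?mulNr//.
    by rewrite ltW// mulr_gt0// expR_gt0.
  rewrite ge0_integral_tmap//.
  by apply: eq_integral => t _; rewrite funenegE -EFinN -EFin_max.
Qed.

End change_of_variable.

(** * Integrals against the kernel *)

Section kernel_integrals.
Context {R : realType}.
Local Notation lam := (@lebesgue_measure R).

(* [sum_gs_coef] at [w = 2^-1 + v] is [(2^-1 + v) * (2^-1 - v) * gsk n v]. *)
Definition gsk n (v : R) : R := 4 * sk n (1 - 4 * v ^+ 2).

Lemma gskN n v : gsk n (- v) = gsk n v.
Proof. by rewrite /gsk sqrrN. Qed.

Lemma continuous_gsk n : continuous (gsk n).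
Proof.
move=> v.
apply: cvgM; first exact: cvg_cst.
apply: (@continuous_comp _ _ _ (fun v : R => 1 - 4 * v ^+ 2) (sk n)); last exact: continuous_sk.
apply: cvgB; first exact: cvg_cst.
by apply: cvgM; [exact: cvg_cst|apply: cvgM; exact: cvg_id].
Qed.

Lemma measurable_gsk n (D : set R) : measurable_fun D (gsk n).
Proof. by apply: measurable_funTS; apply: continuous_measurable_fun; exact: continuous_gsk. Qed.

Lemma gsk_dct (D : set R) (psi g : R -> R) : measurable D ->
  D `<=` `]0, 2^-1]%classic -> measurable_fun D psi ->
  lam.-integrable D (EFin \o g) ->
  (forall n v, (0 < n)%N -> D v -> `|gsk n v * psi v| <= g v) ->
  (forall n, (0 < n)%N -> lam.-integrable D (EFin \o (fun v => gsk n v * psi v))) /\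
  \int[lam]_(v in D) (gsk n v * psi v) @[n --> \oo] --> 0.
Proof.
move=> mD DH mpsi gi bd.
have mf n : measurable_fun D (EFin \o (fun v => gsk n v * psi v)).
  apply/measurable_EFinP; apply: measurable_funM => //; exact: measurable_gsk.
split=> [n n0|].
  have h := @le_integrable _ _ R lam D mD _ _ (mf n) _ gi.
  apply: h => v Dv /=; rewrite lee_fin.
  by rewrite (le_trans (bd n v n0 Dv))// ler_norm.
(* The bounds on the kernel start at [n = 1]. *)
rewrite -cvg_shiftS /Rintegral.
have [||||_ _] := @dominated_convergence _ _ R lam D mD
    (fun n v => (gsk n.+1 v * psi v)%:E) (fun=> 0%E) (EFin \o g) _ _ _ gi _.
- by move=> n; exact: mf.
- exact: measurable_cst.
- apply: aeW => v Dv; have := DH _ Dv; rewrite /= in_itv/= => /andP[v0 v1].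
  apply: cvg_EFin; first by apply: nearW.
  have := sk_halfcvg0 v0 v1; rewrite -cvg_shiftS => h.
  rewrite -[X in _ --> X](mul0r (psi v)).
  by apply: cvgMl; exact: h.
- by apply: aeW => v n Dv; rewrite /= lee_fin; exact: bd.
rewrite integral0 => h.
exact: (fine_cvg h).
Qed.

Lemma Rintegral_gsk n (a b : R) : a < b ->
  \int[lam]_(v in `]a, b]) gsk n v = sk_prim n b - sk_prim n a.
Proof.
move=> ab; have cN (x : R) : {for x, continuous (sk_prim n)}.
  have [d _] := is_derive_sk_prim n x.
  by apply: differentiable_continuous; apply/derivable1_diffP.
rewrite /Rintegral integral_itv_obnd_cbnd; last first.
  by apply/measurable_EFinP; exact: measurable_gsk.
rewrite (@continuous_FTC2 _ (gsk n) (sk_prim n) _ _ ab)//.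
- by apply: continuous_subspaceT; exact: continuous_gsk.
- split.
  + by move=> x _; have [] := is_derive_sk_prim n x.
  + by apply: cvg_at_right_filter; exact: cN.
  + by apply: cvg_at_left_filter; exact: cN.
- by move=> x _; rewrite derive1E; have [_ ->] := is_derive_sk_prim n x.
Qed.

Lemma nondecreasing_measurable (I : interval R) (phi : R -> R) :
  {in I &, {homo phi : x y / x <= y}} -> measurable_fun [set` I] phi.
Proof.
move=> ndphi mI; apply: (measurability _ (RGenOInfty.measurableE R)) => // _ [_ [c ->] <-].
apply: is_interval_measurable => x y [Ix cx] [Iy cy] z /andP[xz zy].
have Iz : z \in I.
  by have /= := @interval_is_interval _ I x y Ix Iy z; apply; rewrite xz.
split => //; move: cx; rewrite /= !in_itv/= !andbT => cx.
by rewrite (lt_le_trans cx)//; exact: ndphi.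
Qed.

Lemma gsk_bounded n : (0 < n)%N -> exists2 L : R, 0 <= L &
  forall v, 0 < v -> v <= 2^-1 -> `|gsk n v| <= L.
Proof.
move=> n0; have [C C0 HC] := @sk_le_linear R.
exists (4 * (C * n%:R)) => [|v v0 v1]; first by rewrite !mulr_ge0.
by rewrite /gsk normrM ger0_norm// ler_pM2l//; apply: HC => //; exact: y_bounds.
Qed.

Lemma integrable_gsk n (D : set R) (psi : R -> R) : (0 < n)%N -> measurable D ->
  D `<=` `]0, 2^-1]%classic -> lam.-integrable D (EFin \o psi) ->
  lam.-integrable D (EFin \o (fun v => gsk n v * psi v)).
Proof.
move=> n0 mD DH psii; have [L L0 HL] := gsk_bounded n0.
have mpsi : measurable_fun D psi by apply/measurable_EFinP; exact: measurable_int psii.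
have mf : measurable_fun D (EFin \o (fun v => gsk n v * psi v)).
  by apply/measurable_EFinP; apply: measurable_funM => //; exact: measurable_gsk.
have gi : lam.-integrable D (EFin \o (fun v => L * psi v)).
  have := @integrableZl _ _ R lam D mD L _ psii.
  by apply: eq_integrable => // v _; rewrite /= EFinM.
have h := @le_integrable _ _ R lam D mD _ _ mf _ gi.
apply: h => v Dv /=; rewrite lee_fin (normrM (gsk n v)) (normrM L) ler_wpM2r//.
have := DH _ Dv; rewrite /= in_itv/= => /andP[v0 v1].
by rewrite (le_trans (HL _ v0 v1))// ler_norm.
Qed.

Lemma bounded_integrable_itv (a b B : R) (psi : R -> R) :
  measurable_fun `]a, b]%classic psi ->
  (forall v, a < v -> v <= b -> `|psi v| <= B) ->
  lam.-integrable `]a, b]%classic (EFin \o psi).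
Proof.
move=> mpsi bd; apply: measurable_bounded_integrable => //.
  by rewrite /= lebesgue_measure_itv; case: ifPn => _; rewrite ltry.
exists B; split; first exact: num_real.
move=> y By v; rewrite /= in_itv/= => /andP[av vb].
by rewrite (le_trans (bd v av vb))// ltW.
Qed.

(** A form of the second mean value theorem, by Abel summation over [N + 1] equal steps: on each
    step [phi] is replaced by its value at the right end, and the sum is rearranged in terms of the
    bounded primitive [sk_prim n]. *)
Lemma Rintegral_nondecreasing_gsk n (M d : R) (phi : R -> R) : (0 < n)%N ->
  0 < d -> d <= 2^-1 -> (forall x, 0 <= x -> x <= 2^-1 -> `|sk_prim n x| <= M) ->
  {in `]0, d] &, {homo phi : x y / x <= y}} -> (forall v, v \in `]0, d] -> 0 <= phi v) ->
  `|\int[lam]_(v in `]0, d]) (gsk n v * phi v)| <= 2 * M * phi d.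
Proof.
move=> n0 d0 d2 PM ndphi phi0.
(* [L] depends on [n], but it enters only error terms that vanish as [N] grows. *)
have [L L0 HL] := gsk_bounded n0.
(* [phi] is controlled on []0, d]] only; the value [0] at [0] keeps monotonicity and starts the
   induction. *)
pose f (x : R) := if x <= 0 then 0 else phi x.
have f0 : f 0 = 0 by rewrite /f lexx.
have fE x : 0 < x -> f x = phi x by move=> x0; rewrite /f leNgt x0.
have ndf x y : 0 <= x -> x <= y -> y <= d -> f x <= f y.
  move=> x0 xy yd; rewrite /f; case: (leP x 0) => [_|xp].
    by case: (leP y 0) => // yp; apply: phi0; rewrite in_itv/= yp.
  rewrite (leNgt y) (lt_le_trans xp xy)/=.
  by apply: ndphi => //; rewrite in_itv/= ?xp ?(lt_le_trans xp xy)//= (le_trans xy).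
have M0 : 0 <= M by apply: le_trans (normr_ge0 _) (PM 0 _ _); rewrite ?invr_ge0.
have f_ge0 x : 0 <= x -> x <= d -> 0 <= f x by move=> x0 xd; rewrite -f0 ndf.
have mf : measurable_fun `]0, d]%classic f.
  apply: (@nondecreasing_measurable `]0, d]) => x y; rewrite !in_itv/=.
  by move=> /andP[x0 _] /andP[_ yd] xy; apply: ndf => //; exact: ltW.
have sub s s' : 0 <= s -> s' <= d -> `]s, s']%classic `<=` (`]0, d]%classic : set R).
  move=> s0 sd v; rewrite /= !in_itv/= => /andP[sv vs].
  by rewrite (le_lt_trans s0 sv) (le_trans vs sd).
have subH s s' : 0 <= s -> s' <= d -> `]s, s']%classic `<=` (`]0, 2^-1]%classic : set R).
  move=> s0 sd v /(sub _ _ s0 sd); rewrite /= !in_itv/= => /andP[-> vd].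
  exact: le_trans d2.
have fi s s' : 0 <= s -> s' <= d -> lam.-integrable `]s, s']%classic (EFin \o f).
  move=> s0 sd; apply: (@bounded_integrable_itv _ _ (f d)).
    exact: (measurable_funS _ (sub _ _ s0 sd) mf).
  move=> v sv vs; have v0 : 0 <= v by rewrite ltW// (le_lt_trans s0).
  by rewrite ger0_norm ?f_ge0 ?ndf// (le_trans vs).
have gi s s' : 0 <= s -> s' <= d ->
    lam.-integrable `]s, s']%classic (EFin \o (fun v => gsk n v * f v)).
  by move=> s0 sd; apply: integrable_gsk => //; [exact: subH|exact: fi].
pose J s := \int[lam]_(v in `]0, s]) (gsk n v * f v).
have JE : \int[lam]_(v in `]0, d]) (gsk n v * phi v) = J d.
  by apply: eq_Rintegral => v; rewrite inE/= in_itv/= => /andP[v0 _]; rewrite fE.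
have Jstep s s' : 0 <= s -> s < s' -> s' <= d ->
    `|J s' - J s - f s' * (sk_prim n s' - sk_prim n s)| <= L * (f s' - f s) * (s' - s).
  move=> s0 ss sd.
  have b1 : (BRight 0 <= BRight s)%O by rewrite bnd_simp.
  have b2 : (BRight s <= BRight s')%O by rewrite bnd_simp ltW.
  rewrite /J (Rintegral_itvB (gi 0 s' (lexx 0) sd) b1 b2).
  have si : lam.-integrable `]s, s']%classic (EFin \o (fun=> f s')).
    exact: (@bounded_integrable_itv _ _ `|f s'|).
  have ci : lam.-integrable `]s, s']%classic (EFin \o (fun v => gsk n v * f s')).
    by apply: integrable_gsk => //; exact: subH.
  have oi : lam.-integrable `]s, s']%classic (EFin \o gsk n).
    have o1 : lam.-integrable `]s, s']%classic (EFin \o (fun=> 1)).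
      exact: (@bounded_integrable_itv _ _ `|1|).
    have := integrable_gsk n0 _ (subH _ _ s0 sd) o1.
    move=> /(_ _)/wrap[//|]; apply: eq_integrable => // v _.
    by rewrite /= mulr1.
  rewrite -Rintegral_gsk// mulrC -RintegralZr// -RintegralB//; last exact: gi.
  have bi : lam.-integrable `]s, s']%classic
      (EFin \o (fun v => gsk n v * f v - gsk n v * f s')).
    have := @integrableB _ _ R lam `]s, s']%classic _ _ _ (gi _ _ s0 sd) ci.
    by move=> /(_ _)/wrap[//|]; apply: eq_integrable.
  rewrite (le_trans (le_normr_Rintegral _ bi))//.
  have ki : lam.-integrable `]s, s']%classic (EFin \o (fun=> L * (f s' - f s))).
    exact: (@bounded_integrable_itv _ _ `|L * (f s' - f s)|).
  have -> : L * (f s' - f s) * (s' - s) = \int[lam]_(v in `]s, s']) (L * (f s' - f s)).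
    by rewrite Rintegral_cst//= lebesgue_measure_itv/= lte_fin ss.
  apply: le_Rintegral => //.
    have := integrable_abse bi; exact.
  move=> v; rewrite /= in_itv/= => /andP[sv vs].
  have v0 : 0 < v by exact: le_lt_trans sv.
  have vd : v <= d by exact: le_trans sd.
  rewrite -mulrBr (normrM (gsk n v)) ler_pM//.
    by apply: HL => //; exact: le_trans d2.
  rewrite distrC ger0_norm ?subr_ge0 ?ndf ?(ltW v0)//.
  by rewrite lerB// ndf// ltW.
(* The increments [f s' - f s] multiply both [M] and the error [L d / (N + 1)], so the sums
   telescope to [f x]. *)
have key N j : (j <= N.+1)%N -> let x := d * j%:R / N.+1%:R in
    `|J x - f x * sk_prim n x| <= f x * (M + L * (d / N.+1%:R)).
  elim: j => [_|j IH jN] /=.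
    rewrite mulr0 mul0r f0 !mul0r subr0 /J set_itvoc0 Rintegral_set0 normr0//.
  have NN : 0 < N.+1%:R :> R by [].
  set s := d * j%:R / N.+1%:R in IH *; set s' := d * j.+1%:R / N.+1%:R.
  have s0 : 0 <= s by rewrite divr_ge0// mulr_ge0// ltW.
  have ss : s' - s = d / N.+1%:R by rewrite /s /s' -natr1; field; rewrite nat1r pnatr_eq0.
  have lt_ss : s < s' by rewrite -subr_gt0 ss divr_gt0.
  have sd : s' <= d.
    by rewrite /s' ler_pdivrMr// ler_pM2l// ler_nat.
  have h1 := IH (ltnW jN); have h2 := Jstep _ _ s0 lt_ss sd; rewrite ss in h2.
  have h3 : `|(f s' - f s) * sk_prim n s| <= (f s' - f s) * M.
    have fs : 0 <= f s' - f s by rewrite subr_ge0 ndf// ltW.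
    rewrite normrM (ger0_norm fs) ler_wpM2l// PM//.
    by rewrite (le_trans (ltW lt_ss))// (le_trans sd).
  have -> : J s' - f s' * sk_prim n s' = (J s - f s * sk_prim n s) +
      (J s' - J s - f s' * (sk_prim n s' - sk_prim n s)) - (f s' - f s) * sk_prim n s by ring.
  rewrite (le_trans (ler_normB _ _))// (le_trans (lerD (ler_normD _ _) (lexx _)))//.
  rewrite (le_trans (lerD (lerD h1 h2) h3))//.
  by move: (f s) (f s') (d / N.+1%:R) => a b c; lra.
have fin N : `|J d| <= 2 * M * phi d + phi d * L * d * N.+1%:R^-1.
  have := key N N.+1 (leqnn _); rewrite /= mulfK ?pnatr_eq0// fE// => h.
  have hp : `|phi d * sk_prim n d| <= phi d * M.
    have p0 : 0 <= phi d by apply: phi0; rewrite in_itv/= d0 lexx.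
    by rewrite normrM (ger0_norm p0) ler_wpM2l// PM// ltW.
  rewrite -[J d](subrK (phi d * sk_prim n d)) (le_trans (ler_normD _ _))//.
  rewrite (le_trans (lerD h hp))//.
  by move: (phi d) (N.+1%:R^-1 : R) => a b; lra.
rewrite JE; apply: (@cvgn_le _ (fun N => `|J d| - phi d * L * d * N.+1%:R^-1)).
  have c : phi d * L * d * N.+1%:R^-1 @[N --> \oo] --> phi d * L * d * 0.
    by apply: cvgMr; exact: cvg_harmonic.
  rewrite mulr0 in c; rewrite -[X in _ --> X]subr0.
  by apply: cvgB c; exact: cvg_cst.
by move=> N; rewrite lerBlDr; exact: fin.
Qed.

End kernel_integrals.

(** * Folding the integral at the origin *)

Section reflection.
Context {R : realType}.
Local Notation lam := (@lebesgue_measure R).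
Local Notation bR := (measurableTypeR R).

Lemma measurable_oppR : measurable_fun [set: bR] (-%R : bR -> bR).
Proof. by apply: continuous_measurable_fun; exact: opp_continuous. Qed.

Lemma integral_opp (D : set R) (h : R -> \bar R) :
  measurable D -> measurable_fun [set: R] h ->
  (\int[lam]_(v in -%R @^-1` D) h (- v)%R = \int[lam]_(v in D) h v)%E.
Proof.
move=> mD mh.
have ge0 (k : R -> \bar R) : measurable_fun [set: R] k -> (forall v, 0 <= k v)%E ->
    (\int[lam]_(v in -%R @^-1` D) k (- v)%R = \int[lam]_(v in D) k v)%E.
  move=> mk k0.
  have := @ge0_integral_pushforward _ _ bR bR R -%R measurable_oppR lam D k mD.
  move=> hk; rewrite -hk; [|exact: measurable_funTS|by move=> v _; exact: k0].
  apply: eq_measure_integral => [A mA _].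
  exact: lebesgue_measureN.
rewrite integralE [RHS]integralE; congr (_ - _)%E.
- by rewrite -[RHS](ge0 _ (measurable_funepos mh) (funepos_ge0 h));
    apply: eq_integral => v _; rewrite !funeposE.
- by rewrite -[RHS](ge0 _ (measurable_funeneg mh) (funeneg_ge0 h));
    apply: eq_integral => v _; rewrite !funenegE.
Qed.

Lemma measurable_vitv : measurable (vitv : set R).
Proof. exact: measurable_itv. Qed.

Let H : set R := `]0, 2^-1[%classic.

Let mH : measurable H. Proof. exact: measurable_itv. Qed.

Let mV := measurable_vitv.

Lemma Rintegral_reflection (phi : R -> R) : measurable_fun [set: R] phi ->
  lam.-integrable vitv (EFin \o phi) ->
  [/\ lam.-integrable H (EFin \o phi), lam.-integrable H (EFin \o (phi \o -%R)) &
    \int[lam]_(v in vitv) phi v = \int[lam]_(v in H) (phi v + phi (- v))].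
Proof.
move=> mphi iphi.
have h1 : lam.-integrable H (EFin \o phi).
  apply: integrableS iphi => // v; rewrite /H /vitv /= !in_itv/= => /andP[? ->].
  by rewrite andbT; lra.
have mE : measurable_fun [set: R] (EFin \o phi) by exact/measurable_EFinP.
have hN : -%R @^-1` `]- 2^-1, 0[%classic = H :> set R.
  by apply/seteqP; split => v; rewrite /H /= !in_itv/= ltrN2 oppr_lt0 andbC.
have h3 : lam.-integrable `]- 2^-1, 0[%classic (EFin \o phi).
  apply: integrableS iphi => // v; rewrite /vitv /= !in_itv/= => /andP[-> ?].
  by rewrite /=; lra.
have h2 : lam.-integrable H (EFin \o (phi \o -%R)).
  have mN : measurable_fun [set: R] (phi \o -%R) by exact: measurableT_comp.
  apply/integrableP; split; first by apply/measurable_funTS/measurable_EFinP.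
  have /integrableP[_] := h3.
  have mA : measurable_fun [set: R] (abse \o (EFin \o phi)) by exact: measurableT_comp.
  have := @integral_opp `]- 2^-1, 0[%classic _ _ mA.
  by move=> /(_ _)/wrap[//|/= <-]; rewrite hN.
split => //.
have e2 : \int[lam]_(v in H) phi (- v) = \int[lam]_(v in `]- 2^-1, 0[) phi v.
  rewrite /Rintegral -hN.
  by have := @integral_opp `]- 2^-1, 0[%classic _ _ mE => /= ->.
rewrite RintegralD// e2 (Rintegral_itv_bndo_bndc h3).
have b1 : (BRight (- 2^-1) <= BRight 0 :> itv_bound R)%O by rewrite bnd_simp; lra.
have b2 : (BRight 0 <= BLeft 2^-1 :> itv_bound R)%O by rewrite bnd_simp; lra.
have := Rintegral_itvB iphi b1 b2.
by rewrite /H => <-; rewrite addrC /vitv; ring.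
Qed.

(** Only the symmetric part on []0, d]] is critical: the antisymmetric part carries a factor [v]
    that cancels [C / v], and beyond [d] the kernel is at most [C / d], so dominated convergence
    disposes of both. *)
Lemma gsk_reflection_cvg (u : R -> R) (c d : R) : measurable_fun [set: R] u ->
  lam.-integrable vitv (EFin \o u) -> 0 < d < 2^-1 ->
  \int[lam]_(v in `]0, d]) (gsk n v * (u v + u (- v) - 2 * c)) @[n --> \oo] --> 0 ->
  \int[lam]_(v in vitv) (u v * ((2^-1 - v) * gsk n v)) @[n --> \oo] --> c.
Proof.
move=> meas_u iu /andP[d0 d2] hd.
have [C C0 HC] := @sk_le_inv R.
have mG : measurable_fun [set: R] (fun v => u v + u (- v) - 2 * c).
  apply: measurable_funB => //; apply: measurable_funD => //.
  exact: (measurableT_comp meas_u measurable_oppR).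
have [iu1 iu2 _] := Rintegral_reflection meas_u iu.
have HH : H `<=` `]0, 2^-1]%classic.
  by move=> v; rewrite /H /= !in_itv/= => /andP[-> /ltW].
have ik (k : R) : lam.-integrable H (EFin \o (fun=> k)).
  apply: (@integrableS _ _ _ lam `]0, 2^-1]%classic) => //.
  exact: (@bounded_integrable_itv _ _ _ `|k|).
have iW : lam.-integrable H (EFin \o (fun v => u v - u (- v))).
  by have := @integrableB _ _ R lam H mH _ _ iu1 iu2; apply: eq_integrable.
have iG : lam.-integrable H (EFin \o (fun v => u v + u (- v) - 2 * c)).
  have := @integrableB _ _ R lam H mH _ _ (@integrableD _ _ R lam H mH _ _ iu1 iu2) (ik (2 * c)).
  by apply: eq_integrable.
have HHC n v : (0 < n)%N -> H v -> `|gsk n v| <= C / v.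
  by move=> n0 /HH; rewrite /= in_itv/= => /andP[v0 v1]; exact: HC.
have i1 n : (0 < n)%N -> lam.-integrable H (EFin \o (fun v => gsk n v * (u v + u (- v) - 2 * c))).
  by move=> n0; exact: integrable_gsk.
have [i2 c2] : (forall n, (0 < n)%N -> lam.-integrable H
      (EFin \o (fun v => gsk n v * (v * (u v - u (- v)))))) /\
    \int[lam]_(v in H) (gsk n v * (v * (u v - u (- v)))) @[n --> \oo] --> 0.
  apply: (@gsk_dct _ H _ (fun v => C * `|u v - u (- v)|)) => //.
  - apply: measurable_funM => //; apply/measurable_EFinP; exact: measurable_int iW.
  - have := @integrableZl _ _ R lam H mH C _ (integrable_abse iW).
    by apply: eq_integrable.
  - move=> n v n0 Hv; have := HHC n v n0 Hv.
    have /HH := Hv; rewrite /= in_itv/= => /andP[v0 _] h.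
    rewrite (normrM (gsk n v)) (normrM v) mulrA ler_wpM2r// (gtr0_norm v0).
    by rewrite -ler_pdivlMr.
have mE : measurable (`]d, 2^-1[%classic : set R) by [].
have EH : `]d, 2^-1[%classic `<=` H.
  by move=> v; rewrite /H /= !in_itv/= => /andP[/(lt_trans d0) -> ->].
have c3 : \int[lam]_(v in `]d, 2^-1[) (gsk n v * (u v + u (- v) - 2 * c)) @[n --> \oo] --> 0.
  apply: (proj2 (@gsk_dct _ _ _ (fun v => C / d * `|u v + u (- v) - 2 * c|) mE
    (subset_trans EH HH) (measurable_funTS mG) _ _)).
  - have iE : lam.-integrable `]d, 2^-1[%classic (EFin \o (fun v => u v + u (- v) - 2 * c)).
      by apply: integrableS iG.
    have := @integrableZl _ _ R lam _ mE (C / d) _ (integrable_abse iE).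
    by apply: eq_integrable.
  - move=> n v n0 Ev; have := HHC n v n0 (EH _ Ev).
    move: Ev; rewrite /= in_itv/= => /andP[dv _] h.
    rewrite normrM ler_wpM2r// (le_trans h)// ler_wpM2l//.
    by rewrite lef_pV2 ?posrE ?(lt_trans d0 dv)// ltW.
have one n : (0 < n)%N -> \int[lam]_(v in H) gsk n v = 1.
  move=> n0; rewrite Rintegral_itv_bndo_bndc ?Rintegral_gsk ?sk_prim_half ?sk_prim0 ?subr0//.
  have := @integrable_gsk _ n H (fun=> 1) n0 mH HH (ik 1).
  by apply: eq_integrable => // v _; rewrite /= mulr1.
have eqn n : (0 < n)%N -> \int[lam]_(v in vitv) (u v * ((2^-1 - v) * gsk n v)) =
    2^-1 * (\int[lam]_(v in `]0, d]) (gsk n v * (u v + u (- v) - 2 * c)) +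
            \int[lam]_(v in `]d, 2^-1[) (gsk n v * (u v + u (- v) - 2 * c))) -
    \int[lam]_(v in H) (gsk n v * (v * (u v - u (- v)))) + c.
  move=> n0; have mp : measurable_fun [set: R] (fun v => u v * ((2^-1 - v) * gsk n v)).
    apply: measurable_funM => //; apply: measurable_funM; last exact: measurable_gsk.
    by apply: measurable_funB.
  have ip : lam.-integrable vitv (EFin \o (fun v => u v * ((2^-1 - v) * gsk n v))).
    (* [L] bounds the kernel for [v > 0], evenness extends this to [v < 0], and the summand
       [|gsk n 0|] covers [v = 0]. *)
    have [L L0 HL] := @gsk_bounded R n n0.
    have h := @le_integrable _ _ R lam vitv _ _ (fun v => ((L + `|gsk n 0|) * u v)%:E).
    apply: h => //.
    - exact/measurable_funTS/measurable_EFinP.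
    - move=> v; rewrite /vitv/= in_itv/= => /andP[v1 v2]; rewrite lee_fin.
      rewrite mulrC normrM [leRHS]normrM ler_wpM2r//.
      have hv : `|2^-1 - v| <= 1 by rewrite ler_norml; apply/andP; split; lra.
      rewrite [leRHS]ger0_norm ?addr_ge0// normrM -[leRHS]mul1r ler_pM//.
      have [-> |vn0] := eqVneq v 0; first by rewrite lerDr.
      rewrite -[leLHS]addr0 lerD//.
      have [v0|v0] := ltP 0 v; first by apply: HL => //; exact: ltW.
      rewrite -gskN; apply: HL; last by lra.
      by rewrite oppr_gt0 lt_neqAle vn0.
    - have := @integrableZl _ _ R lam vitv _ (L + `|gsk n 0|) _ iu.
      by move=> /(_ _)/wrap[//|]; apply: eq_integrable.
  have [_ _ ->] := Rintegral_reflection mp ip.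
  have b1 : (BLeft 0 <= BRight d :> itv_bound R)%O by rewrite bnd_simp ltW.
  have b0 : (BRight 0 <= BRight d :> itv_bound R)%O by rewrite bnd_simp ltW.
  have b2 : (BRight d <= BLeft 2^-1 :> itv_bound R)%O by rewrite bnd_simp.
  have <- := Rintegral_itvB (i1 n n0) b0 b2.
  rewrite [X in 2^-1 * X]addrC subrK.
  have i3 : lam.-integrable H (EFin \o (fun v => gsk n v * c)) by exact: integrable_gsk.
  have i0 : lam.-integrable H (EFin \o gsk n).
    have := @integrable_gsk _ n H (fun=> 1) n0 mH HH (ik 1).
    by apply: eq_integrable => // v _; rewrite /= mulr1.
  have i4 : lam.-integrable H
      (EFin \o (fun v => 2^-1 * (gsk n v * (u v + u (- v) - 2 * c)))).
    have := @integrableZl _ _ R lam H mH 2^-1 _ (i1 n n0).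
    by apply: eq_integrable.
  have i5 : lam.-integrable H
      (EFin \o (fun v => 2^-1 * (gsk n v * (u v + u (- v) - 2 * c)) -
        gsk n v * (v * (u v - u (- v))))).
    have := @integrableB _ _ R lam H mH _ _ i4 (i2 n n0).
    by apply: eq_integrable.
  rewrite -RintegralZl//; last exact: i1.
  rewrite -RintegralB//; last exact: i2.
  have ec : c = \int[lam]_(v in H) (gsk n v * c).
    by rewrite RintegralZr// (one n n0) mul1r.
  rewrite [X in _ = _ + X]ec -RintegralD//.
  apply: eq_Rintegral => v _; rewrite gskN.
  by move: (u v) (u (- v)) (gsk n v) => p q r; lra.
rewrite -cvg_shiftS; apply: (@cvg_trans _
  ((2^-1 * (\int[lam]_(v in `]0, d]) (gsk n.+1 v * (u v + u (- v) - 2 * c)) +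
            \int[lam]_(v in `]d, 2^-1[) (gsk n.+1 v * (u v + u (- v) - 2 * c))) -
    \int[lam]_(v in H) (gsk n.+1 v * (v * (u v - u (- v)))) + c) @[n --> \oo])).
  by apply: near_eq_cvg; apply: nearW => n /=; rewrite eqn.
move: hd; rewrite -cvg_shiftS => hd; move: c2; rewrite -cvg_shiftS => c2.
move: c3; rewrite -cvg_shiftS => c3.
have c4 := cvgD (cvgB (cvgM (@cvg_cst _ (2^-1 : R) _ \oo _) (cvgD hd c3)) c2)
  (@cvg_cst _ (c : R) _ \oo _).
have ec : 2^-1 * (0 + 0) - 0 + c = c by lra.
by rewrite ec in c4; exact: c4.
Qed.

End reflection.

(** * The integral representation of the approximations *)

Section representation.
Context {R : realType}.
Local Notation lam := (@lebesgue_measure R).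
Local Notation bR := (measurableTypeR R).
Local Notation cR := (lebesgueTypeR R).

Lemma measurable_posR : measurable (posR : set bR).
Proof.
have -> : posR = `]0, +oo[%classic :> set R.
  by apply/seteqP; split => t /=; rewrite in_itv/= andbT.
exact: measurable_itv.
Qed.

Lemma expR_tmap (x v : R) : 0 < x -> - 2^-1 < v ->
  expR (- (ln 2 / x * tmap x v)) = 2^-1 + v.
Proof.
move=> x0 v0; rewrite -[RHS]lnK; last by rewrite posrE; lra.
congr expR; rewrite /tmap /log2; field.
by rewrite gt_eqF ?gt_eqF// ln2_gt0.
Qed.

Lemma tmap_gt0 (x v : R) : 0 < x -> vitv v -> 0 < tmap x v.
Proof.
move=> x0; rewrite /vitv/= in_itv/= => /andP[v1 v2].
rewrite /tmap mulNr oppr_gt0 pmulr_rlt0// /log2 pmulr_llt0 ?invr_gt0 ?ln2_gt0//.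
by rewrite ln_lt0//; apply/andP; split; lra.
Qed.

(** The substitution formula applied to the indicator of [N]. *)
Lemma null_tmap (x : R) (N : set R) : 0 < x -> measurable N -> lam N = 0%E ->
  lam (vitv `&` tmap x @^-1` N) = 0%E.
Proof.
move=> x0 mN N0.
have mT : measurable (tmap x @^-1` N).
  by rewrite -[X in measurable X]setTI; exact: measurable_tmap.
have := @ge0_integral_tmap R x x0 (\1_N) (measurable_indic mN) (fun t => _).
move=> /(_ _)/wrap[t|]; first by rewrite indicE ler0n.
rewrite [X in X = _](_ : _ = 0%E); last first.
  rewrite (@ae_eq_integral _ _ _ lam _ (cst 0%E)) ?integral0//.
  - exact: measurable_posR.
  - apply/measurable_EFinP; apply: measurable_funM; first exact: measurable_indic.
    apply: measurable_funM => //; apply: measurableT_comp => //.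
    by apply: measurableT_comp => //; exact: measurable_funM.
  - exists N; split => // t /= /not_implyP[_ H]; apply: contrapT => Nt; apply: H.
    by rewrite indicE memNset// mul0r.
move=> e; rewrite setIC -(integral_indic lam measurable_vitv mT).
exact: esym e.
Qed.

Lemma Rintegral_sum_nat (D : set R) (F : nat -> R -> R) m : measurable D ->
  (forall k, lam.-integrable D (EFin \o F k)) ->
  lam.-integrable D (EFin \o (fun t => \sum_(0 <= k < m) F k t)) /\
  \int[lam]_(t in D) (\sum_(0 <= k < m) F k t) =
  \sum_(0 <= k < m) \int[lam]_(t in D) F k t.
Proof.
move=> mD iF; elim: m => [|m [IH1 IH2]].
  split.
    have := @integrable0 _ _ R lam D; apply: eq_integrable => // t _.
    by rewrite /= big_nil.
  rewrite big_nil /Rintegral (eq_integral (fun=> 0%E)) ?integral0// => t _.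
  by rewrite big_nil.
split.
  have := @integrableD _ _ R lam D mD _ _ IH1 (iF m).
  by apply: eq_integrable => // t _; rewrite /= big_nat_recr.
rewrite [RHS]big_nat_recr//= -IH2 -RintegralD//.
by apply: eq_Rintegral => t _; rewrite big_nat_recr.
Qed.

(** [g] is a Borel version of [f], for which the substitution is available; the null set [N] is kept
    in order to return to [f] later. *)
Lemma gaver_stehfest_Rintegral (f : R -> R) (x : R) : 0 < x ->
  measurable_fun (posR : set cR) (f : cR -> R) -> laplace_exists f ->
  exists (N : set R) (g : R -> R), [/\ measurable N, lam N = 0%E,
    measurable_fun [set: R] g /\ (forall t, 0 < t -> ~ N t -> g t = f t),
    lam.-integrable vitv (EFin \o (g \o tmap x)) &
    forall n, gaver_stehfest f n x =
      \int[lam]_(v in vitv) (g (tmap x v) * ((2^-1 - v) * gsk n v))].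
Proof.
move=> x0 mf fl.
have mP := measurable_posR.
have [N [mN N0 mfN]] := measurable_fun_borel mP mf.
pose g := f \_ (posR `\` N).
have mPN : measurable (posR `\` N : set bR) by exact: measurableD.
have mg : measurable_fun [set: R] g by apply/(measurable_restrictT _ mPN).
have gE t : 0 < t -> ~ N t -> g t = f t.
  by move=> t0 Nt; rewrite /g patchE mem_set.
have gle t : `|g t| <= `|f t|.
  by rewrite /g patchE; case: ifP => // _; rewrite normr0.
pose E z t : R := expR (- (z * t)).
have mE z (D : set R) : measurable_fun D (E z).
  by apply: measurable_funTS; apply: measurableT_comp => //;
    apply: measurableT_comp => //; exact: measurable_funM.
have mEg z (D : set R) : measurable_fun D (fun t => E z t * g t).
  by apply: measurable_funM => //; exact: measurable_funTS.
have ieg z : 0 < z -> lam.-integrable posR (EFin \o (fun t => E z t * g t)).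
  move=> z0; apply/integrableP; split; first by apply/measurable_EFinP; exact: mEg.
  have /integrableP[mEf] := fl z z0; apply: le_lt_trans.
  rewrite -ge0_integral_completed//; last first.
    by apply: measurableT_comp => //; apply/measurable_EFinP; exact: mEg.
  apply: ge0_le_integral => //.
  - exact: measurable_borel_lebesgue.
  - apply: measurable_fun_lebesgue => //.
    by apply: measurableT_comp => //; apply/measurable_EFinP; exact: mEg.
  - exact: measurableT_comp.
  - by move=> t _; rewrite /= lee_fin (normrM (E z t)) (normrM (expR _)) ler_wpM2l.
have leg z : 0 < z -> laplace f z = \int[lam]_(t in posR) (E z t * g t).
  move=> z0; rewrite /laplace /Rintegral -integral_completed//; last first.
    by apply/measurable_EFinP; exact: mEg.
  congr fine; apply: ae_eq_integral.
  - exact: measurable_borel_lebesgue.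
  - exact: measurable_int (fl z z0).
  - by apply: measurable_fun_lebesgue => //; apply/measurable_EFinP; exact: mEg.
  - exists N; split => //; first exact: measurable_borel_lebesgue.
    move=> t /= /not_implyP[t0 H]; apply: contrapT => Nt; apply: H.
    by rewrite gE.
set a := ln 2 / x; have a0 : 0 < a by rewrite divr_gt0// ln2_gt0.
exists N, g; split => //.
  apply: integrable_tmap => //; have := @integrableZl _ _ R lam _ mP a _ (ieg a a0).
  apply: eq_integrable => // t _; rewrite /= -EFinM /E -/a; congr EFin; ring.
move=> n.
pose F k t := a * gs_coef n k.+1 * (E (k.+1%:R * a) t * g t).
have zk k : 0 < k.+1%:R * a by rewrite mulr_gt0.
have iF k : lam.-integrable posR (EFin \o F k).
  have := @integrableZl _ _ R lam _ mP (a * gs_coef n k.+1) _ (ieg _ (zk k)).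
  by apply: eq_integrable.
have [iS eS] := Rintegral_sum_nat (2 * n) mP iF.
have -> : gaver_stehfest f n x = \sum_(0 <= k < 2 * n) \int[lam]_(t in posR) F k t.
  rewrite /gaver_stehfest big_add1/= mulr_sumr; apply: eq_bigr => k _.
  by rewrite /F RintegralZl ?ieg// -mulrA -(leg _ (zk k)) /a !mulrA.
pose w t := E a t.
(* With [w t = e^(- a t)] the Laplace integrands carry the powers [w^k], which [sum_gs_coef] adds
   up. One factor [w] is set aside for the density [a e^(- a t)]. *)
pose h t := g t * (4 * (1 - w t) * sk n (4 * (w t * (1 - w t)))).
have FE t : \sum_(0 <= k < 2 * n) F k t = h t * (a * E a t).
  have := sum_gs_coef n (w t); rewrite big_add1/= => e.
  have -> : h t * (a * E a t) = a * g t *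
     (4 * (w t * (1 - w t)) * sk n (4 * (w t * (1 - w t)))) by rewrite /h /w; ring.
  rewrite -e mulr_sumr; apply: eq_bigr => k _.
  have -> : w t ^+ k.+1 = E (k.+1%:R * a) t.
    by rewrite /w /E -expRM_natl; congr expR; ring.
  by rewrite /F; ring.
have {}eS : \int[lam]_(t in posR) (h t * (a * E a t)) =
    \sum_(0 <= k < 2 * n) \int[lam]_(t in posR) F k t.
  by rewrite -eS; apply: eq_Rintegral => t _; rewrite FE.
rewrite -eS.
have mh : measurable_fun [set: R] h.
  apply: measurable_funM => //; apply: measurable_funM.
    by apply: measurable_funM => //; apply: measurable_funB => //; exact: mE.
  apply: (measurableT_comp (f := sk n)).
    by apply: continuous_measurable_fun; exact: continuous_sk.
  apply: measurable_funM => //; apply: measurable_funM; first exact: mE.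
  by apply: measurable_funB => //; exact: mE.
rewrite (@Rintegral_tmap R x x0 h mh); last first.
  by move: iS; apply: eq_integrable => // t _; rewrite /= FE.
apply: eq_Rintegral => v; rewrite inE /vitv/= in_itv/= => /andP[v1 v2].
rewrite /h /w /E expR_tmap//.
have -> : 4 * ((2^-1 + v) * (1 - (2^-1 + v))) = 1 - 4 * v ^+ 2.
  by field.
have -> : 1 - (2^-1 + v) = 2^-1 - v by field.
by rewrite /gsk; ring.
Qed.

End representation.

(** * Convergence criteria *)

Section convergence.
Context {R : realType}.
Local Notation mu := (@completed_lebesgue_measure R).
Local Notation lam := (@lebesgue_measure R).
Local Notation bR := (measurableTypeR R).
Local Notation cR := (lebesgueTypeR R).

(** The suprema over simple functions are compared directly, so that the lemma applies to integrands
    built from [f \o tmap x], whose measurability is not established. *)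
Lemma ge0_subset_integralS d (T : measurableType d) (m : {measure set T -> \bar R})
  (D E : set T) (f : T -> \bar R) : D `<=` E -> (forall t, E t -> (0 <= f t)%E) ->
  (\int[m]_(t in D) f t <= \int[m]_(t in E) f t)%E.
Proof.
move=> DE f0; rewrite !ge0_integralE//; last by move=> t /DE /f0.
apply: le_ereal_sup => _ [h hf <-] /=; exists h => //= t.
rewrite (le_trans (hf t))// !patchE; case: ifPn => tD.
  by rewrite mem_set//; apply: DE; exact: set_mem.
by case: ifPn => // tE; apply: f0; exact: set_mem.
Qed.

Lemma gaver_stehfest_cvg (f : R -> R) (x c : R) : 0 < x ->
  measurable_fun (posR : set cR) (f : cR -> R) -> laplace_exists f ->
  exists (M : set R) (G : R -> R), [/\ measurable M, lam M = 0%E,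
    measurable_fun [set: R] G,
    (forall v, 0 < v -> v < 2^-1 -> ~ M v ->
       G v = f (tmap x v) + f (tmap x (- v)) - 2 * c) &
    forall d, 0 < d < 2^-1 ->
      \int[lam]_(v in `]0, d]) (gsk n v * G v) @[n --> \oo] --> 0 ->
      gaver_stehfest f n x @[n --> \oo] --> c].
Proof.
move=> x0 fl fL.
have [N [g [mN N0 [mg gE] ig gs]]] := gaver_stehfest_Rintegral x0 fl fL.
(* The points where [f] and [g] may differ after the substitution; the mirror image is added below
   because both [v] and [- v] occur. *)
pose A := vitv `&` tmap x @^-1` N.
have mT : measurable (tmap x @^-1` N).
  by rewrite -[X in measurable X]setTI; exact: measurable_tmap.
have mA : measurable A by apply: measurableI => //; exact: measurable_vitv.
have A0 : lam A = 0%E by exact: null_tmap.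
have mNA : measurable (-%R @^-1` A).
  by rewrite -[X in measurable X]setTI; exact: measurable_oppR.
pose u v := g (tmap x v).
have meas_u : measurable_fun [set: R] u.
  by apply: (measurableT_comp mg); exact: measurable_tmap.
exists (A `|` -%R @^-1` A), (fun v => u v + u (- v) - 2 * c); split.
- exact: measurableU.
- have NA0 : lam (-%R @^-1` A) = 0%E by rewrite -A0; exact: lebesgue_measureN.
  by apply: null_set_setU.
- apply: measurable_funB => //; apply: measurable_funD => //.
  exact: (measurableT_comp meas_u measurable_oppR).
- move=> v v0 v2 nM.
  have vv : vitv v by rewrite /vitv/= in_itv/= v2 andbT; lra.
  have vn : vitv (- v) by rewrite /vitv/= in_itv/=; apply/andP; split; lra.
  rewrite /u !gE ?tmap_gt0//.
    by move=> Nv; apply: nM; right; split.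
  by move=> Nv; apply: nM; left; split.
- move=> d d2 hd; under eq_cvg do rewrite gs.
  exact: gsk_reflection_cvg hd.
Qed.

Lemma gaver_stehfest_dini (f : R -> R) (x c e : R) : 0 < x ->
  measurable_fun (posR : set cR) (f : cR -> R) -> laplace_exists f -> 0 < e -> e <= 2^-1 ->
  (\int[mu]_(v in ([set v | 0 < v < e]%R : set cR))
     (`|f (tmap x v) + f (tmap x (- v)) - 2 * c| * v^-1)%R%:E < +oo)%E ->
  gaver_stehfest f n x @[n --> \oo] --> c.
Proof.
move=> x0 fl fL e0 e2 fin.
have [M [G [mM M0 mG GE h]]] := gaver_stehfest_cvg c x0 fl fL.
(* Halving puts the half-closed []0, d]] inside the given open interval. *)
pose d := e / 2; have d0 : 0 < d by rewrite divr_gt0.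
have de : d < e by rewrite /d ltr_pdivrMr//; lra.
have d2 : d < 2^-1 by exact: lt_le_trans e2.
apply: (h d); first by rewrite d0.
have [C C0 HC] := @sk_le_inv R.
pose D : set R := `]0, d]%classic; have mD : measurable D by exact: measurable_itv.
have mq : measurable_fun D (fun v => `|G v| * v^-1).
  apply: measurable_funM; first by apply: measurable_funTS; exact: measurableT_comp.
  apply: (eq_measurable_fun (fun v => expR (- ln v))) => [v|].
    by rewrite inE /D/= in_itv/= => /andP[v0 _]; rewrite expRN lnK.
  apply: measurable_funTS; apply: measurableT_comp => //.
  by apply: measurableT_comp => //; exact: measurable_ln.
have mqE : measurable_fun D (fun v => (`|G v| * v^-1)%:E) by exact/measurable_EFinP.
have q0 v : D v -> (0 <= (`|G v| * v^-1)%:E)%E.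
  by rewrite /D/= in_itv/= => /andP[v0 _]; rewrite lee_fin mulr_ge0// invr_ge0 ltW.
have iq : lam.-integrable D (EFin \o (fun v => `|G v| * v^-1)).
  apply/integrableP; split => //.
  rewrite [ltLHS](_ : _ = (\int[lam]_(v in D) (`|G v| * v^-1)%:E)%E); last first.
    by apply: eq_integral => v /set_mem/q0; rewrite lee_fin => ?; rewrite /= ger0_norm.
  (* Off [M], [G] equals the expression in [f]; after this replacement the domain is enlarged to the
     whole interval. *)
  rewrite (@ge0_negligible_integral _ bR R lam D M _ mM mD mqE q0 M0).
  rewrite -ge0_integral_completed; [|exact: measurableD| |by move=> t [/q0]].
    apply: le_lt_trans fin.
    rewrite [leLHS](_ : _ = (\int[mu]_(v in (D `\` M : set cR))
        (`|f (tmap x v) + f (tmap x (- v)) - 2 * c| * v^-1)%R%:E)%E).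
      apply: ge0_subset_integralS => [v|v].
        by rewrite /D/= in_itv/= => -[/andP[-> /le_lt_trans ->]].
      by rewrite /= => /andP[v0 _]; rewrite lee_fin mulr_ge0// invr_ge0 ltW.
    apply: eq_integral => v /set_mem[]; rewrite /D/= in_itv/= => /andP[v0 vd] nM.
    by rewrite -GE// (le_lt_trans vd).
  by apply: measurable_funS mqE => // v [].
have DH : D `<=` `]0, 2^-1]%classic.
  by move=> v; rewrite /D /= !in_itv/= => /andP[-> vd]; rewrite (le_trans vd)// ltW.
apply: (proj2 (@gsk_dct _ D G (fun v => C * (`|G v| * v^-1)) mD DH (measurable_funTS mG) _ _)).
- by have := @integrableZl _ _ R lam D mD C _ iq; apply: eq_integrable.
- move=> n v n0; rewrite /D/= in_itv/= => /andP[v0 vd].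
  rewrite (normrM (gsk n v)) (mulrC `|G v|) mulrA ler_wpM2r//.
  by apply: HC => //; rewrite (le_trans vd)// ltW.
Qed.

End convergence.

(** * Dependence on local values *)

Section localization.
Context {R : realType}.
Local Notation mu := (@completed_lebesgue_measure R).
Local Notation cR := (lebesgueTypeR R).

Lemma tmap0 (x : R) : tmap x 0 = x.
Proof.
rewrite /tmap addr0 /log2 lnV ?posrE//.
by field; rewrite gt_eqF// ln2_gt0.
Qed.

Lemma tmap_cvg (x : R) : tmap x v @[v --> 0] --> x.
Proof.
have h : {for 0, continuous (@ln R \o (fun v : R => 2^-1 + v))}.
  apply: continuous_comp; first by apply: cvgD; [exact: cvg_cst|exact: cvg_id].
  by apply: continuous_ln; rewrite addr0 invr_gt0.
rewrite -[X in _ --> X]tmap0; apply: (@cvgM R); first exact: cvg_cst.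
by apply: (@cvgM R); [exact: h|exact: cvg_cst].
Qed.

Lemma tmap_anti (x v w : R) : 0 < x -> - 2^-1 < v -> v <= w -> tmap x w <= tmap x v.
Proof.
move=> x0 v0 vw; rewrite /tmap !mulNr lerN2 ler_pM2l// /log2 ler_pM2r ?invr_gt0 ?ln2_gt0//.
by rewrite ler_ln ?posrE; lra.
Qed.

Lemma tmap_lt_self (x v : R) : 0 < x -> 0 < v -> tmap x v < x.
Proof.
move=> x0 v0; rewrite -[X in _ < X]tmap0 /tmap !mulNr ltrN2 ltr_pM2l// /log2.
by rewrite ltr_pM2r ?invr_gt0 ?ln2_gt0// ltr_ln ?posrE; lra.
Qed.

Lemma tmap_gt_self (x v : R) : 0 < x -> - 2^-1 < v -> v < 0 -> x < tmap x v.
Proof.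
move=> x0 v0 v1; rewrite -[X in X < _]tmap0 /tmap !mulNr ltrN2 ltr_pM2l// /log2.
by rewrite ltr_pM2r ?invr_gt0 ?ln2_gt0// ltr_ln ?posrE; lra.
Qed.

Lemma near_tmap (x : R) (P : set R) : (\forall y \near x, P y) ->
  exists2 e, 0 < e <= 2^-1 & forall v, 0 < v -> v < e -> P (tmap x v) /\ P (tmap x (- v)).
Proof.
move=> /tmap_cvg/nbhs_ballP[e /= e0 h].
exists (Num.min e 2^-1); first by rewrite lt_min e0 invr_gt0 ltr0n/= ge_min lexx orbT.
move=> v v0; rewrite lt_min => /andP[ve _].
by split; apply: h; rewrite /ball/= sub0r ?opprK ?normrN gtr0_norm.
Qed.

(** With [c = 0] the integrand of the Dini condition is zero near the origin. *)
Lemma gaver_stehfest_vanishing (k : R -> R) (x : R) : 0 < x ->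
  measurable_fun (posR : set cR) (k : cR -> R) -> laplace_exists k ->
  (\forall y \near x, k y = 0) -> gaver_stehfest k n x @[n --> \oo] --> 0.
Proof.
move=> x0 mk kL /near_tmap[e /andP[e0 e2] h].
apply: (gaver_stehfest_dini x0 mk kL e0 e2).
rewrite integral0_eq ?ltry// => v /= /andP[v0 ve].
by have [-> ->] := h _ v0 ve; rewrite mulr0 addr0 subr0 normr0 mul0r.
Qed.

Lemma laplace_existsB (f h : R -> R) : laplace_exists f -> laplace_exists h ->
  laplace_exists (f \- h).
Proof.
move=> fL hL z z0.
have mP : measurable (posR : set cR) by apply: measurable_borel_lebesgue; exact: measurable_posR.
have := @integrableB _ _ R mu posR mP _ _ (fL z z0) (hL z z0).
by apply: eq_integrable => // t _; rewrite /= -EFinB -mulrBr.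
Qed.

Lemma gaver_stehfestB (f h : R -> R) n (x : R) : 0 < x ->
  laplace_exists f -> laplace_exists h ->
  gaver_stehfest (f \- h) n x = gaver_stehfest f n x - gaver_stehfest h n x.
Proof.
move=> x0 fL hL; rewrite /gaver_stehfest -mulrBr -sumrB; congr (_ * _).
rewrite !big_add1; apply: eq_bigr => k _; rewrite -mulrBr; congr (_ * _).
have z0 : 0 < k.+1%:R * ln 2 / x by rewrite divr_gt0// mulr_gt0// ln2_gt0.
have mP : measurable (posR : set cR) by apply: measurable_borel_lebesgue; exact: measurable_posR.
rewrite /laplace -RintegralB//; [|exact: fL|exact: hL].
by apply: eq_Rintegral => t _; rewrite -mulrBr.
Qed.

Lemma gaver_stehfest_local (f h : R -> R) (x c : R) : 0 < x ->
  measurable_fun (posR : set cR) (f : cR -> R) -> laplace_exists f ->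
  measurable_fun (posR : set cR) (h : cR -> R) -> laplace_exists h ->
  (\forall y \near x, h y = f y) ->
  gaver_stehfest f n x @[n --> \oo] --> c -> gaver_stehfest h n x @[n --> \oo] --> c.
Proof.
move=> x0 mf fL mh hL hf fc.
have d0 : gaver_stehfest (h \- f) n x @[n --> \oo] --> 0.
  apply: gaver_stehfest_vanishing => //.
  - exact: measurable_funB.
  - exact: laplace_existsB.
  - by apply: filterS hf => y /= ->; rewrite subrr.
have e : (fun n => gaver_stehfest h n x) =
    (fun n => gaver_stehfest (h \- f) n x + gaver_stehfest f n x).
  by apply/funext => n; rewrite gaver_stehfestB// subrK.
by rewrite e -[c]add0r; exact: cvgD.
Qed.

End localization.

(** * Functions of bounded variation *)

Section bounded_variation.
Context {R : realType}.
Local Notation lam := (@lebesgue_measure R).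
Local Notation cR := (lebesgueTypeR R).

(** [phi v / v] may fail to be integrable at [0], so dominated convergence is used on []s, d]] only;
    on []0, s]] the second mean value bound [2 M phi(s)] is small uniformly in [n]. *)
Lemma gsk_nondecreasing_cvg0 (d : R) (phi : R -> R) : 0 < d -> d <= 2^-1 ->
  {in `]0, d] &, {homo phi : v w / v <= w}} ->
  (forall v, v \in `]0, d] -> 0 <= phi v) ->
  phi v @[v --> 0^'+] --> 0 ->
  (forall n, (0 < n)%N -> lam.-integrable `]0, d]%classic (EFin \o (fun v => gsk n v * phi v))) /\
  \int[lam]_(v in `]0, d]) (gsk n v * phi v) @[n --> \oo] --> 0.
Proof.
move=> d0 d2 ndphi phi0 cphi.
have mphi : measurable_fun `]0, d]%classic phi.
  exact: (@nondecreasing_measurable R `]0, d]).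
have dd : d \in `]0, d] by rewrite in_itv/= d0 lexx.
have phib v : 0 < v -> v <= d -> `|phi v| <= phi d.
  move=> v0 vd; have vi : v \in `]0, d] by rewrite in_itv/= v0.
  by rewrite ger0_norm ?phi0// ndphi.
have subH : `]0, d]%classic `<=` (`]0, 2^-1]%classic : set R).
  by move=> v; rewrite /= !in_itv/= => /andP[-> vd]; exact: le_trans d2.
have iphi : lam.-integrable `]0, d]%classic (EFin \o phi).
  exact: bounded_integrable_itv phib.
have ig n : (0 < n)%N -> lam.-integrable `]0, d]%classic (EFin \o (fun v => gsk n v * phi v)).
  by move=> n0; exact: integrable_gsk.
split => //.
have [M M0 HM] := @sk_prim_le R.
have [C C0 HC] := @sk_le_inv R.
apply/cvgrPdist_le => e e0.
have q0 : 0 < 2 * M + 1 by rewrite ltr_wpDl// mulr_ge0.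
have e1 : 0 < e / 2 / (2 * M + 1) by rewrite !divr_gt0.
move/cvgrPdist_le : cphi => /(_ _ e1); rewrite near_withinE => /nbhs_ballP[r /= r0 hr].
pose s := Num.min (r / 2) (d / 2).
have s0 : 0 < s by rewrite lt_min !divr_gt0.
have sr : s < r by rewrite gt_min; apply/orP; left; lra.
have sd : s < d by rewrite gt_min; apply/orP; right; lra.
have phis : phi s <= e / 2 / (2 * M + 1).
  have := hr s; rewrite /ball/= !sub0r !normrN gtr0_norm// => /(_ sr s0).
  by apply: le_trans; rewrite ler_norm.
have mE : measurable (`]s, d]%classic : set R) by [].
have ED : `]s, d]%classic `<=` (`]0, d]%classic : set R).
  by move=> v; rewrite /= !in_itv/= => /andP[/(lt_trans s0) -> ->].
have : \int[lam]_(v in `]s, d]) (gsk n v * phi v) @[n --> \oo] --> 0.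
  apply: (proj2 (@gsk_dct _ _ phi (fun=> C / s * phi d) mE (subset_trans ED subH)
    (measurable_funS _ ED mphi) _ _)) => //.
  - exact: (@bounded_integrable_itv _ _ _ `|C / s * phi d|).
  - move=> n v n0; rewrite /= in_itv/= => /andP[sv vd].
    have v0 := lt_trans s0 sv.
    rewrite (normrM (gsk n v)) ler_pM//; last exact: phib.
    rewrite (le_trans (HC n v n0 v0 (le_trans vd d2)))// ler_wpM2l//.
    by rewrite lef_pV2 ?posrE// ltW.
move=> /cvgrPdist_le/(_ _ (divr_gt0 e0 (ltr0n R 2))); apply: filterS2 (nbhs_infty_gt 1) => n n1.
rewrite !sub0r !normrN => h.
have n0 : (0 < n)%N by exact: ltn_trans n1.
have b1 : (BRight 0 <= BRight s :> itv_bound R)%O by rewrite bnd_simp ltW.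
have b2 : (BRight s <= BRight d :> itv_bound R)%O by rewrite bnd_simp ltW.
have := Rintegral_itvB (ig n n0) b1 b2.
move=> /eqP; rewrite subr_eq => /eqP ->.
have h2 : `|\int[lam]_(v in `]0, s]) (gsk n v * phi v)| <= 2 * M * phi s.
  apply: Rintegral_nondecreasing_gsk => //.
  - by rewrite (le_trans (ltW sd)).
  - by move=> v v0 v2; apply: HM.
  - move=> v w; rewrite !in_itv/= => /andP[v0 vs] /andP[w0 ws]; apply: ndphi.
      by rewrite in_itv/= v0 (le_trans vs)// ltW.
    by rewrite in_itv/= w0 (le_trans ws)// ltW.
  - by move=> v; rewrite in_itv/= => /andP[v0 vs]; rewrite phi0// in_itv/= v0 (le_trans vs)// ltW.
have h3 : 2 * M * phi s <= e / 2.
  have p0 : 0 <= phi s by rewrite phi0// in_itv/= s0 ltW.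
  move: phis; rewrite ler_pdivlMr// => hh.
  by apply: le_trans hh; rewrite mulrDr mulr1 mulrC lerDl.
rewrite (le_trans (ler_normD _ _))// [leRHS](splitr e) lerD//.
exact: le_trans h2 h3.
Qed.

Lemma nondecreasing_lim_right (f : R -> R) (a b : R) : a < b ->
  {in `[a, b] &, {homo f : v w / v <= w}} ->
  exists l, f y @[y --> a^'+] --> l /\ forall t, a < t -> t < b -> l <= f t.
Proof.
move=> ab ndf.
have lb : has_lbound (f @` `]a, b[%classic).
  exists (f a) => y [t /=]; rewrite in_itv/= => /andP[at_ tb] <-.
  by apply: ndf; rewrite ?in_itv/= ?lexx ?ltW.
exists (inf (f @` `]a, b[%classic)); split.
  apply: (@nondecreasing_at_right_cvgr _ _ _ (BLeft b)) => //.
  by apply: sub_in2 ndf => v; rewrite !in_itv/= => /andP[/ltW -> /ltW ->].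
move=> t at_ tb; apply: ge_inf => //; exists t => //=.
by rewrite in_itv/= at_.
Qed.

Lemma nondecreasing_lim_left (f : R -> R) (a b : R) : a < b ->
  {in `[a, b] &, {homo f : v w / v <= w}} ->
  exists l, f y @[y --> b^'-] --> l /\ forall t, a < t -> t < b -> f t <= l.
Proof.
move=> ab ndf.
have [||l [cl hl]] := @nondecreasing_lim_right (\- (f \o -%R)) (- b) (- a).
- by rewrite ltrN2.
- move=> v w; rewrite !in_itv/= => /andP[v1 v2] /andP[w1 w2] vw.
  rewrite lerN2; apply: ndf; rewrite ?in_itv/= ?lerN2// lerNr ?opprK.
  + by rewrite w2 lerNl.
  + by rewrite v2 lerNl.
exists (- l); split.
  apply/cvg_at_leftNP; have -> : f \o -%R = \- (\- (f \o -%R)).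
    by apply/funext => y /=; rewrite opprK.
  exact: cvgN cl.
move=> t at_ tb; have := hl (- t); rewrite !ltrN2 /= opprK => /(_ tb at_).
by rewrite lerNr.
Qed.

Lemma tmap_cvg_left (x : R) : 0 < x -> tmap x v @[v --> 0^'+] --> x^'-.
Proof.
move=> x0 P xP.
have /near_tmap[e /andP[e0 e2] h] : \forall y \near x, y < x -> P y by exact: xP.
suff : \forall v \near 0^'+, P (tmap x v) by [].
near=> v; have v0 : 0 < v by near: v; exact: nbhs_right_gt.
have ve : v < e by near: v; exact: nbhs_right_lt.
by have [+ _] := h v v0 ve; apply; exact: tmap_lt_self.
Unshelve. all: by end_near. Qed.

Lemma tmap_cvg_right (x : R) : 0 < x -> tmap x (- v) @[v --> 0^'+] --> x^'+.
Proof.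
move=> x0 P xP.
have /near_tmap[e /andP[e0 e2] h] : \forall y \near x, x < y -> P y by exact: xP.
suff : \forall v \near 0^'+, P (tmap x (- v)) by [].
near=> v; have v0 : 0 < v by near: v; exact: nbhs_right_gt.
have ve : v < e by near: v; exact: nbhs_right_lt.
have [_ +] := h v v0 ve; apply; apply: tmap_gt_self => //; first by lra.
by rewrite oppr_lt0.
Unshelve. all: by end_near. Qed.

(** [tmap x] is decreasing, so for nondecreasing [g] both [g (tmap x (- v)) - g(x+0)] and
    [g(x-0) - g (tmap x v)] are nonnegative, nondecreasing in [v > 0] and tend to [0]. For
    [f = A - B] the symmetric expression is a difference of two such functions: one pairs [A] on the
    right of [x] with [B] on the left, the other exchanges the roles. *)
Lemma gaver_stehfest_bounded_variation (f : R -> R) (x d : R) : 0 < x ->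
  measurable_fun (posR : set cR) (f : cR -> R) -> laplace_exists f ->
  0 < d -> bounded_variation (x - d) (x + d) f ->
  exists lr ll, [/\ f y @[y --> x^'+] --> lr, f y @[y --> x^'-] --> ll &
    gaver_stehfest f n x @[n --> \oo] --> (lr + ll) / 2].
Proof.
move=> x0 mf fL d0 bvf.
pose A := fine \o pos_tv (x - d) f; pose B := fine \o neg_tv (x - d) f.
have fAB y : x - d <= y -> y <= x + d -> f y = A y - B y.
  move=> y1 y2; have /(_ y) := bounded_variation_pos_neg_tvE bvf.
  by rewrite in_itv/= y1 y2 => ->.
have ndB : {in `[x - d, x + d] &, {homo B : v w / v <= w}}.
  exact: fine_neg_tv_nondecreasing.
have ndA : {in `[x - d, x + d] &, {homo A : v w / v <= w}}.
  (* [pos_tv] of [f] is [neg_tv] of [- f]. *)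
  by apply: fine_neg_tv_nondecreasing; exact/bounded_variationN.
have xr : x < x + d by rewrite ltrDl.
have xl : x - d < x by rewrite ltrBlDr.
have right (g : R -> R) : {in `[x - d, x + d] &, {homo g : v w / v <= w}} ->
    exists l, g y @[y --> x^'+] --> l /\ forall t, x < t -> t < x + d -> l <= g t.
  move=> ndg; apply: nondecreasing_lim_right => //; apply: sub_in2 ndg => v.
  by rewrite !in_itv/= => /andP[h ->]; rewrite andbT (le_trans (ltW xl)).
have left (g : R -> R) : {in `[x - d, x + d] &, {homo g : v w / v <= w}} ->
    exists l, g y @[y --> x^'-] --> l /\ forall t, x - d < t -> t < x -> g t <= l.
  move=> ndg; apply: nondecreasing_lim_left => //; apply: sub_in2 ndg => v.
  by rewrite !in_itv/= => /andP[-> h] /=; rewrite (le_trans h)// ltW.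
have [Ar [cAr hAr]] := right A ndA; have [Br [cBr hBr]] := right B ndB.
have [Al [cAl hAl]] := left A ndA; have [Bl [cBl hBl]] := left B ndB.
have fr : f y @[y --> x^'+] --> Ar - Br.
  apply: (@cvg_trans _ ((A y - B y) @[y --> x^'+])); last exact: cvgB.
  apply: near_eq_cvg; near=> y; rewrite fAB//.
    by rewrite (le_trans (ltW xl)).
  by near: y; exact: nbhs_right_le.
have fl : f y @[y --> x^'-] --> Al - Bl.
  apply: (@cvg_trans _ ((A y - B y) @[y --> x^'-])); last exact: cvgB.
  apply: near_eq_cvg; near=> y; rewrite fAB//.
    by near: y; exact: nbhs_left_ge.
  by rewrite (le_trans _ (ltW xr)).
exists (Ar - Br), (Al - Bl); split => //.
set c := _ / 2.
have /near_tmap[e /andP[e0 e2] he] : \forall y \near x, x - d < y < x + d.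
  have : y @[y --> x] --> x by exact: cvg_id.
  by move=> /cvgr_dist_lt/(_ _ d0); apply: filterS => y; rewrite ltr_distlC.
pose s := e / 2; have s0 : 0 < s by rewrite divr_gt0.
have se : s < e by rewrite /s ltr_pdivrMr//; lra.
have s2 : s < 2^-1 by exact: lt_le_trans e2.
have in1 v : v \in `]0, s] -> [/\ x - d < tmap x v, tmap x v < x, x < tmap x (- v),
    tmap x (- v) < x + d & (0 < v) && (v <= s)].
  rewrite in_itv/= => /andP[v0 vs]; have ve := le_lt_trans vs se.
  have [/andP[-> _] /andP[_ ->]] := he v v0 ve.
  rewrite tmap_lt_self// tmap_gt_self ?oppr_lt0// ?v0//; by lra.
have phiP (g h : R -> R) gr hl :
    {in `[x - d, x + d] &, {homo g : v w / v <= w}} ->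
    {in `[x - d, x + d] &, {homo h : v w / v <= w}} ->
    g y @[y --> x^'+] --> gr -> h y @[y --> x^'-] --> hl ->
    (forall t, x < t -> t < x + d -> gr <= g t) ->
    (forall t, x - d < t -> t < x -> h t <= hl) ->
    let phi v := g (tmap x (- v)) - gr + (hl - h (tmap x v)) in
    (forall n, (0 < n)%N -> lam.-integrable `]0, s]%classic (EFin \o (fun v => gsk n v * phi v))) /\
    \int[lam]_(v in `]0, s]) (gsk n v * phi v) @[n --> \oo] --> 0.
  move=> ndg ndh cg ch hg hh phi; apply: gsk_nondecreasing_cvg0 => //.
  - exact: ltW.
  - move=> v w /in1[v1 v2 v3 v4 /andP[v5 v6]] /in1[w1 w2 w3 w4 /andP[w5 w6]] vw.
    rewrite /phi lerD// ?lerD2r ?lerD2l ?lerN2.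
      apply: ndg; rewrite ?in_itv/= ?(ltW v4) ?(ltW w4) ?andbT.
      + by rewrite (le_trans (ltW xl))// ltW.
      + by rewrite (le_trans (ltW xl))// ltW.
      + by apply: tmap_anti => //; lra.
    apply: ndh; rewrite ?in_itv/= ?(ltW v1) ?(ltW w1)/=.
    + by rewrite (le_trans _ (ltW xr))// ltW.
    + by rewrite (le_trans _ (ltW xr))// ltW.
    + by apply: tmap_anti => //; lra.
  - move=> v /in1[v1 v2 v3 v4 _].
    by rewrite /phi addr_ge0// subr_ge0; [exact: hg|exact: hh].
  - have e1 : g (tmap x (- v)) @[v --> 0^'+] --> gr.
      exact: (cvg_comp _ _ (tmap_cvg_right x0) cg).
    have e3 : h (tmap x v) @[v --> 0^'+] --> hl.
      exact: (cvg_comp _ _ (tmap_cvg_left x0) ch).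
    have := cvgD (cvgB e1 (@cvg_cst _ gr _ (0^'+) _)) (cvgB (@cvg_cst _ hl _ (0^'+) _) e3).
    by rewrite !subrr addr0; exact.
have [i1 c1] := phiP A B Ar Bl ndA ndB cAr cBl hAr hBl.
have [i2 c2] := phiP B A Br Al ndB ndA cBr cAl hBr hAl.
have [M [G [mM M0 mG GE h]]] := gaver_stehfest_cvg c x0 mf fL.
apply: (h s); first by rewrite s0.
move: c1; rewrite -cvg_shiftS => c1; move: c2; rewrite -cvg_shiftS => c2.
suff eG n : \int[lam]_(v in `]0, s]) (gsk n.+1 v * G v) =
    \int[lam]_(v in `]0, s]) (gsk n.+1 v * (A (tmap x (- v)) - Ar + (Bl - B (tmap x v)))) -
    \int[lam]_(v in `]0, s]) (gsk n.+1 v * (B (tmap x (- v)) - Br + (Al - A (tmap x v)))).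
  rewrite -cvg_shiftS.
  have -> : [sequence \int[lam]_(v in `]0, s]) (gsk n.+1 v * G v)]_n = _ := funext eG.
  by have c3 := cvgB c1 c2; rewrite subr0 in c3; exact: c3.
rewrite -RintegralB//; [|exact: i1|exact: i2].
rewrite /Rintegral; congr fine.
have iB := @integrableB _ _ R lam `]0, s]%classic _ _ _ (i1 n.+1 isT) (i2 n.+1 isT).
apply: ae_eq_integral => //.
- by apply/measurable_EFinP; apply: measurable_funM; [exact: measurable_gsk|exact: measurable_funTS].
- exact: measurable_int (iB _).
exists M; split => // v /= /not_implyP[vs hv]; apply: contrapT => nM; apply: hv.
have [v1 v2 v3 v4 /andP[v5 v6]] := in1 v vs.
rewrite GE//; last exact: le_lt_trans s2.
rewrite !fAB ?(ltW v1) ?(ltW v4)//.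
- rewrite -mulrBr /c; congr (EFin (_ * _)); field.
- by [].
- by rewrite (le_trans (ltW xl))// ltW.
- by rewrite (le_trans _ (ltW xr))// ltW.
Unshelve. all: by end_near. Qed.

End bounded_variation.

Theorem theorem1 (R : realType) (f : R -> R) (x : R)
    (f_loc : llocally_integrable posR f)
    (f_lap : laplace_exists f) (x_gt0 : 0 < x) :
  [/\ (forall h : R -> R,
        llocally_integrable posR h ->
        laplace_exists h ->
        (\forall y \near x, h y = f y) ->
        forall c : R,
          (gaver_stehfest f n x @[n --> \oo] --> c) <->
          (gaver_stehfest h n x @[n --> \oo] --> c)),
      (forall c e : R, 0 < e < 4^-1 ->
        (\int[@completed_lebesgue_measure R]_(v in
             ([set v | 0 < v < e]%R : set (lebesgueTypeR R)))
           (`|f (- x * log2 (2^-1 + v)) + f (- x * log2 (2^-1 - v)) - 2 * c|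
              * v^-1)%R%:E < +oo)%E ->
        gaver_stehfest f n x @[n --> \oo] --> c)
    & ((exists2 d : R, 0 < d < x & bounded_variation (x - d) (x + d) f) ->
        [/\ cvg (f y @[y --> x^'+]), cvg (f y @[y --> x^'-])
          & gaver_stehfest f n x @[n --> \oo] -->
              (lim (f y @[y --> x^'+]) + lim (f y @[y --> x^'-])) / 2])].
Proof.
have [mf _ _] := f_loc; split.
- move=> h [mh _ _] hL hf c; split; first exact: gaver_stehfest_local.
  by apply: gaver_stehfest_local => //; apply: filterS hf => y /esym.
- move=> c e /andP[e0 e4] fin; apply: (gaver_stehfest_dini x_gt0 mf f_lap e0 _ fin).
  by rewrite (le_trans (ltW e4))// lef_pV2 ?posrE// ler_nat.
- move=> [d /andP[d0 _] bvf].
  have [lr [ll [hr hl hc]]] := gaver_stehfest_bounded_variation x_gt0 mf f_lap d0 bvf.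
  by rewrite (cvg_lim _ hr)// (cvg_lim _ hl)//; split.
Qed.
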